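(* Let $\mathbb K=[-1,1]$, $H(x,p)=\frac{1-x}2(e^{2p}-1)+\frac{1+x}2(e^{-2p}-1)$ and $I_0(x)=\frac{1-x}2\log(1-x)+\frac{1+x}2\log(1+x)-\frac12\alpha x^2-\theta x+C$. (a) For $\alpha\ge0$ and $\theta\in\mathbb R$ such that $I_0'(x)=0$ has a unique solution in $(-1,1)$, there is $t^*$ such that $I_t\in C^{1,\partial}[-1,1]$ for all $t\ge t^*$. (b) For every $\alpha>1$ there is $\kappa>0$ such that for every $\theta$ with $|\theta|>\kappa$ there are times $t_0<t_1\le t_2$ with: (i) $I_t\in C^{1,\partial}[-1,1]$ for $t<t_0$; (ii) $\mathcal G_t$ has an overhang for every $t\in(t_0,t_2)$, and $I_t$ is not differentiable (on $(-1,1)$) for every $t\in(t_0,t_1)$; (iii) $I_t\in C^{1,\partial}[-1,1]$ for $t>t_2$.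
   Context: $C$ is chosen such that $\inf_{[-1,1]}I_0=0$. For $H$, $\mathcal L(x,v)=\sup_p(pv-H(x,p))$; for $t>0$, $S_t(a,b)=\inf\int_0^t\mathcal L(\gamma,\dot\gamma)\,ds$ over absolutely continuous $\gamma:[0,t]\to[-1,1]$ with $\gamma(0)=a,\gamma(t)=b$, and $I_t(b)=\inf_{x\in[-1,1]}(I_0(x)+S_t(x,b))$. $C^{1,\partial}[-1,1]$: continuous $g:[-1,1]\to\mathbb R$, $C^1$ on $(-1,1)$, with $g'(x)\to+\infty$ as $x\to1$ and $g'(x)\to-\infty$ as $x\to-1$. The Hamilton flow $(X_t^{x,p},P_t^{x,p})$ solves $\dot X=\partial_pH(X,P)$, $\dot P=-\partial_xH(X,P)$ from $(x,p)$ on its maximal interval $[0,t_{x,p})$. $\mathcal G=\{(x,I_0'(x)):x\in(-1,1)\}$, $\mathcal G_t=\{(X_t^{x,p},P_t^{x,p}):(x,p)\in\mathcal G,t<t_{x,p}\}$; $\mathcal G_t$ has an overhang (at $x$) if there are $y_1\ne y_2$ with $(x,y_1),(x,y_2)\in\mathcal G_t$. *)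

(* Defs.v *)
From Stdlib Require Import Reals Lra Classical ClassicalEpsilon.
Open Scope R_scope.

Fixpoint sumN (f : nat -> R) (n : nat) : R :=
  match n with O => 0 | S m => sumN f m + f m end.

Definition is_glb (E : R -> Prop) (m : R) : Prop :=
  (forall x, E x -> m <= x) /\ (forall m', (forall x, E x -> m' <= x) -> m' <= m).

(* the infimum of E (meaningful whenever E is nonempty and bounded below) *)
Definition glb (E : R -> Prop) : R := epsilon (inhabits 0) (is_glb E).

Definition cover_length (A : R -> Prop) (s : R) : Prop :=
  exists a b : nat -> R,
    (forall n, a n <= b n) /\
    (forall x, A x -> exists n, a n < x < b n) /\
    infinite_sum (fun n => b n - a n) s.

Definition leb_measure (A : R -> Prop) : R := glb (cover_length A).

(* Lebesgue integral over [0,t] of a nonnegative (measurable) function f,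
   given through its super-level sets: Gt y s  <->  f s > y.
   Layer-cake formula  int_0^t f = int_0^oo |{s in [0,t] : f s > y}| dy ;
   the map y |-> |{f > y}| is nonincreasing, so its (improper) integral is the
   supremum of its right-endpoint (= lower) Riemann sums on uniform grids.
   [integral_0t Gt t c] means the integral is finite and equals c. *)
Definition lower_sum (Gt : R -> R -> Prop) (t v : R) : Prop :=
  exists (N : nat) (h : R), 0 < h /\
    v = sumN (fun k => h * leb_measure (fun s => 0 <= s <= t /\ Gt (INR (S k) * h) s)) N.

Definition integral_0t (Gt : R -> R -> Prop) (t c : R) : Prop :=
  is_lub (lower_sum Gt t) c.

Definition abs_cont_on (g : R -> R) (t : R) : Prop :=
  forall eps, 0 < eps -> exists delta, 0 < delta /\
    forall (n : nat) (a b : nat -> R),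
      (forall i, (i < n)%nat -> 0 <= a i /\ a i <= b i /\ b i <= t) ->
      (forall i j, (i < j)%nat -> (j < n)%nat -> b i <= a j) ->
      sumN (fun i => b i - a i) n < delta ->
      sumN (fun i => Rabs (g (b i) - g (a i))) n < eps.

Definition Ham (x p : R) : R :=
  (1 - x) / 2 * (exp (2 * p) - 1) + (1 + x) / 2 * (exp (- 2 * p) - 1).

(* L(x,v) > y, where L(x,v) = sup_p (p v - H(x,p)) (possibly +infinity) *)
Definition Lag_gt (x v y : R) : Prop := exists p, p * v - Ham x p > y.

(* initial rate function without the normalising constant
   (0 * ln 0 = 0 automatically, since the factor in front vanishes) *)
Definition J0 (alpha theta x : R) : R :=
  (1 - x) / 2 * ln (1 - x) + (1 + x) / 2 * ln (1 + x)
  - 1 / 2 * alpha * x ^ 2 - theta * x.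

(* C is chosen such that inf_{[-1,1]} I_0 = 0 *)
Definition Cst (alpha theta : R) : R :=
  - glb (fun v => exists x, -1 <= x <= 1 /\ v = J0 alpha theta x).

Definition I0 (alpha theta x : R) : R := J0 alpha theta x + Cst alpha theta.

(* super-level sets of s |-> L(gamma s, gamma' s) on (0,t)
   (gamma' exists a.e. for absolutely continuous gamma; the null set where it
    does not exist contributes nothing) *)
Definition action_gt (gamma : R -> R) (t : R) (y s : R) : Prop :=
  0 < s < t /\ exists v, derivable_pt_lim gamma s v /\ Lag_gt (gamma s) v y.

Definition admissible (t a b : R) (gamma : R -> R) : Prop :=
  (forall s, 0 <= s <= t -> -1 <= gamma s <= 1) /\
  gamma 0 = a /\ gamma t = b /\ abs_cont_on gamma t.

(* I_t(b) = inf_x ( I_0(x) + S_t(x,b) ),  S_t(x,b) = inf_gamma int_0^t L(gamma, gamma');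
   paths of infinite action do not affect the infimum.  For t <= 0, I_t := I_0. *)
Definition It (alpha theta t b : R) : R :=
  if Rlt_dec 0 t then
    glb (fun v => exists x gamma c,
           -1 <= x <= 1 /\ admissible t x b gamma /\
           integral_0t (action_gt gamma t) t c /\ v = I0 alpha theta x + c)
  else I0 alpha theta b.

Definition C1partial (g : R -> R) : Prop :=
  (forall x, -1 <= x <= 1 -> forall eps, 0 < eps -> exists delta, 0 < delta /\
     forall y, -1 <= y <= 1 -> Rabs (y - x) < delta -> Rabs (g y - g x) < eps) /\
  exists g' : R -> R,
    (forall x, -1 < x < 1 -> derivable_pt_lim g x (g' x) /\ continuity_pt g' x) /\
    (forall M, exists delta, 0 < delta /\ forall x, 1 - delta < x < 1 -> M < g' x) /\
    (forall M, exists delta, 0 < delta /\ forall x, -1 < x < -1 + delta -> g' x < M).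

(* (X,P) solves Xdot = d_p H(X,P), Pdot = - d_x H(X,P) on an open interval
   containing [0,t] (for this smooth Hamiltonian this holds iff t < t_{x,p}) *)
Definition hamilton_sol (t : R) (X P : R -> R) : Prop :=
  exists eps, 0 < eps /\ forall s, -eps < s < t + eps ->
    exists dX dP,
      derivable_pt_lim X s dX /\ derivable_pt_lim P s dP /\
      derivable_pt_lim (fun q => Ham (X s) q) (P s) dX /\
      derivable_pt_lim (fun z => Ham z (P s)) (X s) (- dP).

Definition Gt (alpha theta t y q : R) : Prop :=
  exists x p, -1 < x < 1 /\ derivable_pt_lim (I0 alpha theta) x p /\
    exists X P, X 0 = x /\ P 0 = p /\ hamilton_sol t X P /\ X t = y /\ P t = q.

Definition overhang (alpha theta t : R) : Prop :=
  exists x y1 y2, y1 <> y2 /\ Gt alpha theta t x y1 /\ Gt alpha theta t x y2.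

(* Main.v *)
From Stdlib Require Import Reals Lra Lia Psatz Classical ClassicalEpsilon.
From Coquelicot Require Import Coquelicot.
From Stdlib Require Import List.
Require Import Defs.
Import ListNotations.
Open Scope R_scope.

(** A product measure with field h stays a product measure under
    independent spin flips; its rate functions [U h] solve the Hamilton-Jacobi equation exactly and
    depend on b affinely apart from the entropy [ent b]. Since - alpha x^2 / 2 is the minimum over m of
    alpha m^2 / 2 - alpha m x, the initial rate function is a minimum of such product rate functions, and
    I_t (b) = C + min_m (alpha m^2 / 2 + U (alpha m + theta) t b) = C + ent b - (convex function of b).
    The critical points in m of this minimum are the solutions of X_t (m) = b, where X_t (m) is the
    position at time t of the characteristic issued from (m, I_0'(m)). Hence I_t is C^1 when X_t is
    increasing where it takes values in (-1,1), while a fold of X_t inside (-1,1) makes the minimiser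
    jump and I_t non-differentiable. What remains is the shape of
    X_t (m) = m cosh 2t + sinh 2t (m cosh 2h - sinh 2h), with h = alpha m + theta.

    The lower bound on the action of an arbitrary path compares it with the increment of [U h] along
    the path. As only pointwise derivatives enter the action, this needs Lebesgue's theorem that
    absolutely continuous functions are differentiable almost everywhere; it is proved by Austin's
    argument, from Vitali's covering lemma, and null sets are handled through gauges so that Cousin's
    lemma gives the integral inequality without any measurability. *)

(** The slope of X_t in m is cosh 2t + sinh 2t d(m), where the profile d does not depend on t; every
    statement on folds compares this one function with - coth 2t. For a large positive field d has a
    single valley, with bottom m0, and t0 is the time at which coth 2t falls to - d(m0). The
    threshold |theta| > 2 alpha gives, after reflection, alpha m + theta > alpha on [-1,1]; this
    yields the single valley and a negative drift for all m <= m0. Hence the characteristics issued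
    from the left of m0 leave through -1 and never return, and t2 is the supremum of the times at
    which one of them is still inside. For the jump of the minimiser, X_t must stay above some b1 >
    -1 on the right of m0, which holds for a while after t0; this is the origin of t1. An overhang
    asks only for two characteristics meeting inside (-1,1), and lasts until t2.

    In the long run X_t is exp (-2t) m plus sinh 2t times a drift that vanishes, inside (-1,1),
    exactly at the critical points of I_0. A unique critical point leaves one place from which
    characteristics survive, and the delicate case is that of a degenerate zero of the drift
    there. *)

(** * Finite sums, series and sums over lists *)

Lemma Rdiv_mult (x y : R) : y <> 0 -> x / y * y = x.
Proof. intros Hy. field. exact Hy. Qed.

Lemma sumN_sum_f_R0 (f : nat -> R) (n : nat) : sumN f (S n) = sum_f_R0 f n.
Proof. induction n as [|n IH]; simpl in *; [ring | now rewrite IH]. Qed.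

Lemma sumN_le (f g : nat -> R) (n : nat) :
  (forall i, (i < n)%nat -> f i <= g i) -> sumN f n <= sumN g n.
Proof.
  induction n as [|n IH]; intros H; simpl; [lra|].
  assert (f n <= g n) by (apply H; lia).
  assert (sumN f n <= sumN g n) by (apply IH; intros; apply H; lia). lra.
Qed.

Lemma sumN_ext (f g : nat -> R) (n : nat) :
  (forall i, (i < n)%nat -> f i = g i) -> sumN f n = sumN g n.
Proof. intros H; apply Rle_antisym; apply sumN_le; intros i Hi; rewrite H; auto; lra. Qed.

Lemma sumN_plus (f g : nat -> R) (n : nat) :
  sumN (fun i => f i + g i) n = sumN f n + sumN g n.
Proof. induction n as [|n IH]; simpl; [ring | rewrite IH; ring]. Qed.

Lemma sumN_scal (c : R) (f : nat -> R) (n : nat) : sumN (fun i => c * f i) n = c * sumN f n.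
Proof. induction n as [|n IH]; simpl; [ring | rewrite IH; ring]. Qed.

Lemma sumN_zero (n : nat) : sumN (fun _ => 0) n = 0.
Proof. induction n as [|n IH]; simpl; [ring | rewrite IH; ring]. Qed.

Lemma sumN_pow_half (c : R) (n : nat) : 0 <= c -> sumN (fun i => c * (1 / 2) ^ S i) n <= c.
Proof.
  intros Hc.
  assert (H : sumN (fun i => c * (1 / 2) ^ S i) n = c * (1 - (1 / 2) ^ n)).
  { induction n as [|n IH]; simpl in *; [ring | rewrite IH; field]. }
  rewrite H. assert (0 < (1 / 2) ^ n) by (apply pow_lt; lra). nra.
Qed.

Lemma sumN_le_infinite_sum (f : nat -> R) (s : R) (n : nat) :
  (forall i, 0 <= f i) -> infinite_sum f s -> sumN f n <= s.
Proof.
  intros Hf Hs. destruct n as [|n].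
  - simpl. apply Rle_trans with (sum_f_R0 f 0); [simpl; apply Hf|].
    apply (sum_incr f 0 s); [exact Hs | exact Hf].
  - rewrite sumN_sum_f_R0. apply (sum_incr f n s); [exact Hs | exact Hf].
Qed.

Lemma infinite_sum_bounded (f : nat -> R) (M : R) :
  (forall i, 0 <= f i) -> (forall n, sumN f n <= M) ->
  exists s, infinite_sum f s /\ s <= M.
Proof.
  intros Hf HM.
  assert (Hg : Un_growing (sum_f_R0 f)) by (intros n; simpl; specialize (Hf (S n)); lra).
  assert (Hb : has_ub (sum_f_R0 f)).
  { exists M. intros x [n ->]. rewrite <- sumN_sum_f_R0. apply HM. }
  destruct (growing_cv _ Hg Hb) as [s Hs]. exists s. split; [exact Hs|].
  destruct (Rle_or_lt s M) as [|Hlt]; [assumption | exfalso].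
  destruct (Hs (s - M)) as [n Hn]; [lra|].
  specialize (Hn n (Nat.le_refl n)). unfold Rdist in Hn.
  assert (sum_f_R0 f n <= M) by (rewrite <- sumN_sum_f_R0; apply HM).
  apply Rabs_def2 in Hn. lra.
Qed.

Section Lists.
Context {A : Type}.

Definition sumL (f : A -> R) (l : list A) : R := fold_right (fun x s => f x + s) 0 l.

Lemma sumL_le f g l : Forall (fun x => f x <= g x) l -> sumL f l <= sumL g l.
Proof. induction 1; simpl; lra. Qed.

Lemma sumL_plus f g l : sumL (fun x => f x + g x) l = sumL f l + sumL g l.
Proof. induction l as [|x l IH]; simpl; [ring | rewrite IH; ring]. Qed.

Lemma sumL_scal c f l : sumL (fun x => c * f x) l = c * sumL f l.
Proof. induction l as [|x l IH]; simpl; [ring | rewrite IH; ring]. Qed.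

Lemma sumL_filter_split f (P : A -> bool) l :
  sumL f l = sumL f (filter P l) + sumL f (filter (fun x => negb (P x)) l).
Proof. induction l as [|x l IH]; simpl; [ring|]. destruct (P x); simpl; rewrite IH; ring. Qed.

(** Double counting. It serves with the classes [k x = n], which partition the list, and with the
    nested classes [n < k x], which give a discrete layer-cake formula. *)
Lemma sumL_exchange f (P : nat -> A -> bool) N l :
  sumN (fun n => sumL f (filter (P n) l)) N
  = sumL (fun x => sumN (fun n => if P n x then f x else 0) N) l.
Proof.
  induction l as [|x l IH]; simpl; [apply sumN_zero|].
  rewrite <- IH, <- sumN_plus. apply sumN_ext. intros n _.
  destruct (P n x); simpl; ring.
Qed.

Lemma nat_valued_bounded (k : A -> nat) l : exists N, Forall (fun x => (k x < N)%nat) l.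
Proof.
  induction l as [|x l [N HN]]; [exists 0%nat; constructor|].
  exists (S (Nat.max (k x) N)). constructor; [lia|].
  eapply Forall_impl; [|exact HN]. simpl; intros; lia.
Qed.
End Lists.

Lemma sumL_map {A B : Type} (g : A -> B) f l : sumL f (map g l) = sumL (fun x => f (g x)) l.
Proof. induction l as [|x l IH]; simpl; [ring | rewrite IH; ring]. Qed.

Lemma sumN_indicator_lt (k N : nat) (c : R) :
  (k <= N)%nat -> sumN (fun n => if (n <? k)%nat then c else 0) N = INR k * c.
Proof.
  induction N as [|N IH]; intros HN; cbn [sumN].
  - replace k with 0%nat by lia. simpl; ring.
  - destruct (Nat.eq_dec k (S N)) as [->|Hk].
    + rewrite (sumN_ext _ (fun _ => c)).
      * replace (N <? S N)%nat with true by (symmetry; apply Nat.ltb_lt; lia).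
        clear IH HN. induction N as [|N IH]; [simpl; ring|].
        rewrite S_INR. cbn [sumN]. rewrite S_INR in *. lra.
      * intros i Hi. replace (i <? S N)%nat with true by (symmetry; apply Nat.ltb_lt; lia). reflexivity.
    + rewrite IH by lia.
      replace (N <? k)%nat with false by (symmetry; apply Nat.ltb_ge; lia). ring.
Qed.

Lemma sumN_indicator_eq (k N : nat) (c : R) :
  (k < N)%nat -> sumN (fun n => if (k =? n)%nat then c else 0) N = c.
Proof.
  intros HN.
  assert (H0 : forall M, (M <= k)%nat -> sumN (fun n => if (k =? n)%nat then c else 0) M = 0).
  { induction M as [|M IH]; intros HM; simpl; [ring|]. rewrite IH by lia.
    replace (k =? M)%nat with false by (symmetry; apply Nat.eqb_neq; lia). ring. }
  induction N as [|N IH]; [lia|]. simpl.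
  destruct (Nat.eq_dec k N) as [->|Hk].
  - rewrite Nat.eqb_refl, H0 by lia. ring.
  - rewrite IH by lia. replace (k =? N)%nat with false by (symmetry; apply Nat.eqb_neq; lia). ring.
Qed.

(** * Interval lists and gauges *)

Fixpoint ivs (a : R) (l : list (R * R)) (b : R) : Prop :=
  match l with
  | [] => a <= b
  | (u, v) :: l' => a <= u /\ u <= v /\ ivs v l' b
  end.

Definition incr (F : R -> R) (p : R * R) : R := F (snd p) - F (fst p).
Definition len (p : R * R) : R := snd p - fst p.

Lemma ivs_le a l b : ivs a l b -> a <= b.
Proof.
  revert a; induction l as [|[u v] l IH]; simpl; intros a H; [exact H|].
  destruct H as (H1 & H2 & H3). specialize (IH _ H3). lra.
Qed.

Lemma ivs_weaken a a' l b : a' <= a -> ivs a l b -> ivs a' l b.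
Proof. destruct l as [|[u v] l]; simpl; intuition lra. Qed.

Lemma ivs_filter {B : Type} (P : (R * R) * B -> bool) a l b :
  ivs a (map fst l) b -> ivs a (map fst (filter P l)) b.
Proof.
  revert a; induction l as [|[[u v] x] l IH]; simpl; intros a H; [exact H|].
  destruct H as (H1 & H2 & H3). destruct (P (u, v, x)); simpl.
  - repeat split; auto.
  - apply ivs_weaken with v; [lra | auto].
Qed.

Lemma ivs_incr_le (F : R -> R) a l b :
  (forall x y, a <= x -> x <= y -> y <= b -> F x <= F y) ->
  ivs a l b -> sumL (incr F) l <= F b - F a.
Proof.
  revert a; induction l as [|[u v] l IH]; simpl; intros a HF H.
  - specialize (HF a b). lra.
  - destruct H as (H1 & H2 & H3). pose proof (ivs_le _ _ _ H3).
    assert (sumL (incr F) l <= F b - F v) by (apply IH; auto; intros; apply HF; lra).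
    unfold incr at 1; simpl.
    assert (F a <= F u) by (apply HF; lra). lra.
Qed.

Definition fine (d : R -> R) (p : (R * R) * R) : Prop :=
  fst (fst p) <= snd p <= snd (fst p) /\
  snd p - d (snd p) < fst (fst p) /\ snd (fst p) < snd p + d (snd p).

(** Unlike [ivs], this leaves no gaps: the intervals fill [a,b]. Nothing is asked of the tags here;
    [fine] constrains them. *)
Fixpoint tiles (a : R) (l : list ((R * R) * R)) (b : R) : Prop :=
  match l with
  | [] => a = b
  | ((u, v), _) :: l' => u = a /\ u <= v /\ tiles v l' b
  end.

Lemma tiles_ivs a l b : tiles a l b -> ivs a (map fst l) b.
Proof.
  revert a; induction l as [|[[u v] x] l IH]; simpl; intros a H; [lra|].
  destruct H as (H1 & H2 & H3). repeat split; [lra | lra | auto].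
Qed.

Lemma tiles_telescope (F : R -> R) a l b :
  tiles a l b -> sumL (fun p => incr F (fst p)) l = F b - F a.
Proof.
  revert a; induction l as [|[[u v] x] l IH]; simpl; intros a H; [subst; ring|].
  destruct H as (-> & H2 & H3). rewrite (IH _ H3). unfold incr; simpl; ring.
Qed.

Lemma tiles_snoc a l b c x : tiles a l b -> b <= c -> tiles a (l ++ [((b, c), x)]) c.
Proof.
  revert a; induction l as [|[[u v] y] l IH]; simpl; intros a H Hc; [subst; auto|].
  intuition.
Qed.

(** Supremum argument: if s is the supremum of the right ends that can be reached, one interval
    tagged at s, started from a reachable point in (s - d s, s], leads beyond s unless it reaches
    b. *)
Lemma cousin (d : R -> R) (a b : R) :
  (forall x, 0 < d x) -> a <= b -> exists l, tiles a l b /\ Forall (fine d) l.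
Proof.
  intros Hd Hab.
  set (S := fun x => a <= x <= b /\ exists l, tiles a l x /\ Forall (fine d) l).
  assert (Sa : S a) by (split; [lra | exists []; split; [reflexivity | constructor]]).
  destruct (completeness S) as [s [Hub Hlub]].
  { exists b. intros x [Hx _]. lra. }
  { exists a. exact Sa. }
  assert (Has : a <= s) by (apply Hub, Sa).
  assert (Hsb : s <= b) by (apply Hlub; intros x [Hx _]; lra).
  pose proof (Hd s) as Hds.
  assert (Hex : exists x, S x /\ s - d s < x).
  { apply NNPP; intros H. assert (s <= s - d s); [|lra].
    apply Hlub. intros x Hx. apply Rnot_lt_le. intros Hlt. apply H. exists x; auto. }
  destruct Hex as [x [Sx Hx]]. pose proof (Hub _ Sx) as Hxs.
  destruct Sx as [Hxab [l [Hl Hf]]].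
  assert (Hstep : forall y, s <= y <= b -> y < s + d s -> S y).
  { intros y Hy Hy'. split; [lra|]. exists (l ++ [((x, y), s)]). split.
    - apply tiles_snoc; [exact Hl | lra].
    - apply Forall_app; split; [exact Hf|]. constructor; [|constructor].
      unfold fine; simpl; lra. }
  destruct (Rle_or_lt b (s + d s / 2)) as [Hb|Hb].
  - apply (Hstep b); lra.
  - exfalso. assert (S (s + d s / 2)) by (apply Hstep; lra).
    apply Hub in H. lra.
Qed.

(* A set is [gsmall A e] when it has outer measure at most [e] in the Henstock sense: some gauge
   bounds by [e] the length of every fine tagged family with tags in [A]. *)
Definition gsmall (A : R -> Prop) (e : R) : Prop :=
  exists d : R -> R, (forall x, 0 < d x) /\
    forall a b l, ivs a (map fst l) b -> Forall (fine d) l ->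
      Forall (fun p => A (snd p)) l -> sumL (fun p => len (fst p)) l <= e.

Lemma gsmall_subset (A B : R -> Prop) e e' :
  (forall x, A x -> B x) -> e <= e' -> gsmall B e -> gsmall A e'.
Proof.
  intros HAB He (d & Hd & H). exists d; split; [exact Hd|].
  intros a b l H1 H2 H3. apply Rle_trans with e; [|exact He]. apply (H a b); auto.
  eapply Forall_impl; [|exact H3]. simpl; auto.
Qed.

Lemma Forall_filter {A : Type} (P : A -> Prop) (Q : A -> bool) l :
  Forall P l -> Forall P (filter Q l).
Proof. induction 1; simpl; [constructor|]. destruct (Q x); auto. Qed.

Lemma Forall_filter_and {A : Type} (P Q : A -> Prop) (b : A -> bool) l :
  Forall P l -> (forall x, P x -> b x = true -> Q x) -> Forall Q (filter b l).
Proof.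
  intros H HQ. induction H as [|x l Hx _ IH]; simpl; [constructor|].
  destruct (b x) eqn:E; auto.
Qed.

(** Each point x is assigned by choice to one set [A (k x)] containing it, and receives the gauge of
    that set. A finite family of tags involves finitely many indices, so it splits into finitely
    many families, each controlled by its own gauge. *)
Lemma gsmall_countable_union (A : nat -> R -> Prop) (e : nat -> R) (E : R) :
  (forall n, gsmall (A n) (e n)) -> (forall N, sumN e N <= E) ->
  gsmall (fun x => exists n, A n x) E.
Proof.
  intros HA HE.
  set (d := fun n => proj1_sig (constructive_indefinite_description _ (HA n))).
  assert (Hd : forall n, (forall x, 0 < d n x) /\
    forall a b l, ivs a (map fst l) b -> Forall (fine (d n)) l ->
      Forall (fun p => A n (snd p)) l -> sumL (fun p => len (fst p)) l <= e n).
  { intros n. unfold d. destruct constructive_indefinite_description; auto. }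
  set (k := fun x => epsilon (inhabits 0%nat) (fun n => A n x)).
  assert (Hk : forall x, (exists n, A n x) -> A (k x) x).
  { intros x Hx. apply (epsilon_spec (inhabits 0%nat) (fun n => A n x)), Hx. }
  exists (fun x => d (k x) x). split; [intros x; apply Hd|].
  intros a b l Hivs Hfine Htag.
  destruct (nat_valued_bounded (fun p : R * R * R => k (snd p)) l) as [N HN].
  apply Rle_trans with (sumN e N); [|apply HE].
  replace (sumL (fun p => len (fst p)) l) with
    (sumN (fun n => sumL (fun p => len (fst p)) (filter (fun p => (k (snd p) =? n)%nat) l)) N).
  - apply sumN_le. intros n _. apply (proj2 (Hd n) a b).
    + apply ivs_filter, Hivs.
    + apply Forall_filter_and with (1 := Hfine). intros p Hp Hk'.
      apply Nat.eqb_eq in Hk'. unfold fine in *. rewrite <- Hk'. exact Hp.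
    + apply Forall_filter_and with (1 := Htag). intros p Hp Hk'.
      apply Nat.eqb_eq in Hk'. rewrite <- Hk'. apply Hk, Hp.
  - rewrite sumL_exchange. clear - HN. induction HN as [|p l Hp _ IH]; simpl; [ring|].
    rewrite IH. f_equal. apply sumN_indicator_eq, Hp.
Qed.

Definition gnull (A : R -> Prop) : Prop := forall e, 0 < e -> gsmall A e.

Lemma gnull_countable_union (A : nat -> R -> Prop) :
  (forall n, gnull (A n)) -> gnull (fun x => exists n, A n x).
Proof.
  intros HA e He. apply gsmall_countable_union with (e := fun n => e * (1 / 2) ^ S n).
  - intros n. apply HA. apply Rmult_lt_0_compat; [exact He | apply pow_lt; lra].
  - intros N. apply sumN_pow_half. lra.
Qed.

Lemma gnull_subset (A B : R -> Prop) : (forall x, A x -> B x) -> gnull B -> gnull A.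
Proof. intros H HB e He. apply gsmall_subset with B e; auto; lra. Qed.

Lemma gnull_union (A B : R -> Prop) : gnull A -> gnull B -> gnull (fun x => A x \/ B x).
Proof.
  intros HA HB.
  apply gnull_subset with (fun x => exists n, (match n with O => A | _ => B end) x).
  - intros x [H|H]; [exists 0%nat | exists 1%nat]; exact H.
  - apply gnull_countable_union. intros [|n]; assumption.
Qed.

Lemma gsmall_union (A B : R -> Prop) e1 e2 :
  gsmall A e1 -> 0 <= e1 -> gnull B -> 0 < e2 -> gsmall (fun x => A x \/ B x) (e1 + e2).
Proof.
  intros HA He1 HB He2.
  apply gsmall_subset with (fun x => exists n, (match n with O => A | _ => B end) x) (e1 + e2).
  - intros x [H|H]; [exists 0%nat | exists 1%nat]; exact H.
  - lra.
  (* [B] is repeated at all indices n >= 1, with budgets e2 / 2^n whose sum stays below e2. *)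
  - apply gsmall_countable_union with (fun n => match n with O => e1 | S _ => e2 * (1/2) ^ n end).
    + intros [|n]; [exact HA|]. apply HB, Rmult_lt_0_compat; [exact He2 | apply pow_lt; lra].
    + intros [|N]; [simpl; lra|].
      assert (H : sumN (fun n => match n with O => e1 | S _ => e2 * (1/2) ^ n end) (S N)
                  = e1 + sumN (fun n => e2 * (1/2) ^ S n) N).
      { induction N as [|N IH]; [simpl; ring|]. cbn [sumN] in *. rewrite IH. ring. }
      rewrite H. pose proof (sumN_pow_half e2 N). lra.
Qed.

(** * Open covers, outer measure and gauges *)

Definition clamp (a b y : R) : R := Rmax a (Rmin y b).

Lemma clamp_mono a b x y : x <= y -> clamp a b x <= clamp a b y.
Proof. intros H; unfold clamp, Rmax, Rmin; repeat destruct Rle_dec; lra. Qed.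

Lemma clamp_range a b x y : a <= b -> clamp a b y - clamp a b x <= b - a.
Proof. intros H; unfold clamp, Rmax, Rmin; repeat destruct Rle_dec; lra. Qed.

Lemma clamp_id a b x : a <= x <= b -> clamp a b x = x.
Proof. intros H; unfold clamp, Rmax, Rmin; repeat destruct Rle_dec; lra. Qed.

Lemma sumN_clamp_incr (a b : nat -> R) u v N n :
  (forall i, a i <= b i) -> u <= v -> (n < N)%nat -> a n <= u -> v <= b n ->
  v - u <= sumN (fun i => clamp (a i) (b i) v) N - sumN (fun i => clamp (a i) (b i) u) N.
Proof.
  intros Hab Huv Hn Ha Hb. induction N as [|N IH]; [lia|]. simpl.
  destruct (Nat.eq_dec n N) as [->|Hne].
  - rewrite !(clamp_id (a N) (b N)) by lra.
    assert (sumN (fun i => clamp (a i) (b i) u) N <= sumN (fun i => clamp (a i) (b i) v) N)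
      by (apply sumN_le; intros; apply clamp_mono; lra). lra.
  - assert (clamp (a N) (b N) u <= clamp (a N) (b N) v) by (apply clamp_mono; lra).
    assert (n < N)%nat by lia. specialize (IH H0). lra.
Qed.

(** The gauge at x confines fine intervals to one covering interval around x. The sum F of the
    clamps to the finitely many covering intervals in use is nondecreasing, grows by at most their
    total length, and grows over each fine interval by at least the length of that interval.
    Overlaps in the cover thus need no rearrangement. *)
Lemma cover_gsmall (A : R -> Prop) (s : R) : cover_length A s -> gsmall A s.
Proof.
  intros (a & b & Hab & Hcov & Hsum).
  set (k := fun x => epsilon (inhabits 0%nat) (fun n => a n < x < b n)).
  assert (Hk : forall x, A x -> a (k x) < x < b (k x)).
  { intros x Hx. apply (epsilon_spec (inhabits 0%nat) (fun n => a n < x < b n)), Hcov, Hx. }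
  exists (fun x => if excluded_middle_informative (A x)
                   then Rmin (x - a (k x)) (b (k x) - x) else 1).
  split.
  - intros x. destruct excluded_middle_informative as [Hx|]; [|lra].
    specialize (Hk x Hx). apply Rmin_pos; lra.
  - intros c d l Hivs Hfine Htag.
    destruct (nat_valued_bounded (fun p : R * R * R => k (snd p)) l) as [N HN].
    set (F := fun y => sumN (fun i => clamp (a i) (b i) y) N).
    apply Rle_trans with (sumL (incr F) (map fst l)).
    + rewrite sumL_map. apply sumL_le. rewrite Forall_forall in *.
      intros [[u v] x] Hp. specialize (HN _ Hp). specialize (Hfine _ Hp). specialize (Htag _ Hp).
      unfold fine in Hfine; simpl in *. destruct excluded_middle_informative as [Hx|]; [|contradiction].
      specialize (Hk x Hx).
      pose proof (Rmin_l (x - a (k x)) (b (k x) - x)). pose proof (Rmin_r (x - a (k x)) (b (k x) - x)).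
      unfold len, incr, F; simpl. apply sumN_clamp_incr with (k x); auto; lra.
    + apply Rle_trans with (F d - F c).
      * apply ivs_incr_le; [|exact Hivs]. intros x y _ Hxy _. apply sumN_le. intros; apply clamp_mono; lra.
      * apply Rle_trans with (sumN (fun i => b i - a i) N).
        -- unfold F. assert (H : forall M, sumN (fun i => clamp (a i) (b i) d) M
              - sumN (fun i => clamp (a i) (b i) c) M <= sumN (fun i => b i - a i) M); [|apply H].
           induction M as [|M IH]; simpl; [lra|].
           pose proof (clamp_range (a M) (b M) c d (Hab M)). lra.
        -- apply sumN_le_infinite_sum; [|exact Hsum]. intros i; specialize (Hab i); lra.
Qed.

Lemma glb_spec (E : R -> Prop) : (exists x, E x) -> (exists m, forall x, E x -> m <= x) -> is_glb E (glb E).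
Proof.
  intros [x0 Hx0] [m Hm]. unfold glb. apply epsilon_spec.
  destruct (completeness (fun y => E (- y))) as [s [Hs1 Hs2]].
  - exists (- m). intros y Hy. specialize (Hm _ Hy). lra.
  - exists (- x0). rewrite Ropp_involutive. exact Hx0.
  - exists (- s). split.
    + intros x Hx. assert (- x <= s); [|lra]. apply Hs1. rewrite Ropp_involutive. exact Hx.
    + intros m' Hm'. assert (s <= - m'); [|lra]. apply Hs2. intros y Hy. specialize (Hm' _ Hy). lra.
Qed.

Lemma glb_eq (E : R -> Prop) (m : R) : is_glb E m -> glb E = m.
Proof.
  intros Hm. assert (H : is_glb E (glb E)) by (unfold glb; apply epsilon_spec; exists m; exact Hm).
  destruct H as [H1 H2], Hm as [H3 H4]. apply Rle_antisym; auto.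
Qed.

Lemma cover_length_nonneg A s : cover_length A s -> 0 <= s.
Proof.
  intros (a & b & Hab & _ & Hs).
  change 0 with (sumN (fun n => b n - a n) 0). apply sumN_le_infinite_sum; [|exact Hs].
  intros i; specialize (Hab i); lra.
Qed.

Lemma leb_measure_le A s : cover_length A s -> leb_measure A <= s.
Proof.
  intros H. destruct (glb_spec (cover_length A)) as [H1 _].
  - exists s; exact H.
  - exists 0. apply cover_length_nonneg.
  - apply H1, H.
Qed.

Lemma leb_measure_approx A : (exists s, cover_length A s) -> forall e, 0 < e ->
  exists s, cover_length A s /\ s < leb_measure A + e.
Proof.
  intros Hex e He. apply NNPP. intros Hno.
  destruct (glb_spec (cover_length A)) as [_ H2]; [exact Hex | exists 0; apply cover_length_nonneg |].
  fold (leb_measure A) in H2.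
  assert (leb_measure A + e <= leb_measure A); [|lra].
  apply H2. intros s Hs. apply Rnot_lt_le. intros Hlt. apply Hno. exists s; auto.
Qed.

Lemma infinite_sum_single (c : R) : infinite_sum (fun n => match n with O => c | _ => 0 end) c.
Proof.
  intros eps Heps. exists 0%nat. intros n _.
  replace (sum_f_R0 _ n) with c; [unfold Rdist; rewrite Rminus_diag; rewrite Rabs_R0; exact Heps|].
  induction n as [|n IH]; simpl in *; [reflexivity | rewrite <- IH; ring].
Qed.

Lemma infinite_sum_ext (f g : nat -> R) s : (forall n, f n = g n) -> infinite_sum f s -> infinite_sum g s.
Proof.
  intros H Hf eps Heps. destruct (Hf eps Heps) as [N HN]. exists N. intros n Hn.
  replace (sum_f_R0 g n) with (sum_f_R0 f n); [apply HN, Hn|]. apply sum_eq. auto.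
Qed.

Lemma cover_interval (A : R -> Prop) (a b e : R) :
  a <= b -> 0 < e -> (forall x, A x -> a <= x <= b) -> cover_length A (b - a + e).
Proof.
  intros Hab He HA.
  exists (fun n => match n with O => a - e / 2 | _ => 0 end),
         (fun n => match n with O => b + e / 2 | _ => 0 end).
  repeat split.
  - intros [|n]; lra.
  - intros x Hx. exists 0%nat. specialize (HA x Hx). lra.
  - eapply infinite_sum_ext; [|apply infinite_sum_single]. intros [|n]; simpl; field.
Qed.

Lemma gnull_point (x : R) : gnull (fun y => y = x).
Proof.
  intros e He. apply cover_gsmall. replace e with (x - x + e) by ring.
  apply cover_interval; try lra. intros; lra.
Qed.

Lemma gnull_finite (l : list R) : gnull (fun y => In y l).
Proof.
  induction l as [|x l IH].
  - apply gnull_subset with (fun y => y = 0); [simpl; tauto | apply gnull_point].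
  - apply gnull_subset with (fun y => y = x \/ In y l).
    + simpl; intuition.
    + apply gnull_union; [apply gnull_point | exact IH].
Qed.

Lemma cover_union A B s1 s2 :
  cover_length A s1 -> cover_length B s2 ->
  exists s, cover_length (fun x => A x \/ B x) s /\ s <= s1 + s2.
Proof.
  intros (a1 & b1 & H1 & C1 & S1) (a2 & b2 & H2 & C2 & S2).
  (* The two covers are interleaved by parity. *)
  set (a := fun n => if Nat.even n then a1 (Nat.div2 n) else a2 (Nat.div2 n)).
  set (b := fun n => if Nat.even n then b1 (Nat.div2 n) else b2 (Nat.div2 n)).
  assert (Hab : forall n, a n <= b n) by (intros n; unfold a, b; destruct (Nat.even n); auto).
  assert (E : forall n, sumN (fun i => b i - a i) (2 * n) =
     sumN (fun i => b1 i - a1 i) n + sumN (fun i => b2 i - a2 i) n).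
  { induction n as [|n IH]; [simpl; ring|].
    replace (2 * S n)%nat with (S (S (2 * n))) by lia. cbn [sumN]. rewrite IH.
    assert (a (2 * n)%nat = a1 n /\ b (2 * n)%nat = b1 n) as [-> ->].
    { unfold a, b. rewrite Nat.even_mul. rewrite Nat.div2_double. simpl; auto. }
    assert (a (S (2 * n)) = a2 n /\ b (S (2 * n)) = b2 n) as [-> ->].
    { unfold a, b. rewrite Nat.even_succ, Nat.odd_mul. rewrite Nat.div2_succ_double. simpl; auto. }
    ring. }
  destruct (infinite_sum_bounded (fun i => b i - a i) (s1 + s2)) as [s [Hs Hle]].
  - intros i; specialize (Hab i); lra.
  - intros n. apply Rle_trans with (sumN (fun i => b i - a i) (2 * n)).
    + assert (Hm : forall k, sumN (fun i => b i - a i) n <= sumN (fun i => b i - a i) (n + k)).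
      { induction k as [|k IH]; [rewrite Nat.add_0_r; lra|]. rewrite Nat.add_succ_r. simpl.
        specialize (Hab (n + k)%nat). lra. }
      replace (2 * n)%nat with (n + n)%nat by lia. apply Hm.
    + rewrite E. apply Rplus_le_compat; apply sumN_le_infinite_sum; auto;
        intros i; [specialize (H1 i) | specialize (H2 i)]; lra.
  - exists s. split; [|exact Hle]. exists a, b. repeat split; auto.
    intros x [Hx|Hx].
    + destruct (C1 x Hx) as [n Hn]. exists (2 * n)%nat. unfold a, b.
      rewrite Nat.even_mul, Nat.div2_double. exact Hn.
    + destruct (C2 x Hx) as [n Hn]. exists (S (2 * n))%nat. unfold a, b.
      rewrite Nat.even_succ, Nat.odd_mul, Nat.div2_succ_double. exact Hn.
Qed.

Lemma cover_subset (A B : R -> Prop) s : (forall x, A x -> B x) -> cover_length B s -> cover_length A s.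
Proof. intros H (a & b & H1 & H2 & H3). exists a, b. auto. Qed.

Lemma leb_measure_union (A B : R -> Prop) :
  (exists s, cover_length A s) -> (exists s, cover_length B s) ->
  leb_measure (fun x => A x \/ B x) <= leb_measure A + leb_measure B.
Proof.
  intros HA HB. apply Rnot_lt_le. intros Hlt.
  set (e := (leb_measure (fun x => A x \/ B x) - (leb_measure A + leb_measure B)) / 2).
  assert (He : 0 < e) by (unfold e; lra).
  destruct (leb_measure_approx A HA e He) as [s1 [H1 L1]].
  destruct (leb_measure_approx B HB e He) as [s2 [H2 L2]].
  destruct (cover_union _ _ _ _ H1 H2) as [s [Hs Hle]].
  apply leb_measure_le in Hs. unfold e in *. lra.
Qed.

Lemma leb_measure_mono (A B : R -> Prop) :
  (forall x, A x -> B x) -> (exists s, cover_length B s) -> leb_measure A <= leb_measure B.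
Proof.
  intros H HB. apply Rnot_lt_le. intros Hlt.
  destruct (leb_measure_approx B HB (leb_measure A - leb_measure B)) as [s [Hs Hl]]; [lra|].
  apply (cover_subset A) in Hs; [|exact H]. apply leb_measure_le in Hs. lra.
Qed.

Lemma leb_measure_interval (A : R -> Prop) (a b : R) :
  a <= b -> (forall x, A x -> a <= x <= b) -> leb_measure A <= b - a.
Proof.
  intros Hab HA. apply Rnot_lt_le. intros Hlt.
  pose proof (cover_interval A a b ((leb_measure A - (b - a)) / 2) Hab) as H.
  assert (C : cover_length A (b - a + (leb_measure A - (b - a)) / 2)) by (apply H; auto; lra).
  apply leb_measure_le in C. lra.
Qed.

Lemma leb_measure_empty (A : R -> Prop) : (forall x, ~ A x) -> leb_measure A <= 0.
Proof.
  intros HA. replace 0 with (0 - 0) by ring.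
  apply leb_measure_interval; [lra|]. intros x Hx; destruct (HA x Hx).
Qed.

Lemma leb_measure_gsmall (A : R -> Prop) (e : R) :
  (exists s, cover_length A s) -> 0 < e -> gsmall A (leb_measure A + e).
Proof.
  intros HA He. destruct (leb_measure_approx A HA e He) as [s [Hs Hl]].
  apply gsmall_subset with A s; auto; [lra|]. apply cover_gsmall, Hs.
Qed.

(** * Vitali's covering argument *)

Definition disj (I J : R * R) : Prop := snd I < fst J \/ snd J < fst I.

Fixpoint pdisj (l : list (R * R)) : Prop :=
  match l with
  | [] => True
  | p :: l' => Forall (disj p) l' /\ pdisj l'
  end.

Lemma pdisj_filter (P : R * R -> bool) l : pdisj l -> pdisj (filter P l).
Proof.
  induction l as [|I l IH]; simpl; [auto|]. intros [H1 H2].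
  destruct (P I); simpl; auto. split; auto. apply Forall_filter, H1.
Qed.

(** The list is not sorted: its head (u, v) separates the other intervals into those on its left and
    those on its right, and the induction on the bound n for the length applies to both, on [a,u]
    and [v,b]. *)
Lemma pdisj_incr_le (F : R -> R) (n : nat) : forall l a b, (length l <= n)%nat ->
  a <= b -> (forall x y, a <= x -> x <= y -> y <= b -> F x <= F y) ->
  Forall (fun I => a <= fst I /\ fst I <= snd I /\ snd I <= b) l -> pdisj l ->
  sumL (incr F) l <= F b - F a.
Proof.
  induction n as [|n IH]; intros l a b Hlen Hab HF Hl Hd.
  - destruct l; [|simpl in Hlen; lia]. simpl. specialize (HF a b). lra.
  - destruct l as [|[u v] l]; [simpl; specialize (HF a b); lra|].
    simpl in Hlen. inversion Hl as [|? ? Huv Hl']; subst. simpl in Huv. destruct Hd as [Hd1 Hd2].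
    set (P := fun I : R * R => if Rlt_dec (snd I) u then true else false).
    simpl. rewrite (sumL_filter_split _ P).
    assert (A1 : sumL (incr F) (filter P l) <= F u - F a).
    { apply IH; try lra.
      - pose proof (filter_length_le P l). lia.
      - intros; apply HF; lra.
      - apply Forall_filter_and with (1 := Hl'). intros J HJ HP. unfold P in HP.
        destruct Rlt_dec; [lra | discriminate].
      - apply pdisj_filter, Hd2. }
    assert (A2 : sumL (incr F) (filter (fun x => negb (P x)) l) <= F b - F v).
    { apply IH; try lra.
      - pose proof (filter_length_le (fun x => negb (P x)) l). lia.
      - intros; apply HF; lra.
      - apply Forall_filter_and with (1 := Forall_and Hl' Hd1). intros J [HJ HJd] HP.
        unfold P in HP. unfold disj in HJd. simpl in HJd. destruct Rlt_dec; [discriminate | lra].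
      - apply pdisj_filter, Hd2. }
    unfold incr at 1; simpl. lra.
Qed.

Section Vitali.
Variables (Fam : R * R -> Prop) (B eta : R).
Hypothesis Fam_len : forall I, Fam I -> 0 < len I <= B.
Hypothesis Fam_total : forall l, Forall Fam l -> pdisj l -> sumL len l <= eta.

Definition avail (l : list (R * R)) (J : R * R) : Prop := Fam J /\ Forall (disj J) l.

(** A largest available interval need not exist; one longer than half the supremum of the lengths
    does. *)
Lemma avail_large l : (exists J, avail l J) ->
  exists J, avail l J /\ forall J', avail l J' -> len J' < 2 * len J.
Proof using Fam_len.
  intros [J0 HJ0].
  destruct (completeness (fun x => exists J, avail l J /\ x = len J)) as [s [Hub Hlub]].
  - exists B. intros x [J [HJ ->]]. apply Fam_len, HJ.
  - exists (len J0), J0. auto.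
  - assert (0 < s).
    { apply Rlt_le_trans with (len J0); [apply Fam_len, HJ0|]. apply Hub. exists J0; auto. }
    apply NNPP. intros Hno. assert (s <= s / 2); [|lra].
    apply Hlub. intros x [J [HJ ->]]. apply Rnot_lt_le. intros Hlt. apply Hno.
    exists J. split; [exact HJ|]. intros J' HJ'.
    assert (len J' <= s) by (apply Hub; exists J'; auto). lra.
Qed.

Definition pick (l : list (R * R)) : R * R :=
  epsilon (inhabits (0, 0)) (fun J => avail l J /\ forall J', avail l J' -> len J' < 2 * len J).

Lemma pick_spec l : (exists J, avail l J) ->
  avail l (pick l) /\ forall J', avail l J' -> len J' < 2 * len (pick l).
Proof using Fam_len.
  intros H. apply avail_large in H.
  exact (epsilon_spec (inhabits (0, 0)) (fun J => avail l J /\ forall J', avail l J' -> len J' < 2 * len J) H).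
Qed.

Fixpoint chosen (n : nat) : list (R * R) :=
  match n with
  | O => []
  | S n => let l := chosen n in
           if excluded_middle_informative (exists J, avail l J) then pick l :: l else l
  end.

Lemma chosen_ok n : Forall Fam (chosen n) /\ pdisj (chosen n).
Proof using Fam_len.
  induction n as [|n [IH1 IH2]]; simpl; [auto|].
  destruct excluded_middle_informative as [H|]; [|auto].
  destruct (pick_spec _ H) as [[H1 H2] _]. simpl. auto.
Qed.

(** The picked interval enlarged five times about its centre. Once nothing is available, the empty
    open interval [(0, 0)] pads the sequence at no cost. *)
Definition vit (n : nat) : R * R :=
  let l := chosen n in
  if excluded_middle_informative (exists J, avail l J)
  then (fst (pick l) - 2 * len (pick l), snd (pick l) + 2 * len (pick l)) else (0, 0).

Lemma vit_total n : sumN (fun i => len (vit i)) n = 5 * sumL len (chosen n).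
Proof.
  induction n as [|n IH]; simpl; [ring|]. rewrite IH. unfold vit.
  destruct excluded_middle_informative; unfold len; simpl; ring.
Qed.

Lemma vit_len_nonneg n : 0 <= len (vit n).
Proof using Fam_len.
  unfold vit. destruct excluded_middle_informative as [H|]; [|unfold len; simpl; lra].
  destruct (pick_spec _ H) as [[H1 _] _]. apply Fam_len in H1. unfold len in *; simpl; lra.
Qed.

(** If J met no chosen interval it would stay available, every pick would be longer than half of J,
    and their total length would pass eta. The first pick that meets J is still longer than half of
    J, so its fivefold enlargement contains J in its interior. *)
Lemma vitali (A : R -> Prop) :
  (forall x, A x -> exists I, Fam I /\ fst I <= x <= snd I) ->
  exists s, cover_length A s /\ s <= 5 * eta.
Proof using Fam_len Fam_total.
  intros HA.
  destruct (infinite_sum_bounded (fun i => len (vit i)) (5 * eta)) as [s [Hs Hle]].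
  - apply vit_len_nonneg.
  - intros n. rewrite vit_total. destruct (chosen_ok n) as [H1 H2].
    specialize (Fam_total _ H1 H2). lra.
  - exists s. split; [|exact Hle]. exists (fun n => fst (vit n)), (fun n => snd (vit n)).
    split; [|split; [|exact Hs]].
    { intros n. pose proof (vit_len_nonneg n). unfold len in *. lra. }
    intros x Hx. destruct (HA x Hx) as [J [HJ HxJ]].
    assert (Hstop : exists n, ~ Forall (disj J) (chosen n)).
    { apply NNPP. intros Hno.
      assert (Hall : forall n, Forall (disj J) (chosen n)).
      { intros n. apply NNPP. intros Hn. apply Hno. exists n; exact Hn. }
      assert (Hgrow : forall n, INR n * (len J / 2) <= sumL len (chosen n)).
      { induction n as [|n IH]; [simpl; lra|]. rewrite S_INR. simpl.
        assert (Hav : avail (chosen n) J) by (split; auto).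
        destruct excluded_middle_informative as [H|H]; [|exfalso; apply H; exists J; exact Hav].
        destruct (pick_spec _ H) as [_ H2]. specialize (H2 _ Hav). simpl. lra. }
      pose proof (Fam_len _ HJ) as HJl.
      destruct (INR_unbounded (eta / (len J / 2))) as [n Hn].
      specialize (Hgrow n). destruct (chosen_ok n) as [H1 H2]. specialize (Fam_total _ H1 H2).
      apply (Rmult_lt_compat_r (len J / 2)) in Hn; [|lra].
      rewrite Rdiv_mult in Hn by lra. lra. }
    assert (Hfirst : exists n, Forall (disj J) (chosen n) /\ ~ Forall (disj J) (chosen (S n))).
    { destruct Hstop as [n Hn]. induction n as [|n IH]; [exfalso; apply Hn; constructor|].
      destruct (classic (Forall (disj J) (chosen n))) as [H|H]; [exists n; auto | auto]. }
    destruct Hfirst as [n [Hn1 Hn2]]. exists n.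
    assert (Hav : avail (chosen n) J) by (split; auto).
    simpl in Hn2. unfold vit.
    destruct excluded_middle_informative as [H|H]; [|contradiction].
    destruct (pick_spec _ H) as [[H1 _] H2]. specialize (H2 _ Hav).
    assert (Hnd : ~ disj J (pick (chosen n))) by (intros Hd; apply Hn2; constructor; auto).
    unfold disj, len in *. simpl. lra.
Qed.
End Vitali.

Lemma sumN_succ_l (f : nat -> R) n : sumN f (S n) = f 0%nat + sumN (fun i => f (S i)) n.
Proof. induction n as [|n IH]; [simpl; ring|]. cbn [sumN] in *. rewrite IH. ring. Qed.

Lemma sumN_nth (f : R * R -> R) l : sumN (fun i => f (nth i l (0, 0))) (length l) = sumL f l.
Proof. induction l as [|p l IH]; [reflexivity|]. simpl length. rewrite sumN_succ_l. simpl. rewrite IH. reflexivity. Qed.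

Lemma ivs_nth a l b i : ivs a l b -> (i < length l)%nat ->
  a <= fst (nth i l (0, 0)) /\ fst (nth i l (0, 0)) <= snd (nth i l (0, 0)) /\ snd (nth i l (0, 0)) <= b.
Proof.
  revert a i; induction l as [|[u v] l IH]; simpl; intros a i H Hi; [lia|].
  destruct H as (H1 & H2 & H3). destruct i as [|i]; simpl.
  - pose proof (ivs_le _ _ _ H3). lra.
  - destruct (IH v i H3) as (A1 & A2 & A3); [lia|]. lra.
Qed.

Lemma ivs_nth_ordered a l b i j : ivs a l b -> (i < j)%nat -> (j < length l)%nat ->
  snd (nth i l (0, 0)) <= fst (nth j l (0, 0)).
Proof.
  revert a i j; induction l as [|[u v] l IH]; simpl; intros a i j H Hij Hj; [lia|].
  destruct H as (H1 & H2 & H3). destruct j as [|j]; [lia|]. destruct i as [|i]; simpl.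
  - destruct (ivs_nth v l b j H3) as (A1 & _ & _); [lia | exact A1].
  - apply (IH v); auto; lia.
Qed.

Lemma abs_cont_on_list g t : abs_cont_on g t -> forall e, 0 < e -> exists d, 0 < d /\
  forall l, ivs 0 l t -> sumL len l < d -> sumL (fun p => Rabs (incr g p)) l < e.
Proof.
  intros H e He. destruct (H e He) as [d [Hd H']]. exists d; split; [exact Hd|].
  intros l Hl Hlen. rewrite <- sumN_nth.
  apply (H' (length l) (fun i => fst (nth i l (0, 0))) (fun i => snd (nth i l (0, 0)))).
  - intros i Hi. destruct (ivs_nth 0 l t i Hl Hi) as (A1 & A2 & A3). auto.
  - intros i j Hij Hj. apply (ivs_nth_ordered 0 l t); auto.
  - rewrite <- sumN_nth in Hlen. exact Hlen.
Qed.

(** * Total variation *)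

Fixpoint chain (x : R) (l : list R) (y : R) : Prop :=
  match l with
  | [] => x <= y
  | z :: l' => x <= z /\ chain z l' y
  end.

Fixpoint cvar (g : R -> R) (x : R) (l : list R) (y : R) : R :=
  match l with
  | [] => Rabs (g y - g x)
  | z :: l' => Rabs (g z - g x) + cvar g z l' y
  end.

Lemma chain_le x l y : chain x l y -> x <= y.
Proof. revert x; induction l as [|z l IH]; simpl; intros x H; [exact H|]. destruct H as [H1 H2]. apply IH in H2. lra. Qed.

Lemma chain_snoc x l y z : chain x l y -> y <= z -> chain x (l ++ [y]) z.
Proof. revert x; induction l as [|w l IH]; simpl; intros x H Hz; [auto|]. intuition. Qed.

Lemma cvar_snoc g x l y z : cvar g x (l ++ [y]) z = cvar g x l y + Rabs (g z - g y).
Proof. revert x; induction l as [|w l IH]; simpl; intros x; [ring|]. rewrite IH. ring. Qed.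

Lemma chain_split g x l y c : chain x l y -> x <= c <= y ->
  exists l1 l2, chain x l1 c /\ chain c l2 y /\ cvar g x l y <= cvar g x l1 c + cvar g c l2 y.
Proof.
  revert x; induction l as [|z l IH]; simpl; intros x H Hc.
  - exists [], []. simpl. repeat split; try lra.
    replace (g y - g x) with ((g c - g x) + (g y - g c)) by ring. apply Rabs_triang.
  - destruct H as [H1 H2]. destruct (Rle_or_lt c z) as [Hcz|Hcz].
    + exists [], (z :: l). simpl. repeat split; try lra; auto.
      replace (g z - g x) with ((g c - g x) + (g z - g c)) by ring.
      pose proof (Rabs_triang (g c - g x) (g z - g c)). lra.
    + destruct (IH z H2) as (l1 & l2 & A1 & A2 & A3); [lra|].
      exists (z :: l1), l2. simpl. repeat split; auto. lra.
Qed.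

Fixpoint steps (x : R) (l : list R) (y : R) : list (R * R) :=
  match l with
  | [] => [(x, y)]
  | z :: l' => (x, z) :: steps z l' y
  end.

Lemma steps_ivs x l y : chain x l y -> ivs x (steps x l y) y.
Proof. revert x; induction l as [|z l IH]; simpl; intros x H; [lra|]. destruct H. repeat split; auto; lra. Qed.

Lemma steps_len x l y : sumL len (steps x l y) = y - x.
Proof. revert x; induction l as [|z l IH]; simpl; intros x; [unfold len; simpl; ring|]. rewrite IH. unfold len; simpl; ring. Qed.

Lemma steps_cvar g x l y : sumL (fun p => Rabs (incr g p)) (steps x l y) = cvar g x l y.
Proof. revert x; induction l as [|z l IH]; simpl; intros x; [unfold incr; simpl; ring|]. rewrite IH. reflexivity. Qed.

Lemma ivs_weaken_r a l b b' : b <= b' -> ivs a l b -> ivs a l b'.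
Proof.
  revert a; induction l as [|[u v] l IH]; simpl; intros a Hb H; [lra|].
  destruct H as (H1 & H2 & H3). repeat split; auto.
Qed.

Definition bounded_var (g : R -> R) (t : R) : Prop :=
  exists B, forall l, chain 0 l t -> cvar g 0 l t <= B.

(** [0,t] is walked through in steps of length at most d / 2, where d is the modulus of absolute
    continuity for the value 1; each step adds at most 1 to the variation. *)
Lemma abs_cont_bounded_var g t : 0 <= t -> abs_cont_on g t -> bounded_var g t.
Proof.
  intros Ht Hg. destruct (abs_cont_on_list g t Hg 1) as [d [Hd H]]; [lra|].
  assert (Hn : forall n, bounded_var g (Rmin t (INR n * (d / 2)))).
  { induction n as [|n [B IH]].
    - simpl. rewrite Rmult_0_l, Rmin_right by lra. exists 1. intros l Hl.
      rewrite <- steps_cvar. apply Rlt_le, H.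
      + apply ivs_weaken_r with 0; [lra | apply steps_ivs, Hl].
      + rewrite steps_len. lra.
    - set (x := Rmin t (INR n * (d / 2))) in *. rewrite S_INR.
      set (y := Rmin t ((INR n + 1) * (d / 2))).
      assert (0 <= INR n) by apply pos_INR.
      assert (0 <= INR n * (d / 2)) by (apply Rmult_le_pos; lra).
      assert (Hxy : 0 <= x <= y /\ y - x < d /\ y <= t).
      { unfold x, y, Rmin; repeat destruct Rle_dec; lra. }
      exists (B + 1). intros l Hl.
      destruct (chain_split g 0 l y x Hl) as (l1 & l2 & A1 & A2 & A3); [lra|].
      assert (cvar g x l2 y < 1).
      { rewrite <- steps_cvar. apply H.
        + apply ivs_weaken with x; [lra|]. apply ivs_weaken_r with y; [lra|]. apply steps_ivs, A2.
        + rewrite steps_len. lra. }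
      specialize (IH _ A1). lra. }
  destruct (INR_unbounded (t / (d / 2))) as [n Hn'].
  specialize (Hn n). rewrite Rmin_left in Hn; [exact Hn|].
  apply (Rmult_lt_compat_r (d / 2)) in Hn'; [|lra].
  rewrite Rdiv_mult in Hn' by lra. lra.
Qed.

Lemma bounded_var_shift g t c : bounded_var g t -> bounded_var (fun x => g x - c * x) t.
Proof.
  intros [B HB]. exists (B + Rabs c * t). intros l Hl. specialize (HB l Hl).
  assert (H : cvar (fun x => g x - c * x) 0 l t <= cvar g 0 l t + Rabs c * (t - 0)); [|lra].
  assert (H1 : forall x y, x <= y ->
    Rabs (g y - c * y - (g x - c * x)) <= Rabs (g y - g x) + Rabs c * (y - x)).
  { intros x y Hxy. replace (g y - c * y - (g x - c * x)) with ((g y - g x) + (- c) * (y - x)) by ring.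
    eapply Rle_trans; [apply Rabs_triang|]. rewrite Rabs_mult, Rabs_Ropp, (Rabs_right (y - x)) by lra. lra. }
  clear HB. revert Hl. generalize 0. induction l as [|z l IH]; simpl; intros x Hx.
  - apply H1, Hx.
  - destruct Hx as [Hx1 Hx2]. specialize (IH z Hx2). specialize (H1 x z Hx1). lra.
Qed.

(** [v x] is the supremum of the variations along chains from 0 to x. The second property supplies a
    chain that nearly exhausts the variation, so that the corrected function built from it in
    [variation_defect] is nearly constant. *)
Lemma total_variation g t : 0 <= t -> bounded_var g t -> exists v : R -> R,
  (forall x y, 0 <= x -> x <= y -> y <= t -> Rabs (g y - g x) <= v y - v x) /\
  (forall e, 0 < e -> exists l, chain 0 l t /\ v t - v 0 - cvar g 0 l t <= e).
Proof.
  intros Ht [B HB].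
  set (S := fun x r => exists l, chain 0 l x /\ r = cvar g 0 l x).
  assert (HS : forall x, 0 <= x <= t -> is_lub (S x) (epsilon (inhabits 0) (is_lub (S x)))).
  { intros x Hx. apply epsilon_spec.
    destruct (completeness (S x)) as [m Hm].
    - exists B. intros r [l [Hl ->]].
      specialize (HB _ (chain_snoc _ _ _ t Hl (proj2 Hx))). rewrite cvar_snoc in HB.
      pose proof (Rabs_pos (g t - g x)). lra.
    - exists (cvar g 0 [] x), []. simpl; split; [lra | reflexivity].
    - exists m; exact Hm. }
  exists (fun x => epsilon (inhabits 0) (is_lub (S x))). split.
  - intros x y H0 Hxy Hy. destruct (HS x) as [A1 A2]; [lra|]. destruct (HS y) as [B1 B2]; [lra|].
    set (vx := epsilon _ (is_lub (S x))) in *. set (vy := epsilon _ (is_lub (S y))) in *.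
    assert (vx <= vy - Rabs (g y - g x)); [|lra].
    apply A2. intros r [l [Hl ->]].
    assert (cvar g 0 l x + Rabs (g y - g x) <= vy); [|lra].
    rewrite <- cvar_snoc. apply B1. exists (l ++ [x]). split; [apply chain_snoc; auto | reflexivity].
  - intros e He. destruct (HS 0) as [A1 A2]; [lra|]. destruct (HS t) as [B1 B2]; [lra|].
    set (v0 := epsilon _ (is_lub (S 0))) in *. set (vt := epsilon _ (is_lub (S t))) in *.
    assert (0 <= v0).
    { apply Rle_trans with (cvar g 0 [] 0); [simpl; apply Rabs_pos|]. apply A1. exists []. simpl; split; [lra|reflexivity]. }
    apply NNPP. intros Hno. assert (vt <= vt - e); [|lra].
    apply B2. intros r [l [Hl ->]]. apply Rnot_lt_le. intros Hlt. apply Hno. exists l. split; [exact Hl|lra].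
Qed.

(* [K] is [v] corrected by [g] with the sign of its increment on each piece of the chain: it stays
   nondecreasing, its total increment is the defect of the chain, and it grows at least like [v + |g|]
   wherever [g] moves against the sign of its piece. *)
Lemma variation_defect (g v : R -> R) (t : R) :
  (forall x y, 0 <= x -> x <= y -> y <= t -> Rabs (g y - g x) <= v y - v x) ->
  forall l x y, 0 <= x -> y <= t -> chain x l y ->
  exists (K : R -> R) (pts : list R),
    (forall u w, x <= u -> u <= w -> w <= y -> K u <= K w) /\
    K y - K x = v y - v x - cvar g x l y /\
    (forall z, x < z < y -> ~ In z pts -> exists d s, 0 < d /\ (s = 1 \/ s = -1) /\
       forall u w, x <= u -> w <= y -> z - d < u -> u <= w -> w < z + d ->
         K w - K u = v w - v u - s * (g w - g u)).
Proof.
  intros Hv.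
  assert (Hs : forall x y, exists s, (s = 1 \/ s = -1) /\ s * (g y - g x) = Rabs (g y - g x)).
  { intros x y. destruct (Rle_or_lt 0 (g y - g x)).
    - exists 1. rewrite Rabs_right by lra. split; [auto | ring].
    - exists (-1). rewrite Rabs_left by lra. split; [auto | ring]. }
  assert (Hmono : forall s u w, (s = 1 \/ s = -1) -> 0 <= u -> u <= w -> w <= t ->
            v u - s * g u <= v w - s * g w).
  { intros s u w [->| ->] H1 H2 H3; specialize (Hv u w H1 H2 H3);
      pose proof (Rle_abs (g w - g u)); pose proof (Rle_abs (- (g w - g u))) as Hn; rewrite Rabs_Ropp in Hn; lra. }
  induction l as [|c l IH]; simpl; intros x y Hx Hy Hc.
  - destruct (Hs x y) as [s [Hs1 Hs2]]. exists (fun w => v w - s * g w), []. repeat split.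
    + intros u w H1 H2 H3. apply Hmono; auto; lra.
    + rewrite <- Hs2. ring.
    + intros z Hz _. exists 1, s. repeat split; auto; [lra|]. intros; ring.
  - destruct Hc as [Hxc Hc]. pose proof (chain_le _ _ _ Hc) as Hcy.
    destruct (IH c y) as (K' & pts & KP1 & KP2 & KP3); auto; [lra|].
    destruct (Hs x c) as [s [Hs1 Hs2]].
    (* The additive constant makes both pieces agree at c. *)
    exists (fun w => if Rle_dec w c then v w - s * g w - (v c - s * g c) + K' c else K' w), (c :: pts).
    split; [|split].
    + intros u w H1 H2 H3. repeat destruct Rle_dec; try lra.
      * assert (v u - s * g u <= v w - s * g w) by (apply Hmono; auto; lra). lra.
      * assert (v u - s * g u <= v c - s * g c) by (apply Hmono; auto; lra).
        assert (K' c <= K' w) by (apply KP1; lra). lra.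
      * apply KP1; lra.
    + destruct (Rle_dec x c); [|lra]. destruct (Rle_dec y c).
      * replace y with c in * by lra. rewrite <- Hs2. lra.
      * rewrite <- Hs2. lra.
    + intros z Hz Hnot. simpl in Hnot. destruct (Rlt_or_le z c) as [Hzc|Hzc].
      * exists (c - z), s. repeat split; auto; [lra|]. intros u w H1 H2 H3 H4 H5.
        repeat destruct Rle_dec; lra.
      * assert (c < z) by (destruct (Req_dec c z); [tauto | lra]).
        destruct (KP3 z) as (d & s' & Hd & Hs' & H'); [lra | tauto |].
        exists (Rmin d (z - c)), s'. pose proof (Rmin_l d (z - c)). pose proof (Rmin_r d (z - c)).
        repeat split; auto; [apply Rmin_pos; lra|]. intros u w A1 A2 A3 A4 A5.
        repeat destruct Rle_dec; try lra. apply H'; lra.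
Qed.

(** * Differentiability almost everywhere *)

Definition near_iv (t x d u w : R) : Prop := 0 <= u /\ w <= t /\ u < w /\ u <= x <= w /\ x - d < u /\ w < x + d.

(** Points at which steep ascents and steep descents coexist at all scales. Any gap between two
    derivates takes this form once a linear function with a slope in the gap has been subtracted. *)
Definition both_signs (g : R -> R) (t b x : R) : Prop :=
  0 < x < t /\ forall d, 0 < d ->
    (exists u w, near_iv t x d u w /\ b * (w - u) <= g w - g u) /\
    (exists u w, near_iv t x d u w /\ g w - g u <= - b * (w - u)).

(** Disjoint intervals on which K has mean slope at least b have total length at most (K t - K 0) /
    b; the factor 5 is that of [vitali]. *)
Lemma steep_family_cover (K : R -> R) (t b : R) (A : R -> Prop) : 0 < b -> 0 < t ->
  (forall u w, 0 <= u -> u <= w -> w <= t -> K u <= K w) ->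
  (forall x, A x -> exists u w, 0 <= u /\ u < w /\ w <= t /\ u <= x <= w /\ b * (w - u) <= K w - K u) ->
  gsmall A (5 * ((K t - K 0) / b)).
Proof.
  intros Hb Ht HK HA.
  set (Fam := fun I : R * R => 0 <= fst I /\ fst I < snd I /\ snd I <= t /\ b * len I <= incr K I).
  destruct (vitali Fam t ((K t - K 0) / b)) with (A := A) as [s [Hs Hle]].
  - intros I (H1 & H2 & H3 & _). unfold len. lra.
  - intros l Hl Hd.
    assert (b * sumL len l <= K t - K 0).
    { rewrite <- sumL_scal. apply Rle_trans with (sumL (incr K) l).
      - apply sumL_le. eapply Forall_impl; [|exact Hl]. intros I (_ & _ & _ & H); exact H.
      - apply (pdisj_incr_le K (length l)); auto; [lra|].
        eapply Forall_impl; [|exact Hl]. intros I (H1 & H2 & H3 & _); lra. }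
    apply Rmult_le_reg_l with b; [exact Hb|]. replace (b * ((K t - K 0) / b)) with (K t - K 0) by (field; lra). exact H.
  - intros x Hx. destruct (HA x Hx) as (u & w & H1 & H2 & H3 & H4 & H5).
    exists (u, w). unfold Fam, len, incr; simpl. auto.
  - apply gsmall_subset with A s; auto. apply cover_gsmall, Hs.
Qed.

(** Away from the chain points K is locally v - s g up to a constant. Of the two kinds of small
    intervals at x, the one on which g moves against s gives K a mean slope at least b. As K grows
    by at most b e / 10 in all, these points cost e / 2; the other e / 2 goes to the finitely many
    chain points. *)
Lemma both_signs_gnull g t b : 0 < t -> 0 < b -> bounded_var g t -> gnull (both_signs g t b).
Proof.
  intros Ht Hb Hg e He.
  destruct (total_variation g t) as (v & Hv & Hl); [lra | exact Hg |].
  destruct (Hl (b * e / 10)) as (l & Hch & Hdef); [unfold Rdiv; repeat apply Rmult_lt_0_compat; lra|].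
  destruct (variation_defect g v t Hv l 0 t) as (K & pts & K1 & K2 & K3); [lra | lra | exact Hch |].
  apply gsmall_subset with (fun x => (both_signs g t b x /\ ~ In x pts) \/ In x pts) (e / 2 + e / 2).
  - intros x Hx. destruct (classic (In x pts)); tauto.
  - lra.
  - apply gsmall_union; [|lra | apply gnull_finite | lra].
    apply gsmall_subset with (fun x => both_signs g t b x /\ ~ In x pts) (5 * ((K t - K 0) / b)); auto.
    + assert ((K t - K 0) / b <= e / 10); [|lra].
      apply Rmult_le_reg_l with b; [exact Hb|]. replace (b * ((K t - K 0) / b)) with (K t - K 0) by (field; lra). lra.
    + apply steep_family_cover; auto.
      intros x [[Hx Hbs] Hnot]. destruct (K3 x Hx Hnot) as (d & s & Hd & Hs & HK).
      destruct (Hbs d Hd) as [(u1 & w1 & (A1 & A2 & A3 & A4 & A5 & A6) & A7) (u2 & w2 & (B1 & B2 & B3 & B4 & B5 & B6) & B7)].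
      destruct Hs as [->| ->].
      * exists u2, w2. repeat split; try lra. rewrite HK by lra.
        specialize (Hv u2 w2 B1 (Rlt_le _ _ B3) B2). pose proof (Rabs_pos (g w2 - g u2)). lra.
      * exists u1, w1. repeat split; try lra. rewrite HK by lra.
        specialize (Hv u1 w1 A1 (Rlt_le _ _ A3) A2). pose proof (Rabs_pos (g w1 - g u1)). lra.
Qed.

Definition infinite_slope (g : R -> R) (t x : R) : Prop :=
  0 < x < t /\ forall n d, 0 < d -> exists u w, near_iv t x d u w /\ INR n * (w - u) <= Rabs (g w - g u).

Lemma infinite_slope_gnull g t : 0 < t -> bounded_var g t -> gnull (infinite_slope g t).
Proof.
  intros Ht Hg e He.
  destruct (total_variation g t) as (v & Hv & _); [lra | exact Hg |].
  assert (Hm : forall x y, 0 <= x -> x <= y -> y <= t -> v x <= v y).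
  { intros x y H1 H2 H3. specialize (Hv x y H1 H2 H3). pose proof (Rabs_pos (g y - g x)). lra. }
  destruct (INR_unbounded (Rmax 1 (5 * (v t - v 0) / e))) as [n Hn].
  pose proof (Rmax_l 1 (5 * (v t - v 0) / e)). pose proof (Rmax_r 1 (5 * (v t - v 0) / e)).
  apply gsmall_subset with (infinite_slope g t) (5 * ((v t - v 0) / INR n)); auto.
  - apply Rmult_le_reg_r with (INR n); [lra|].
    replace (5 * ((v t - v 0) / INR n) * INR n) with (5 * (v t - v 0) / e * e) by (field; lra).
    rewrite (Rmult_comm e). apply Rmult_le_compat_r; lra.
  - apply steep_family_cover; auto; [lra|].
    intros x [Hx H']. destruct (H' n 1) as (u & w & (A1 & A2 & A3 & A4 & A5 & A6) & A7); [lra|].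
    exists u, w. repeat split; try lra. specialize (Hv u w A1 (Rlt_le _ _ A3) A2). lra.
Qed.

(** The numerator is a difference of naturals, so that countable unions over slopes run over indices
    in [nat]. *)
Definition grid (n i j : nat) : R := (INR i - INR j) / INR (S n).

Lemma grid_approx (n : nat) (r : R) : exists i j, r <= grid n i j <= r + / INR (S n).
Proof.
  assert (HS : 0 < INR (S n)) by (apply lt_0_INR; lia).
  destruct (archimed (r * INR (S n))) as [H1 H2].
  set (k := up (r * INR (S n))) in *.
  assert (Hk : exists i j : nat, IZR k = INR i - INR j).
  { exists (Z.to_nat k), (Z.to_nat (- k)). rewrite !INR_IZR_INZ, <- minus_IZR. f_equal. lia. }
  destruct Hk as (i & j & Hk). exists i, j. unfold grid. rewrite <- Hk. split.
  - apply Rmult_le_reg_r with (INR (S n)); [exact HS|].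
    replace (IZR k / INR (S n) * INR (S n)) with (IZR k) by (field; lra). lra.
  - apply Rmult_le_reg_r with (INR (S n)); [exact HS|].
    replace (IZR k / INR (S n) * INR (S n)) with (IZR k) by (field; lra).
    replace ((r + / INR (S n)) * INR (S n)) with (r * INR (S n) + 1) by (field; lra). lra.
Qed.

(** If the difference quotients at x are bounded, let s be their upper limit as h -> 0. They are
    eventually below s + eps. If they kept returning below s - eps, then with e = 1 / (n + 1) < eps
    / 5 a grid slope c in [s - 3 e, s - 2 e] would be passed on both sides by the margin e. *)
Lemma nondifferentiable_cases (g : R -> R) (t x : R) : 0 < x < t ->
  ~ (exists l, derivable_pt_lim g x l) ->
  infinite_slope g t x \/ exists n i j, both_signs (fun y => g y - grid n i j * y) t (/ INR (S n)) x.
Proof.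
  intros Hx Hnd. apply NNPP. intros Hno. apply not_or_and in Hno. destruct Hno as [Hinf Hbs].
  set (q := fun h => (g (x + h) - g x) / h).
  set (r0 := Rmin x (t - x)).
  assert (Hr0 : 0 < r0) by (unfold r0; apply Rmin_pos; lra).
  assert (Hr1 : r0 <= x) by apply Rmin_l. assert (Hr2 : r0 <= t - x) by apply Rmin_r.
  assert (Hiv : forall h d, h <> 0 -> Rabs h < d -> Rabs h < r0 ->
     exists u w, near_iv t x d u w /\ g w - g u = q h * (w - u)).
  { intros h d Hh Hd Hr. unfold near_iv. destruct (Rlt_or_le h 0).
    - rewrite Rabs_left in * by lra. exists (x + h), x. repeat split; try lra. unfold q. field; lra.
    - rewrite Rabs_right in * by lra. exists x, (x + h). repeat split; try lra. unfold q. field; lra. }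
  assert (Hbd : exists n d, 0 < d /\ forall h, h <> 0 -> Rabs h < d -> Rabs (q h) < INR n).
  { apply NNPP. intros Hn. apply Hinf. split; [exact Hx|]. intros n d Hd.
    apply NNPP. intros Hn'. apply Hn. exists n, (Rmin d r0). split; [apply Rmin_pos; lra|].
    intros h Hh Hhd. apply Rnot_le_lt. intros Hge. apply Hn'.
    pose proof (Rmin_l d r0). pose proof (Rmin_r d r0).
    destruct (Hiv h d) as (u & w & H1 & H2); [exact Hh | lra | lra |].
    exists u, w. split; [exact H1|]. rewrite H2, Rabs_mult. destruct H1 as (_ & _ & H1 & _).
    rewrite (Rabs_right (w - u)) by lra. apply Rmult_le_compat_r; lra. }
  destruct Hbd as (M & dM & HdM & HM).
  set (freq := fun r => forall d, 0 < d -> exists h, h <> 0 /\ Rabs h < d /\ r < q h).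
  destruct (completeness freq) as [s [Hub Hlub]].
  - exists (INR M). intros r Hr. destruct (Hr dM HdM) as (h & H1 & H2 & H3).
    specialize (HM h H1 H2). apply Rabs_def2 in HM. lra.
  - exists (- INR M). intros d Hd. exists (Rmin d dM / 2).
    pose proof (Rmin_l d dM). pose proof (Rmin_r d dM). assert (0 < Rmin d dM) by (apply Rmin_pos; lra).
    assert (A1 : Rmin d dM / 2 <> 0) by lra.
    assert (A2 : Rabs (Rmin d dM / 2) < dM) by (rewrite Rabs_right; lra).
    repeat split; auto; [rewrite Rabs_right; lra|].
    specialize (HM _ A1 A2). apply Rabs_def2 in HM. lra.
  - apply Hnd. exists s. intros eps Heps.
    assert (Hup : exists d, 0 < d /\ forall h, h <> 0 -> Rabs h < d -> q h < s + eps).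
    { apply NNPP. intros Hn. assert (s + eps / 2 <= s); [|lra]. apply Hub.
      intros d Hd. apply NNPP. intros Hn'. apply Hn. exists d. split; [exact Hd|].
      intros h Hh Hhd. apply Rnot_le_lt. intros Hge. apply Hn'. exists h. repeat split; auto. lra. }
    assert (Hlo : exists d, 0 < d /\ forall h, h <> 0 -> Rabs h < d -> s - eps < q h).
    { destruct (INR_unbounded (5 / eps)) as [n Hn].
      assert (HS : 0 < / INR (S n) < eps / 5).
      { rewrite S_INR. assert (0 < 5 / eps) by (apply Rdiv_lt_0_compat; lra).
        split; [apply Rinv_0_lt_compat; lra|].
        replace (eps / 5) with (/ (5 / eps)) by (field; lra).
        apply Rinv_lt_contravar; [apply Rmult_lt_0_compat; lra | lra]. }
      set (e := / INR (S n)) in *.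
      destruct (grid_approx n (s - 3 * e)) as (i & j & Hc). fold e in Hc.
      set (c := grid n i j) in *.
      assert (Hfreq : freq (c + e)).
      { apply NNPP. intros Hnf. assert (s <= c + e); [|lra]. apply Hlub. intros r Hr.
        apply Rnot_lt_le. intros Hlt. apply Hnf. intros d Hd.
        destruct (Hr d Hd) as (h & H1 & H2 & H3). exists h. repeat split; auto. lra. }
      apply NNPP. intros Hn'. apply Hbs. exists n, i, j. fold c. fold e. split; [exact Hx|].
      intros d Hd. pose proof (Rmin_l d r0). pose proof (Rmin_r d r0).
      assert (Hm : 0 < Rmin d r0) by (apply Rmin_pos; lra). split.
      - destruct (Hfreq _ Hm) as (h & H1 & H2 & H3).
        destruct (Hiv h d) as (u & w & A1 & A2); [exact H1 | lra | lra |].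
        exists u, w. split; [exact A1|]. destruct A1 as (_ & _ & A1 & _).
        replace (g w - c * w - (g u - c * u)) with ((q h - c) * (w - u)) by (rewrite Rmult_minus_distr_r, <- A2; ring).
        apply Rmult_le_compat_r; lra.
      - assert (Hex : exists h, h <> 0 /\ Rabs h < Rmin d r0 /\ q h <= s - eps).
        { apply NNPP. intros Hn2. apply Hn'. exists (Rmin d r0). split; [exact Hm|].
          intros h Hh Hhd. apply Rnot_le_lt. intros Hle. apply Hn2. exists h. auto. }
        destruct Hex as (h & H1 & H2 & H3).
        destruct (Hiv h d) as (u & w & A1 & A2); [exact H1 | lra | lra |].
        exists u, w. split; [exact A1|]. destruct A1 as (_ & _ & A1 & _).
        replace (g w - c * w - (g u - c * u)) with ((q h - c) * (w - u)) by (rewrite Rmult_minus_distr_r, <- A2; ring).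
        apply Rmult_le_compat_r; lra. }
    destruct Hup as (d1 & Hd1 & Hup). destruct Hlo as (d2 & Hd2 & Hlo).
    assert (Hm : 0 < Rmin d1 d2) by (apply Rmin_pos; lra).
    exists (mkposreal _ Hm). simpl. intros h Hh Hhd.
    pose proof (Rmin_l d1 d2). pose proof (Rmin_r d1 d2).
    specialize (Hup h Hh). specialize (Hlo h Hh). fold (q h). apply Rabs_def1; [apply Rplus_lt_reg_r with s|];
    [assert (q h < s + eps) by (apply Hup; lra); lra | assert (s - eps < q h) by (apply Hlo; lra); lra].
Qed.

Theorem abs_cont_differentiable_ae g t : 0 < t -> abs_cont_on g t ->
  gnull (fun x => 0 < x < t /\ ~ exists l, derivable_pt_lim g x l).
Proof.
  intros Ht Hac. assert (Hbv : bounded_var g t) by (apply abs_cont_bounded_var; [lra | exact Hac]).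
  apply gnull_subset with (fun x => infinite_slope g t x \/
    exists n i j, both_signs (fun y => g y - grid n i j * y) t (/ INR (S n)) x).
  - intros x [Hx Hn]. apply nondifferentiable_cases; assumption.
  - apply gnull_union; [apply infinite_slope_gnull; assumption|].
    do 3 (apply gnull_countable_union; intro). apply both_signs_gnull; [exact Ht | | apply bounded_var_shift, Hbv].
    apply Rinv_0_lt_compat, lt_0_INR; lia.
Qed.

(** * The action integral *)

Lemma derivable_pt_lim_straddle (f : R -> R) (s d e : R) : derivable_pt_lim f s d -> 0 < e ->
  exists r, 0 < r /\ forall u w, u <= s <= w -> s - r < u -> w < s + r ->
    Rabs (f w - f u - d * (w - u)) <= e * (w - u).
Proof.
  intros Hd He. destruct (Hd e He) as [[r Hr] H]. simpl in H.
  exists r. split; [exact Hr|]. intros u w Hs Hu Hw.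
  assert (P : forall x, Rabs (x - s) < r -> Rabs (f x - f s - d * (x - s)) <= e * Rabs (x - s)).
  { intros x Hx. destruct (Req_dec x s) as [->|Hne].
    - rewrite !Rminus_diag, Rmult_0_r, Rminus_0_r, Rabs_R0. lra.
    - assert (x - s <> 0) by lra. specialize (H (x - s) H0 Hx).
      replace (s + (x - s)) with x in H by ring.
      replace (f x - f s - d * (x - s)) with (((f x - f s) / (x - s) - d) * (x - s)) by (field; lra).
      rewrite Rabs_mult. apply Rmult_le_compat_r; [apply Rabs_pos | lra]. }
  assert (P1 : Rabs (f w - f s - d * (w - s)) <= e * (w - s)).
  { rewrite <- (Rabs_right (w - s)) at 2 by lra. apply P. rewrite Rabs_right; lra. }
  assert (P2 : Rabs (f u - f s - d * (u - s)) <= e * (s - u)).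
  { replace (s - u) with (Rabs (u - s)) by (rewrite Rabs_left1; lra). apply P. rewrite Rabs_left1; lra. }
  replace (f w - f u - d * (w - u)) with ((f w - f s - d * (w - s)) + - (f u - f s - d * (u - s))) by ring.
  eapply Rle_trans; [apply Rabs_triang|]. rewrite Rabs_Ropp. lra.
Qed.

Fixpoint min_gauge (d : nat -> R -> R) (n : nat) (x : R) : R :=
  match n with O => 1 | S n => Rmin (d n x) (min_gauge d n x) end.

Lemma min_gauge_pos d n x : (forall n, 0 < d n x) -> 0 < min_gauge d n x.
Proof. intros H. induction n; simpl; [lra | apply Rmin_pos; auto]. Qed.

Lemma min_gauge_le d n x i : (i < n)%nat -> min_gauge d n x <= d i x.
Proof.
  induction n as [|n IH]; intros Hi; [lia|]. simpl. destruct (Nat.eq_dec i n) as [->|Hne].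
  - apply Rmin_l.
  - eapply Rle_trans; [apply Rmin_r|]. apply IH. lia.
Qed.

Lemma fine_weaken (d d' : R -> R) (p : (R * R) * R) : d' (snd p) <= d (snd p) -> fine d' p -> fine d p.
Proof. unfold fine. intros; lra. Qed.

Lemma tiles_tags a l b : tiles a l b -> Forall (fun p => fst (fst p) <= snd p <= snd (fst p)) l ->
  Forall (fun p => a <= fst (fst p) /\ fst (fst p) <= snd p /\ snd p <= snd (fst p) /\ snd (fst p) <= b) l.
Proof.
  revert a; induction l as [|[[u v] x] l IH]; simpl; intros a H Hf; [constructor|].
  destruct H as (-> & H2 & H3). inversion Hf as [|? ? Hx Hf']; subst. simpl in *.
  pose proof (ivs_le _ _ _ (tiles_ivs _ _ _ H3)).
  constructor; [simpl; lra|]. specialize (IH _ H3 Hf'). eapply Forall_impl; [|exact IH]. simpl; intros; lra.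
Qed.

(** Here k counts levels h, 2h, ..., k h, all below D, and D exceeds k h by at most h: this is the
    rounding error of a lower Riemann sum. *)
Lemma level_index (D h : R) : 0 < h ->
  exists k : nat, D <= (INR k + 1) * h /\ forall j, (j < k)%nat -> INR (S j) * h < D.
Proof.
  intros Hh. destruct (INR_unbounded (D / h)) as [n Hn].
  assert (Hn' : D <= (INR n + 1) * h).
  { apply (Rmult_lt_compat_r h) in Hn; [|exact Hh]. rewrite Rdiv_mult in Hn by lra. lra. }
  clear Hn. induction n as [|n IH].
  - exists 0%nat. split; [exact Hn' | intros; lia].
  - destruct (Rle_or_lt D ((INR n + 1) * h)) as [H|H]; [auto|].
    exists (S n). split; [exact Hn'|]. intros j Hj.
    apply Rle_lt_trans with ((INR n + 1) * h); [|exact H].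
    apply Rmult_le_compat_r; [lra|]. rewrite <- S_INR. apply le_INR. lia.
Qed.

Lemma sublevel_coverable (P : R -> Prop) t : 0 < t -> exists s, cover_length (fun s => 0 <= s <= t /\ P s) s.
Proof. intros Ht. exists (t - 0 + 1). apply cover_interval; try lra. tauto. Qed.

(** On tiles whose tag is a differentiability point of gamma, the increment of f is at most its
    derivative times the length, up to e; rounded to the levels e, 2e, ..., the derivative counts
    the level sets [E j] containing the tag. Exchanging the sums, the tiles tagged in [E j] have
    total length at most the outer measure of [E j] plus 2^-(j+1), which reproduces a lower sum of
    the integral. The remaining tiles are short in total, so by absolute continuity and the
    Lipschitz hypothesis they contribute O(e). *)
Lemma derivative_le_integral (gamma f : R -> R) (lev : R -> R -> Prop) (t c K : R) :
  0 < t -> 0 <= K -> abs_cont_on gamma t ->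
  (forall u w, 0 <= u -> u <= w -> w <= t -> Rabs (f w - f u) <= K * ((w - u) + Rabs (gamma w - gamma u))) ->
  (forall s v, 0 < s < t -> derivable_pt_lim gamma s v ->
     exists d, derivable_pt_lim f s d /\ forall y, y < d -> lev y s) ->
  integral_0t lev t c -> f t - f 0 <= c.
Proof.
  intros Ht HK Hac Hlip Hder [Hc _].
  assert (Main : forall e, 0 < e -> f t - f 0 <= c + e * (2 * t + 1 + 2 * K)).
  { intros e He.
    destruct (abs_cont_on_list _ _ Hac e He) as [d0 [Hd0 Hsmall]].
    set (Good := fun x => 0 < x < t /\ exists l, derivable_pt_lim gamma x l).
    set (E := fun j s => 0 <= s <= t /\ lev (INR (S j) * e) s).
    assert (HE : forall j, gsmall (E j) (leb_measure (E j) + 1 * (1 / 2) ^ S j)).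
    { intros j. apply leb_measure_gsmall; [apply sublevel_coverable, Ht|].
      rewrite Rmult_1_l. apply pow_lt; lra. }
    set (dE := fun j => proj1_sig (constructive_indefinite_description _ (HE j))).
    assert (HdE : forall j, (forall x, 0 < dE j x) /\
      forall a b l, ivs a (map fst l) b -> Forall (fine (dE j)) l -> Forall (fun p => E j (snd p)) l ->
        sumL (fun p => len (fst p)) l <= leb_measure (E j) + 1 * (1 / 2) ^ S j).
    { intros j. unfold dE. destruct constructive_indefinite_description; auto. }
    assert (Hbad : gnull (fun x => 0 <= x <= t /\ ~ Good x)).
    (* The end points join the bad set, since the hypothesis on derivatives concerns interior times
       only. *)
    { apply gnull_subset with (fun x => (0 < x < t /\ ~ exists l, derivable_pt_lim gamma x l) \/ In x [0; t]).
      - intros x [Hx Hn]. simpl. destruct (Req_dec x 0); [auto|]. destruct (Req_dec x t); [auto|].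
        left. split; [lra|]. intros Hl. apply Hn. split; [lra | exact Hl].
      - apply gnull_union; [apply abs_cont_differentiable_ae; assumption | apply gnull_finite]. }
    assert (Hm : 0 < Rmin d0 e / 2) by (assert (0 < Rmin d0 e) by (apply Rmin_pos; lra); lra).
    destruct (Hbad _ Hm) as (db & Hdb & Hb). clear Hbad.
    assert (HD : forall x, exists D (k : nat) r, 0 < r /\ (Good x ->
       D <= (INR k + 1) * e /\ (forall j, (j < k)%nat -> E j x) /\
       forall u w, u <= x <= w -> x - r < u -> w < x + r -> Rabs (f w - f u - D * (w - u)) <= e * (w - u))).
    { intros x. destruct (classic (Good x)) as [[Hx [v Hv]]|Hn].
      - destruct (Hder x v Hx Hv) as (D & HD & Hlev). destruct (level_index D e He) as (k & Hk1 & Hk2).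
        destruct (derivable_pt_lim_straddle f x D e HD He) as (r & Hr & Hstr).
        exists D, k, r. split; [exact Hr|]. intros _. repeat split; auto; lra.
      - exists 0, 0%nat, 1. split; [lra | tauto]. }
    apply choice in HD. destruct HD as [D HD]. apply choice in HD. destruct HD as [k HD].
    apply choice in HD. destruct HD as [r HD].
    set (good := fun p : R * R * R => if excluded_middle_informative (Good (snd p)) then true else false).
    (* A good tag has to respect only the gauges of its first [k x] levels, so a finite minimum
       suffices. *)
    set (dl := fun x => if excluded_middle_informative (Good x) then Rmin (r x) (min_gauge dE (k x) x) else db x).
    destruct (cousin dl 0 t) as (l & Hl & Hfine); [|lra|].
    { intros x. unfold dl. destruct excluded_middle_informative; [|apply Hdb].
      apply Rmin_pos; [apply HD|]. apply min_gauge_pos. intros; apply HdE. }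
    pose proof (tiles_ivs _ _ _ Hl) as Hivs.
    assert (Htags : Forall (fun p => 0 <= fst (fst p) /\ fst (fst p) <= snd p /\ snd p <= snd (fst p) /\ snd (fst p) <= t) l).
    { apply tiles_tags; [exact Hl|]. eapply Forall_impl; [|exact Hfine]. unfold fine. tauto. }
    assert (Hall : Forall (fun p => fine dl p /\ 0 <= fst (fst p) /\ fst (fst p) <= snd p /\ snd p <= snd (fst p) /\ snd (fst p) <= t) l).
    { rewrite Forall_forall in *. intros p Hp. split; auto. }
    rewrite <- (tiles_telescope f _ _ _ Hl). rewrite (sumL_filter_split _ good).
    set (lg := filter good l). set (lb := filter (fun x => negb (good x)) l).
    assert (Hlen : sumL (fun p => len (fst p)) lg <= t).
    { rewrite <- sumL_map. apply Rle_trans with (t - 0); [|lra].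
      apply (ivs_incr_le (fun x => x)); [auto|]. unfold lg. apply ivs_filter, Hivs. }
    assert (Bad : sumL (fun p => incr f (fst p)) lb <= K * (2 * e)).
    { apply Rle_trans with (K * (sumL (fun p => len (fst p)) lb + sumL (fun p => Rabs (incr gamma (fst p))) lb)).
      - rewrite <- sumL_plus, <- sumL_scal. apply sumL_le.
        apply Forall_filter_and with (1 := Hall). intros [[u w] x] [_ Hp] _. simpl in *.
        unfold incr, len; simpl. eapply Rle_trans; [apply Rle_abs|]. apply Hlip; lra.
      - apply Rmult_le_compat_l; [exact HK|].
        assert (A1 : sumL (fun p => len (fst p)) lb <= Rmin d0 e / 2).
        { apply (Hb 0 t).
          - apply ivs_filter, Hivs.
          - apply Forall_filter_and with (1 := Hall). intros p [Hp _] Hg. revert Hp. apply fine_weaken.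
            unfold dl, good in *. destruct excluded_middle_informative; [discriminate | lra].
          - apply Forall_filter_and with (1 := Hall). intros p [_ Hp] Hg. split; [lra|].
            unfold good in Hg. destruct excluded_middle_informative; [discriminate | assumption]. }
        pose proof (Rmin_l d0 e). pose proof (Rmin_r d0 e).
        assert (A2 : sumL (fun p => Rabs (incr gamma p)) (map fst lb) < e).
        { apply Hsmall; [apply ivs_filter, Hivs|]. rewrite sumL_map. lra. }
        rewrite sumL_map in A2. lra. }
    assert (Hlg : Forall (fun p => fine dl p /\ Good (snd p)) lg).
    { apply Forall_filter_and with (1 := Hall). intros p [Hp _] Hg. split; [exact Hp|].
      unfold good in Hg. destruct excluded_middle_informative; [assumption | discriminate]. }
    assert (HN : exists N, Forall (fun p : R * R * R => (k (snd p) < N)%nat) lg) by (apply (nat_valued_bounded (fun p : R*R*R => k (snd p)))).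
    destruct HN as [N HN].
    assert (Lev : sumL (fun p => INR (k (snd p)) * len (fst p)) lg
                  <= sumN (fun j => leb_measure (E j)) N + 1).
    { replace (sumL (fun p => INR (k (snd p)) * len (fst p)) lg) with
        (sumN (fun j => sumL (fun p => len (fst p)) (filter (fun p => (j <? k (snd p))%nat) lg)) N).
      - apply Rle_trans with (sumN (fun j => leb_measure (E j) + 1 * (1/2) ^ S j) N).
        + apply sumN_le. intros j _. apply (proj2 (HdE j) 0 t).
          * unfold lg. apply ivs_filter, ivs_filter, Hivs.
          * apply Forall_filter_and with (1 := Hlg). intros p [Hp Hg] Hj. revert Hp.
            apply Nat.ltb_lt in Hj. apply fine_weaken.
            unfold dl. destruct excluded_middle_informative; [|contradiction].
            eapply Rle_trans; [apply Rmin_r | apply min_gauge_le, Hj].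
          * apply Forall_filter_and with (1 := Hlg). intros p [Hp Hg] Hj.
            apply Nat.ltb_lt in Hj. destruct (HD (snd p)) as [_ HDx].
            apply (proj1 (proj2 (HDx Hg))), Hj.
        + rewrite sumN_plus. pose proof (sumN_pow_half 1 N). lra.
      - rewrite sumL_exchange. clearbody lg. clear - HN. induction HN as [|p l' Hp _ IH]; simpl; [ring|].
        rewrite IH. f_equal. apply sumN_indicator_lt. lia. }
    assert (Gd : sumL (fun p => incr f (fst p)) lg <=
                 (e + e) * sumL (fun p => len (fst p)) lg + e * sumL (fun p => INR (k (snd p)) * len (fst p)) lg).
    { rewrite <- !sumL_scal, <- sumL_plus. apply sumL_le.
      apply Forall_filter_and with (1 := Hall). intros [[u w] x] [Hf Hp] Hg. unfold good in Hg. simpl in *.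
      destruct excluded_middle_informative as [Hx|]; [|discriminate].
      destruct (HD x) as (Hr & HDx). specialize (HDx Hx). destruct HDx as (H1 & _ & H3).
      unfold fine, dl in Hf. simpl in Hf. destruct excluded_middle_informative; [|contradiction].
      pose proof (Rmin_l (r x) (min_gauge dE (k x) x)).
      specialize (H3 u w). unfold incr, len; simpl.
      assert (Rabs (f w - f u - D x * (w - u)) <= e * (w - u)) by (apply H3; lra).
      pose proof (Rle_abs (f w - f u - D x * (w - u))).
      assert (D x * (w - u) <= (INR (k x) + 1) * e * (w - u)) by (apply Rmult_le_compat_r; lra). lra. }
    assert (Hcc : e * sumN (fun j => leb_measure (E j)) N <= c).
    { apply Hc. exists N, e. split; [exact He|]. rewrite <- sumN_scal. reflexivity. }
    assert (0 <= e + e) by lra.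
    assert ((e + e) * sumL (fun p => len (fst p)) lg <= (e + e) * t) by (apply Rmult_le_compat_l; lra).
    apply (Rmult_le_compat_l e) in Lev; [|lra]. unfold lg, lb in *. lra. }
  apply Rnot_lt_le. intros Hlt.
  set (C := 2 * t + 1 + 2 * K) in *. assert (HC : 0 < C) by (unfold C; lra).
  specialize (Main ((f t - f 0 - c) / (2 * C))).
  assert (0 < (f t - f 0 - c) / (2 * C)) by (apply Rdiv_lt_0_compat; lra).
  specialize (Main H). replace ((f t - f 0 - c) / (2 * C) * C) with ((f t - f 0 - c) / 2) in Main by (field; lra). lra.
Qed.

(** * Upper bound of an integral by the increment of a primitive *)

Definition layer_sum (lev : R -> R -> Prop) (h : R) (N : nat) (a b : R) : R :=
  sumN (fun k => h * leb_measure (fun s => a <= s <= b /\ lev (INR (S k) * h) s)) N.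

Lemma interval_coverable (P : R -> Prop) a b : exists s, cover_length (fun s => a <= s <= b /\ P s) s.
Proof.
  destruct (Rle_or_lt a b).
  - exists (b - a + 1). apply cover_interval; try lra. tauto.
  - exists (0 - 0 + 1). apply cover_interval; try lra. intros; lra.
Qed.

Lemma layer_sum_split lev h N a b c : 0 <= h ->
  layer_sum lev h N a c <= layer_sum lev h N a b + layer_sum lev h N b c.
Proof.
  intros Hh. unfold layer_sum. rewrite <- sumN_plus. apply sumN_le. intros k _.
  rewrite <- Rmult_plus_distr_l. apply Rmult_le_compat_l; [exact Hh|].
  eapply Rle_trans; [|apply leb_measure_union; apply interval_coverable].
  apply leb_measure_mono.
  - intros s [Hs Hl]. destruct (Rle_or_lt s b); [left | right]; split; auto; lra.
  - eexists. apply cover_interval with (a := Rmin a b) (b := Rmax b c) (e := 1).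
    + pose proof (Rmin_r a b). pose proof (Rmax_l b c). lra.
    + lra.
    + intros x. pose proof (Rmin_r a b). pose proof (Rmin_l a b). pose proof (Rmax_l b c). pose proof (Rmax_r b c). lra.
Qed.

Lemma layer_sum_tiles lev h N : 0 <= h -> forall l a b, tiles a l b ->
  layer_sum lev h N a b <= sumL (fun p => layer_sum lev h N (fst (fst p)) (snd (fst p))) l.
Proof.
  intros Hh. induction l as [|[[u v] x] l IH]; simpl; intros a b H.
  - subst. unfold layer_sum. apply Rle_trans with (sumN (fun _ => 0) N); [|rewrite sumN_zero; lra].
    apply sumN_le. intros k _.
    assert (leb_measure (fun s => b <= s <= b /\ lev (INR (S k) * h) s) <= b - b).
    { apply leb_measure_interval; [lra | tauto]. }
    assert (h * leb_measure (fun s => b <= s <= b /\ lev (INR (S k) * h) s) <= h * (b - b)) by (apply Rmult_le_compat_l; lra). lra.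
  - destruct H as (-> & H1 & H2). specialize (IH _ _ H2).
    pose proof (layer_sum_split lev h N a v b Hh). lra.
Qed.

Lemma layer_sum_trivial lev h N a b : 0 <= h -> a <= b -> layer_sum lev h N a b <= INR N * h * (b - a).
Proof.
  intros Hh Hab. unfold layer_sum. induction N as [|N IH]; [simpl; lra|].
  rewrite S_INR. cbn [sumN]. set (m := leb_measure _).
  assert (m <= b - a) by (apply leb_measure_interval; [lra | tauto]).
  assert (h * m <= h * (b - a)) by (apply Rmult_le_compat_l; lra). lra.
Qed.

Lemma layer_sum_bound lev h N a b G : 0 <= h -> a <= b -> 0 <= G ->
  (forall y s, a <= s <= b -> lev y s -> y < G) -> layer_sum lev h N a b <= G * (b - a).
Proof.
  intros Hh Hab HG Hlev.
  (* Strengthened for the induction: N levels with step h reach the height N h, but none at or above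
     G counts. *)
  assert (H : layer_sum lev h N a b <= Rmin (INR N * h) G * (b - a)).
  { unfold layer_sum. induction N as [|N IH].
    - simpl. rewrite Rmult_0_l, Rmin_left by lra. lra.
    - cbn [sumN]. set (m := leb_measure _).
      destruct (Rlt_or_le (INR (S N) * h) G) as [Hl|Hl].
      + assert (m <= b - a) by (apply leb_measure_interval; [lra | tauto]).
        assert (h * m <= h * (b - a)) by (apply Rmult_le_compat_l; lra).
        rewrite (Rmin_left (INR (S N) * h)) by lra. rewrite S_INR in *.
        assert (INR N * h <= G) by lra. rewrite Rmin_left in IH by lra. lra.
      + assert (m <= 0) by (apply leb_measure_empty; intros s [Hs Hs']; specialize (Hlev _ _ Hs Hs'); lra).
        assert (h * m <= h * 0) by (apply Rmult_le_compat_l; lra).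
        rewrite (Rmin_right (INR (S N) * h)) by lra.
        assert (Rmin (INR N * h) G * (b - a) <= G * (b - a)) by (apply Rmult_le_compat_r; [lra | apply Rmin_r]). lra. }
  eapply Rle_trans; [exact H|]. apply Rmult_le_compat_r; [lra | apply Rmin_r].
Qed.

(** Local bounds from the continuity of g are added up over a fine tiling of [0,T] with T < t. The
    bound g may blow up at t, as happens when a characteristic ends at -1 or 1. The last strip of
    width q is therefore estimated crudely by N h q, a lower sum having only N levels, and the
    continuity of f at t closes the gap. *)
Lemma integral_le_primitive (lev : R -> R -> Prop) (f g : R -> R) (t : R) : 0 < t ->
  (forall s, 0 <= s < t -> derivable_pt_lim f s (g s) /\ continuity_pt g s /\ 0 <= g s) ->
  continuity_pt f t ->
  (forall y s, lev y s -> 0 < s < t /\ y < g s) ->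
  exists c, integral_0t lev t c /\ c <= f t - f 0.
Proof.
  intros Ht Hf Hft Hlev.
  assert (Hinner : forall h N T e, 0 < h -> 0 < e -> 0 <= T < t ->
            layer_sum lev h N 0 T <= f T - f 0 + e * T).
  { intros h N T e Hh He HT.
    assert (Hr : forall x, exists r, 0 < r /\ (0 <= x <= T -> forall u w, 0 <= u -> u <= x <= w -> x - r < u -> w < x + r ->
      layer_sum lev h N u w <= f w - f u + e * (w - u))).
    { intros x. destruct (classic (0 <= x <= T)) as [Hx|Hx]; [|exists 1; split; [lra | tauto]].
      destruct (Hf x) as (H1 & H2 & H3); [lra|].
      destruct (derivable_pt_lim_straddle f x (g x) (e / 2) H1) as (r1 & Hr1 & Hs); [lra|].
      destruct (H2 (e / 2)) as (r2 & Hr2 & Hg); [lra|]. simpl in Hg. unfold Rdist in Hg.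
      exists (Rmin r1 r2). pose proof (Rmin_l r1 r2). pose proof (Rmin_r r1 r2).
      split; [apply Rmin_pos; lra|]. intros _ u w Hu Hx' Hxu Hxw.
      apply Rle_trans with ((g x + e / 2) * (w - u)).
      - apply layer_sum_bound; try lra. intros y s Hs' Hl. apply Hlev in Hl. destruct Hl as [_ Hl].
        destruct (Req_dec s x) as [->|Hne]; [lra|].
        assert (Rabs (g s - g x) < e / 2).
        { apply Hg. split; [split; [exact I | lra]|]. apply Rabs_def1; lra. }
        apply Rabs_def2 in H4. lra.
      - assert (A : Rabs (f w - f u - g x * (w - u)) <= e / 2 * (w - u)) by (apply Hs; lra).
        pose proof (Rle_abs (- (f w - f u - g x * (w - u)))) as B. rewrite Rabs_Ropp in B. lra. }
    apply choice in Hr. destruct Hr as [r Hr].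
    destruct (cousin r 0 T) as (l & Hl & Hfine); [intros; apply Hr | lra |].
    assert (Htags := tiles_tags 0 l T Hl).
    specialize (Htags ltac:(eapply Forall_impl; [|exact Hfine]; unfold fine; tauto)).
    eapply Rle_trans; [apply layer_sum_tiles with (1 := Rlt_le _ _ Hh) (2 := Hl)|].
    replace (f T - f 0 + e * T) with ((f T + e * T) - (f 0 + e * 0)) by ring.
    rewrite <- (tiles_telescope (fun x => f x + e * x) 0 l T Hl). apply sumL_le.
    rewrite Forall_forall in *. intros p Hp. specialize (Htags p Hp). specialize (Hfine p Hp).
    destruct (Hr (snd p)) as [_ Hr']. unfold fine in Hfine. unfold incr.
    assert (layer_sum lev h N (fst (fst p)) (snd (fst p)) <=
            f (snd (fst p)) - f (fst (fst p)) + e * (snd (fst p) - fst (fst p))) by (apply Hr'; lra).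
    lra. }
  assert (Hub : forall v, lower_sum lev t v -> v <= f t - f 0).
  { intros v (N & h & Hh & ->). fold (layer_sum lev h N 0 t).
    apply Rnot_lt_le. intros Hlt. set (D := layer_sum lev h N 0 t - (f t - f 0)) in *.
    assert (HD : 0 < D) by (unfold D; lra).
    destruct (Hft (D / 4)) as (r & Hr & Hcont); [lra|]. simpl in Hcont. unfold Rdist in Hcont.
    set (Nh := INR N * h + 1). assert (HNh : 0 < Nh).
    { unfold Nh. assert (0 <= INR N * h) by (apply Rmult_le_pos; [apply pos_INR | lra]). lra. }
    set (q := Rmin (r / 2) (Rmin (t / 2) (D / (4 * Nh)))).
    assert (Hq : 0 < q) by (unfold q; repeat apply Rmin_pos; try lra; apply Rdiv_lt_0_compat; lra).
    assert (Hq1 : q <= r / 2) by apply Rmin_l.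
    assert (Hq2 : q <= t / 2) by (eapply Rle_trans; [apply Rmin_r | apply Rmin_l]).
    assert (Hq3 : q <= D / (4 * Nh)) by (eapply Rle_trans; [apply Rmin_r | apply Rmin_r]).
    assert (Htail : layer_sum lev h N (t - q) t <= D / 4).
    { apply Rle_trans with (Nh * q).
      - apply Rle_trans with (INR N * h * q).
        + replace q with (t - (t - q)) at 2 by ring. apply layer_sum_trivial; lra.
        + unfold Nh. lra.
      - apply Rle_trans with (Nh * (D / (4 * Nh))); [apply Rmult_le_compat_l; lra|]. right. field. lra. }
    assert (He : 0 < D / (4 * t)) by (apply Rdiv_lt_0_compat; lra).
    pose proof (Hinner h N (t - q) (D / (4 * t)) Hh He) as Hin. specialize (Hin ltac:(lra)).
    pose proof (layer_sum_split lev h N 0 (t - q) t (Rlt_le _ _ Hh)) as Hsp.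
    assert (D / (4 * t) * (t - q) <= D / 4).
    { apply Rle_trans with (D / (4 * t) * t); [apply Rmult_le_compat_l; lra|]. right. field. lra. }
    assert (Rabs (f (t - q) - f t) < D / 4).
    { apply Hcont. split; [split; [exact I | lra]|]. apply Rabs_def1; lra. }
    apply Rabs_def2 in H0. unfold D in *. lra. }
  destruct (completeness (lower_sum lev t)) as [c Hc].
  - exists (f t - f 0). exact Hub.
  - exists 0, 0%nat, 1. split; [lra | reflexivity].
  - exists c. split; [exact Hc|]. exact (proj2 Hc _ Hub).
Qed.

(** * The Hamilton-Jacobi solutions of product measures *)

(* Up to a common factor, [wp] and [wm] are the weights at time [s] of the spin values 1 and -1
   under the flip dynamics started from a single-spin field [h]; [pU] is the derivative of [U] in x. *)
Definition wp (h s : R) : R := (exp h * (1 + exp (- 2 * s)) + exp (- h) * (1 - exp (- 2 * s))) / 2.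
Definition wm (h s : R) : R := (exp h * (1 - exp (- 2 * s)) + exp (- h) * (1 + exp (- 2 * s))) / 2.
Definition ent (x : R) : R := (1 - x) / 2 * ln (1 - x) + (1 + x) / 2 * ln (1 + x).
Definition U (h s x : R) : R := ent x - (1 + x) / 2 * ln (wp h s) - (1 - x) / 2 * ln (wm h s).
Definition pU (h s x : R) : R := (ln (1 + x) - ln (1 - x) - ln (wp h s) + ln (wm h s)) / 2.

Lemma exp_le_1 x : x <= 0 -> exp x <= 1.
Proof. intros H. rewrite <- exp_0. destruct H as [H| ->]; [left; apply exp_increasing, H | right; reflexivity]. Qed.

Lemma exp_mono x y : x <= y -> exp x <= exp y.
Proof. intros [H| ->]; [left; apply exp_increasing, H | right; reflexivity]. Qed.

(** For s >= 0 the weight is a convex combination of exp h and exp (- h). *)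
Lemma wp_bounds h s : 0 <= s -> exp (- Rabs h) <= wp h s <= exp (Rabs h).
Proof.
  intros Hs. unfold wp. pose proof (exp_le_1 (- 2 * s)). pose proof (exp_pos (- 2 * s)).
  assert (exp (- Rabs h) <= exp h <= exp (Rabs h)).
  { pose proof (Rle_abs h). pose proof (Rle_abs (- h)) as H2. rewrite Rabs_Ropp in H2. split; apply exp_mono; lra. }
  assert (exp (- Rabs h) <= exp (- h) <= exp (Rabs h)).
  { pose proof (Rle_abs h). pose proof (Rle_abs (- h)) as H3. rewrite Rabs_Ropp in H3. split; apply exp_mono; lra. }
  nra.
Qed.

Lemma wm_wp h s : wm h s = wp (- h) s.
Proof. unfold wm, wp. rewrite Ropp_involutive. field. Qed.

Lemma wm_bounds h s : 0 <= s -> exp (- Rabs h) <= wm h s <= exp (Rabs h).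
Proof. intros Hs. rewrite wm_wp, <- (Rabs_Ropp h). apply wp_bounds, Hs. Qed.

Lemma wp_pos h s : 0 <= s -> 0 < wp h s.
Proof. intros Hs. pose proof (wp_bounds h s Hs). pose proof (exp_pos (- Rabs h)). lra. Qed.

Lemma wm_pos h s : 0 <= s -> 0 < wm h s.
Proof. intros Hs. pose proof (wm_bounds h s Hs). pose proof (exp_pos (- Rabs h)). lra. Qed.

Lemma exp_pU h s x : -1 < x < 1 -> 0 < wp h s -> 0 < wm h s ->
  exp (2 * pU h s x) = (1 + x) * wm h s / ((1 - x) * wp h s).
Proof.
  intros Hx Hp Hm. unfold pU.
  replace (2 * ((ln (1 + x) - ln (1 - x) - ln (wp h s) + ln (wm h s)) / 2))
    with (ln (1 + x) + ln (wm h s) + - (ln (1 - x) + ln (wp h s))) by field.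
  rewrite exp_plus, exp_Ropp, !exp_plus, !exp_ln by lra. reflexivity.
Qed.

Lemma exp_pU_opp h s x : -1 < x < 1 -> 0 < wp h s -> 0 < wm h s ->
  exp (- 2 * pU h s x) = (1 - x) * wp h s / ((1 + x) * wm h s).
Proof.
  intros Hx Hp Hm. replace (- 2 * pU h s x) with (- (2 * pU h s x)) by ring.
  rewrite exp_Ropp, exp_pU by assumption. field. repeat split; lra.
Qed.

Lemma derive_wp h s : is_derive (fun s => wp h s) s (wm h s - wp h s).
Proof. unfold wp, wm. auto_derive; [exact I|]. field. Qed.

Lemma derive_wm h s : is_derive (fun s => wm h s) s (wp h s - wm h s).
Proof. unfold wp, wm. auto_derive; [exact I|]. field. Qed.

(** This contains the Hamilton-Jacobi equation: at fixed position the time derivative of [U] is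
    [- Ham x (pU h s x)], because [exp_pU] turns the logarithmic derivatives of the weights into the
    exponentials of the Hamiltonian. The total derivative p v - H is thus a lower bound for the
    Lagrangian. *)
Lemma derive_U_along h (xi : R -> R) s v : 0 < wp h s -> 0 < wm h s -> -1 < xi s < 1 ->
  derivable_pt_lim xi s v ->
  derivable_pt_lim (fun s => U h s (xi s)) s (pU h s (xi s) * v - Ham (xi s) (pU h s (xi s))).
Proof.
  intros Hp Hm Hx Hv. apply is_derive_Reals in Hv. apply is_derive_Reals.
  pose proof (derive_wp h s) as Dp. pose proof (derive_wm h s) as Dm.
  assert (E : is_derive (fun s => U h s (xi s)) s
    (v * pU h s (xi s) - (1 + xi s) / 2 * ((wm h s - wp h s) / wp h s) - (1 - xi s) / 2 * ((wp h s - wm h s) / wm h s))).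
  { unfold U, ent. auto_derive.
    - repeat split; try (eexists; eassumption); lra.
    - replace (Derive (fun x => xi x) s) with v by (symmetry; apply is_derive_unique, Hv).
      replace (Derive (fun x => wp h x) s) with (wm h s - wp h s) by (symmetry; apply is_derive_unique, Dp).
      replace (Derive (fun x => wm h x) s) with (wp h s - wm h s) by (symmetry; apply is_derive_unique, Dm).
      replace (1 + - xi s) with (1 - xi s) by ring. unfold pU. field. repeat split; lra. }
  evar_last; [exact E|]. unfold Ham.
  rewrite exp_pU, exp_pU_opp by assumption. field. repeat split; lra.
Qed.

Lemma Ham_segment l x p : Ham (l * x) p = l * Ham x p + (1 - l) * ((exp (2 * p) + exp (- 2 * p)) / 2 - 1).
Proof. unfold Ham. field. Qed.

Lemma cosh_ge_1 p : 1 <= (exp (2 * p) + exp (- 2 * p)) / 2.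
Proof.
  pose proof (exp_pos (2 * p)) as Hp. replace (- 2 * p) with (- (2 * p)) by ring. rewrite exp_Ropp.
  set (z := exp (2 * p)) in *. apply Rmult_le_reg_r with (2 * z); [lra|].
  replace ((z + / z) / 2 * (2 * z)) with (z * z + 1) by (field; lra).
  pose proof (Rle_0_sqr (z - 1)) as Hsq. unfold Rsqr in Hsq. lra.
Qed.

Lemma Ham_0 x : Ham x 0 = 0.
Proof. unfold Ham. rewrite !Rmult_0_r, exp_0. ring. Qed.

(* Shrinking a path towards 0 keeps it away from the singularities of [U] at the ends of [-1,1],
   and only helps because [H (., p)] is affine with [H (0, p) >= 0]. *)
Lemma Lag_gt_shrink l x v p y : 0 <= l <= 1 ->
  y < p * (l * v) - Ham (l * x) p -> Lag_gt x v y.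
Proof.
  intros Hl Hy. rewrite Ham_segment in Hy. pose proof (cosh_ge_1 p) as Hc.
  assert (0 <= (1 - l) * ((exp (2 * p) + exp (- 2 * p)) / 2 - 1)) by (apply Rmult_le_pos; lra).
  destruct (Rle_or_lt 0 (p * v - Ham x p)).
  - exists p. assert (l * (p * v - Ham x p) <= 1 * (p * v - Ham x p)) by (apply Rmult_le_compat_r; lra). lra.
  - exists 0. rewrite Ham_0. assert (l * (p * v - Ham x p) <= 0) by nra. lra.
Qed.

Lemma ln_bounds a b x : 0 < a -> a <= x <= b -> ln a <= ln x <= ln b.
Proof. intros Ha Hx. split; apply ln_le; lra. Qed.

Lemma ln_wp_bounds h s : 0 <= s -> - Rabs h <= ln (wp h s) <= Rabs h.
Proof.
  intros Hs. pose proof (ln_bounds _ _ _ (exp_pos _) (wp_bounds h s Hs)) as H. rewrite !ln_exp in H. exact H.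
Qed.

Lemma ln_wm_bounds h s : 0 <= s -> - Rabs h <= ln (wm h s) <= Rabs h.
Proof.
  intros Hs. pose proof (ln_bounds _ _ _ (exp_pos _) (wm_bounds h s Hs)) as H. rewrite !ln_exp in H. exact H.
Qed.

Lemma pU_bounded h l : 0 < l < 1 -> exists P, forall s x, 0 <= s -> - l <= x <= l -> Rabs (pU h s x) <= P.
Proof.
  intros Hl. exists (ln 2 - ln (1 - l) + Rabs h). intros s x Hs Hx.
  pose proof (ln_bounds (1 - l) 2 (1 + x)). pose proof (ln_bounds (1 - l) 2 (1 - x)).
  pose proof (ln_wp_bounds h s Hs). pose proof (ln_wm_bounds h s Hs).
  assert (ln (1 - l) <= ln 2) by (apply ln_le; lra).
  unfold pU. apply Rabs_le. lra.
Qed.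

Lemma Ham_bounded P x p : -1 <= x <= 1 -> Rabs p <= P -> Rabs (Ham x p) <= 2 * exp (2 * P) + 2.
Proof.
  intros Hx Hp. apply Rabs_le_between in Hp.
  assert (exp (2 * p) <= exp (2 * P)) by (apply exp_mono; lra).
  assert (exp (- 2 * p) <= exp (2 * P)) by (apply exp_mono; lra).
  pose proof (exp_pos (2 * p)). pose proof (exp_pos (- 2 * p)).
  unfold Ham. apply Rabs_le. split; nra.
Qed.

(** Mean value theorem along the straight space-time segment from (u, x) to (w, y); for positions in
    [-l,l] the momentum [pU], and with it the Hamiltonian, is bounded. *)
Lemma U_Lipschitz h l t : 0 < l < 1 -> 0 <= t -> exists K, 0 <= K /\
  forall u w x y, 0 <= u -> u < w -> w <= t -> - l <= x <= l -> - l <= y <= l ->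
    Rabs (U h w y - U h u x) <= K * ((w - u) + Rabs (y - x)).
Proof.
  intros Hl Ht. destruct (pU_bounded h l Hl) as [P HP].
  assert (HP0 : 0 <= P) by (pose proof (HP 0 0 ltac:(lra) ltac:(lra)); pose proof (Rabs_pos (pU h 0 0)); lra).
  exists (P + (2 * exp (2 * P) + 2)). pose proof (exp_pos (2 * P)). split; [lra|].
  intros u w x y Hu Huw Hw Hx Hy.
  set (xi := fun s => x + (y - x) * ((s - u) / (w - u))).
  assert (Hxi : forall s, u <= s <= w -> - l <= xi s <= l).
  { intros s Hs. unfold xi. set (r := (s - u) / (w - u)).
    assert (0 <= r <= 1).
    { unfold r. split; [apply Rmult_le_pos; [lra | left; apply Rinv_0_lt_compat; lra]|].
      apply Rmult_le_reg_r with (w - u); [lra|]. rewrite Rdiv_mult by lra. lra. }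
    nra. }
  assert (Hd : forall s, u <= s <= w -> derivable_pt_lim (fun s => U h s (xi s)) s
      (pU h s (xi s) * ((y - x) / (w - u)) - Ham (xi s) (pU h s (xi s)))).
  { intros s Hs. pose proof (Hxi s Hs). apply derive_U_along; [apply wp_pos; lra | apply wm_pos; lra | lra |].
    apply is_derive_Reals. unfold xi. auto_derive; [lra | field; lra]. }
  destruct (MVT_cor2 (fun s => U h s (xi s)) _ u w Huw (fun s Hs => Hd s Hs)) as (c & Hc1 & Hc2).
  replace (xi w) with y in Hc1 by (unfold xi; field; lra).
  replace (xi u) with x in Hc1 by (unfold xi; field; lra). rewrite Hc1.
  pose proof (Hxi c ltac:(lra)) as Hxc. pose proof (HP c (xi c) ltac:(lra) Hxc) as Hpc.
  pose proof (Ham_bounded P (xi c) (pU h c (xi c)) ltac:(lra) Hpc) as HH.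
  set (p := pU h c (xi c)) in *.
  replace ((p * ((y - x) / (w - u)) - Ham (xi c) p) * (w - u)) with (p * (y - x) + - (Ham (xi c) p * (w - u))) by (field; lra).
  eapply Rle_trans; [apply Rabs_triang|]. rewrite Rabs_Ropp, !Rabs_mult, (Rabs_right (w - u)) by lra.
  pose proof (Rabs_pos (y - x)).
  assert (Rabs p * Rabs (y - x) <= P * Rabs (y - x)) by (apply Rmult_le_compat_r; lra).
  assert (Rabs (Ham (xi c) p) * (w - u) <= (2 * exp (2 * P) + 2) * (w - u)) by (apply Rmult_le_compat_r; lra).
  nra.
Qed.

Lemma continuity_cst (c x : R) : continuity_pt (fun _ => c) x.
Proof. apply continuity_pt_const. intros y z; reflexivity. Qed.

Lemma continuity_pt_locally_gt (f : R -> R) x y : continuity_pt f x -> y < f x ->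
  exists d, 0 < d /\ forall z, Rabs (z - x) < d -> y < f z.
Proof.
  intros Hf H. destruct (Hf (f x - y)) as (d & Hd & H1); [lra|]. simpl in H1. unfold Rdist in H1.
  exists d. split; [exact Hd|]. intros z Hz. destruct (Req_dec z x) as [->|Hne]; [exact H|].
  assert (Rabs (f z - f x) < f x - y) by (apply H1; split; [split; [exact I | auto] | exact Hz]).
  apply Rabs_def2 in H0. lra.
Qed.

(** On the negative side [ln] is 0. To the right of 0, with r = sqrt z, |z ln z| = 2 r^2 ln (1 / r)
    <= 2 r. *)
Lemma continuity_xlnx y : continuity_pt (fun y => y * ln y) y.
Proof.
  destruct (Rtotal_order y 0) as [Hy|[->|Hy]].
  - apply continuity_pt_locally_ext with (f := fun _ => 0) (a := - y); [lra| |].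
    + intros z Hz. assert (z < 0) by (unfold Rdist in Hz; apply Rabs_def2 in Hz; lra).
      unfold ln. destruct (Rlt_dec 0 z); [exfalso; lra | cbv beta; rewrite Rmult_0_r; reflexivity].
    + apply continuity_cst.
  - intros e He. exists (Rmin 1 ((e / 2) * (e / 2))). split; [apply Rmin_pos; [lra | apply Rmult_lt_0_compat; lra]|]. intros z [_ Hz]. simpl in *.
    unfold Rdist in *. rewrite Rminus_0_r in Hz. rewrite Rmult_0_l, Rminus_0_r.
    unfold Rdist. destruct (Rle_or_lt z 0) as [H|H].
    { unfold ln. destruct (Rlt_dec 0 z); [exfalso; lra | rewrite Rmult_0_r, Rabs_R0; exact He]. }
    pose proof (Rmin_l 1 (e / 2 * (e / 2))). pose proof (Rmin_r 1 (e / 2 * (e / 2))).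
    rewrite Rabs_right in Hz by lra.
    pose proof (sqrt_lt_R0 z H) as Hr. pose proof (sqrt_sqrt z ltac:(lra)) as Hrr.
    set (r := sqrt z) in *. rewrite <- Hrr, ln_mult by lra.
    assert (Hr1 : r < e / 2) by (apply Rsqr_incrst_0; unfold Rsqr; lra).
    pose proof (exp_ineq1_le (ln (/ r))) as Hl.
    rewrite exp_ln in Hl by (apply Rinv_0_lt_compat; lra). rewrite ln_Rinv in Hl by lra.
    assert (Hr2 : r < 1) by (apply Rsqr_incrst_0; unfold Rsqr; lra).
    assert (ln r < 0) by (rewrite <- ln_1; apply ln_increasing; lra).
    rewrite Rabs_left1 by nra.
    apply (Rmult_le_compat_l (r * r)) in Hl; [|nra].
    replace (r * r * / r) with r in Hl by (field; lra). nra.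
  - apply derivable_continuous_pt. exists (ln y + 1). apply is_derive_Reals. auto_derive; [exact Hy | field; lra].
Qed.

Lemma continuity_ent x : continuity_pt ent x.
Proof.
  unfold ent.
  apply continuity_pt_ext with (f := fun x => 1 / 2 * (fun y => y * ln y) (1 - x) + 1 / 2 * (fun y => y * ln y) (1 + x)).
  { intros y. field. }
  apply continuity_pt_plus; apply continuity_pt_mult; try (apply continuity_cst).
  - refine (continuity_pt_comp (fun x => 1 - x) (fun y => y * ln y) x _ _); [reg | apply continuity_xlnx].
  - refine (continuity_pt_comp (fun x => 1 + x) (fun y => y * ln y) x _ _); [reg | apply continuity_xlnx].
Qed.

Lemma continuity_U h s x : continuity_pt (U h s) x.
Proof.
  unfold U. apply continuity_pt_minus; [apply continuity_pt_minus; [apply continuity_ent|]|]; reg.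
Qed.

(** Weak duality: every field h bounds the action of every path from below, through the increment of
    [U h] along the shrunken path l gamma. *)
Theorem action_lower_bound (h t a b c : R) (gamma : R -> R) : 0 < t ->
  admissible t a b gamma -> integral_0t (action_gt gamma t) t c -> U h t b - U h 0 a <= c.
Proof.
  intros Ht (Hrange & Ha & Hb & Hac) Hc.
  assert (Hl : forall l, 0 < l < 1 -> U h t (l * b) - U h 0 (l * a) <= c).
  { intros l Hl. destruct (U_Lipschitz h l t Hl) as (K & HK & HLip); [lra|].
    rewrite <- Ha, <- Hb.
    assert (Hlr : forall s, 0 <= s <= t -> - l <= l * gamma s <= l) by (intros s Hs; specialize (Hrange s Hs); nra).
    apply (derivative_le_integral gamma (fun s => U h s (l * gamma s)) (action_gt gamma t) t c K); auto.
    - intros u w Hu Huw Hw. destruct Huw as [Huw| ->].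
      + eapply Rle_trans; [apply HLip; try lra; apply Hlr; lra|]. apply Rmult_le_compat_l; [exact HK|].
        apply Rplus_le_compat_l. rewrite <- Rmult_minus_distr_l, Rabs_mult, (Rabs_right l) by lra.
        pose proof (Rabs_pos (gamma w - gamma u)). nra.
      + rewrite !Rminus_diag, Rabs_R0. lra.
    - intros s v Hs Hv.
      exists (pU h s (l * gamma s) * (l * v) - Ham (l * gamma s) (pU h s (l * gamma s))). split.
      + apply (derive_U_along h (fun s => l * gamma s)).
        * apply wp_pos; lra.
        * apply wm_pos; lra.
        * assert (- l <= l * gamma s <= l) by (apply Hlr; lra). lra.
        * apply derivable_pt_lim_scal, Hv.
      + intros y Hy. split; [exact Hs|]. exists v. split; [exact Hv|].
        apply (Lag_gt_shrink l (gamma s) v (pU h s (l * gamma s)) y); [lra | exact Hy]. }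
  (* Passage to l = 1, by continuity of [U] up to the end points of [-1,1]. *)
  apply Rnot_lt_le. intros Hlt.
  destruct (continuity_pt_locally_gt (fun l => U h t (l * b) - U h 0 (l * a)) 1 c) as (d & Hd & H).
  - apply continuity_pt_minus;
      [refine (continuity_pt_comp (fun l => l * b) (U h t) 1 _ _) | refine (continuity_pt_comp (fun l => l * a) (U h 0) 1 _ _)];
      solve [reg | apply continuity_U].
  - rewrite !Rmult_1_l. exact Hlt.
  - pose proof (Rmin_l (1 / 2) (d / 2)). pose proof (Rmin_r (1 / 2) (d / 2)).
    assert (0 < Rmin (1 / 2) (d / 2)) by (apply Rmin_pos; lra).
    set (l := 1 - Rmin (1 / 2) (d / 2)). specialize (Hl l ltac:(unfold l; lra)).
    specialize (H l ltac:(unfold l; apply Rabs_def1; lra)). cbv beta in H. lra.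
Qed.

(** * Characteristics *)

(* [Gam h x] is the characteristic of [U h] issued from [x], and [dGam] its velocity. *)
Definition Psi (h x : R) : R := x * cosh (2 * h) - sinh (2 * h).
Definition Gam (h x s : R) : R := x * cosh (2 * s) + sinh (2 * s) * Psi h x.
Definition dGam (h x s : R) : R := 2 * x * sinh (2 * s) + 2 * cosh (2 * s) * Psi h x.

Lemma cosh_exp y : cosh y = (exp y + / exp y) / 2.
Proof. unfold cosh. rewrite exp_Ropp. reflexivity. Qed.

Lemma sinh_exp y : sinh y = (exp y - / exp y) / 2.
Proof. unfold sinh. rewrite exp_Ropp. reflexivity. Qed.

Lemma exp_double y : exp (2 * y) = exp y * exp y.
Proof. rewrite <- exp_plus. f_equal. ring. Qed.

Lemma derive_Gam h x s : derivable_pt_lim (Gam h x) s (dGam h x s).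
Proof.
  apply is_derive_Reals. unfold Gam, dGam, cosh, sinh. auto_derive; [exact I|]. field.
Qed.

(** By [exp_pU], the right-hand side is the p-derivative of [Ham] at the momentum [pU]. The explicit
    solution is that of the linear equation X'' = 4 X with initial velocity [2 * Psi h x]. *)
Lemma dGam_ode h x s : 0 < wp h s -> 0 < wm h s ->
  dGam h x s = (1 + Gam h x s) * wm h s / wp h s - (1 - Gam h x s) * wp h s / wm h s.
Proof.
  intros Hp Hm. unfold dGam, Gam, Psi in *. rewrite !cosh_exp, !sinh_exp.
  rewrite (exp_double h). unfold wp, wm in *. replace (- 2 * s) with (- (2 * s)) in * by ring.
  rewrite !(exp_Ropp) in *. pose proof (exp_pos (2 * s)). pose proof (exp_pos h).
  set (a := exp (2 * s)) in *. set (H1 := exp h) in *.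
  assert (E1 : (H1 * (1 + / a) + / H1 * (1 - / a)) / 2 = (H1 * H1 * (a + 1) + (a - 1)) / (2 * a * H1)) by (field; lra).
  assert (E2 : (H1 * (1 - / a) + / H1 * (1 + / a)) / 2 = (H1 * H1 * (a - 1) + (a + 1)) / (2 * a * H1)) by (field; lra).
  rewrite E1, E2 in *.
  assert (Hpos : 0 < 2 * a * H1) by (apply Rmult_lt_0_compat; lra).
  assert (N1 : 0 < H1 * H1 * (a + 1) + (a - 1)).
  { replace (H1 * H1 * (a + 1) + (a - 1)) with ((H1 * H1 * (a + 1) + (a - 1)) / (2 * a * H1) * (2 * a * H1)) by (field; lra).
    apply Rmult_lt_0_compat; assumption. }
  assert (N2 : 0 < H1 * H1 * (a - 1) + (a + 1)).
  { replace (H1 * H1 * (a - 1) + (a + 1)) with ((H1 * H1 * (a - 1) + (a + 1)) / (2 * a * H1) * (2 * a * H1)) by (field; lra).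
    apply Rmult_lt_0_compat; assumption. }
  field. repeat split; lra.
Qed.

Lemma Gam_0 h x : Gam h x 0 = x.
Proof. unfold Gam. rewrite Rmult_0_r, cosh_0, sinh_0. ring. Qed.

Lemma cosh_pos y : 0 < cosh y.
Proof. unfold cosh. pose proof (exp_pos y). pose proof (exp_pos (- y)). lra. Qed.

Lemma cosh2_sinh2 y : cosh y * cosh y - sinh y * sinh y = 1.
Proof. rewrite cosh_exp, sinh_exp. field. pose proof (exp_pos y); lra. Qed.

Lemma cosh_double y : cosh (2 * y) = cosh y * cosh y + sinh y * sinh y.
Proof. rewrite !cosh_exp, sinh_exp, exp_double. field. pose proof (exp_pos y); lra. Qed.

Lemma sinh_double y : sinh (2 * y) = 2 * sinh y * cosh y.
Proof. rewrite !sinh_exp, cosh_exp, exp_double. field. pose proof (exp_pos y); lra. Qed.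

Lemma sinh_incr x y : x < y -> sinh x < sinh y.
Proof. intros H. unfold sinh. pose proof (exp_increasing x y H). pose proof (exp_increasing (- y) (- x)). lra. Qed.

Lemma sinh_pos y : 0 < y -> 0 < sinh y.
Proof. intros H. rewrite <- sinh_0. apply sinh_incr, H. Qed.

Lemma tanh_incr x y : x < y -> tanh x < tanh y.
Proof.
  intros H. unfold tanh. apply Rmult_lt_reg_r with (cosh x * cosh y); [apply Rmult_lt_0_compat; apply cosh_pos|].
  pose proof (cosh_pos x). pose proof (cosh_pos y).
  replace (sinh x / cosh x * (cosh x * cosh y)) with (sinh x * cosh y) by (field; lra).
  replace (sinh y / cosh y * (cosh x * cosh y)) with (sinh y * cosh x) by (field; lra).
  assert (E : sinh y * cosh x - sinh x * cosh y = sinh (y - x)).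
  { unfold sinh, cosh. replace (- (y - x)) with (- y + x) by ring. unfold Rminus.
    rewrite !exp_plus, !exp_Ropp. pose proof (exp_pos x). pose proof (exp_pos y). field. lra. }
  assert (0 < sinh (y - x)) by (apply sinh_pos; lra). lra.
Qed.

Lemma tanh_mono x y : x <= y -> tanh x <= tanh y.
Proof. intros [H| ->]; [left; apply tanh_incr, H | right; reflexivity]. Qed.

Lemma tanh_bound y : -1 < tanh y < 1.
Proof.
  unfold tanh. pose proof (cosh_pos y). pose proof (exp_pos y). pose proof (exp_pos (- y)).
  split; apply Rmult_lt_reg_r with (cosh y); auto;
    rewrite Rdiv_mult by lra; unfold sinh, cosh; lra.
Qed.

Lemma one_plus_Gam h x s :
  1 + Gam h x s = cosh s * cosh s * ((1 + x) + 2 * Psi h x * tanh s - (1 - x) * (tanh s * tanh s)).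
Proof.
  unfold Gam, tanh. rewrite cosh_double, sinh_double. pose proof (cosh_pos s).
  transitivity ((cosh s * cosh s - sinh s * sinh s) +
    (x * (cosh s * cosh s + sinh s * sinh s) + 2 * sinh s * cosh s * Psi h x)).
  - rewrite cosh2_sinh2. reflexivity.
  - field. lra.
Qed.

Lemma Gam_opp h x s : Gam (- h) (- x) s = - Gam h x s.
Proof.
  unfold Gam, Psi. replace (2 * - h) with (- (2 * h)) by ring.
  unfold cosh, sinh. rewrite !Ropp_involutive. field.
Qed.

Lemma concave_quadratic_pos A B C u w : 0 <= C -> 0 < A -> 0 <= u < w ->
  0 <= A + B * w - C * (w * w) -> 0 < A + B * u - C * (u * u).
Proof.
  intros HC HA Hu H. apply Rmult_lt_reg_r with w; [lra|]. rewrite Rmult_0_l.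
  replace ((A + B * u - C * (u * u)) * w) with
    (A * (w - u) + u * (A + B * w - C * (w * w)) + C * (u * (w * (w - u)))) by ring.
  assert (0 < A * (w - u)) by (apply Rmult_lt_0_compat; lra).
  assert (0 <= u * (A + B * w - C * (w * w))) by (apply Rmult_le_pos; lra).
  assert (0 <= C * (u * (w * (w - u)))) by (repeat apply Rmult_le_pos; lra). lra.
Qed.

(* In the variable [tanh s], [1 + Gam] is a positive multiple of a concave quadratic polynomial. *)
Lemma Gam_gt_earlier h x s t : -1 < x <= 1 -> 0 <= s < t -> -1 <= Gam h x t -> -1 < Gam h x s.
Proof.
  intros Hx Hs Ht. assert (H : 0 <= 1 + Gam h x t) by lra. rewrite one_plus_Gam in H.
  assert (G : 0 < 1 + Gam h x s); [|lra]. rewrite one_plus_Gam.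
  assert (P : forall y, 0 < cosh y * cosh y) by (intros y; apply Rmult_lt_0_compat; apply cosh_pos).
  apply Rmult_lt_0_compat; [apply P|].
  apply concave_quadratic_pos with (tanh t); try lra.
  - split; [|apply tanh_incr; lra]. replace 0 with (tanh 0); [apply tanh_mono; lra|].
    unfold tanh. rewrite sinh_0. unfold Rdiv. ring.
  - apply Rmult_le_reg_l with (cosh t * cosh t); [apply P | lra].
Qed.

Lemma Gam_lt_earlier h x s t : -1 <= x < 1 -> 0 <= s < t -> Gam h x t <= 1 -> Gam h x s < 1.
Proof.
  intros Hx Hs Ht. assert (-1 < Gam (- h) (- x) s); [|rewrite Gam_opp in *; lra].
  apply Gam_gt_earlier with t; try lra. rewrite Gam_opp. lra.
Qed.

Lemma Lipschitz_abs_cont (g : R -> R) (t K : R) : 0 <= K ->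
  (forall u w, 0 <= u -> u <= w -> w <= t -> Rabs (g w - g u) <= K * (w - u)) -> abs_cont_on g t.
Proof.
  intros HK H e He. exists (e / (K + 1)). split; [apply Rdiv_lt_0_compat; lra|].
  intros n a b Hab _ Hsum.
  apply Rle_lt_trans with (K * sumN (fun i => b i - a i) n).
  - rewrite <- sumN_scal. apply sumN_le. intros i Hi. destruct (Hab i Hi) as (H1 & H2 & H3). apply H; assumption.
  - destruct HK as [HK|<-]; [|lra].
    apply Rlt_le_trans with (K * (e / (K + 1))); [apply Rmult_lt_compat_l; assumption|].
    apply Rmult_le_reg_r with (K + 1); [lra|]. replace (K * (e / (K + 1)) * (K + 1)) with (K * e) by (field; lra). nra.
Qed.

Lemma Gam_abs_cont h x t : 0 <= t -> abs_cont_on (Gam h x) t.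
Proof.
  intros Ht. set (K := 2 * Rabs x * exp (2 * t) + 2 * exp (2 * t) * Rabs (Psi h x)).
  pose proof (exp_pos (2 * t)). pose proof (Rabs_pos x). pose proof (Rabs_pos (Psi h x)).
  apply Lipschitz_abs_cont with K; [unfold K; nra|].
  intros u w Hu [Huw| ->] Hw; [|rewrite !Rminus_diag, Rabs_R0; lra].
  destruct (MVT_cor2 (Gam h x) (dGam h x) u w Huw (fun s _ => derive_Gam h x s)) as (c & Hc1 & Hc2).
  rewrite Hc1, Rabs_mult, (Rabs_right (w - u)) by lra. apply Rmult_le_compat_r; [lra|].
  unfold dGam, K. eapply Rle_trans; [apply Rabs_triang|].
  assert (A1 : exp (2 * c) <= exp (2 * t)) by (apply exp_mono; lra).
  assert (A2 : exp (- (2 * c)) <= exp (2 * t)) by (apply exp_mono; lra).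
  pose proof (exp_pos (2 * c)). pose proof (exp_pos (- (2 * c))).
  assert (B1 : Rabs (sinh (2 * c)) <= exp (2 * t)) by (unfold sinh; apply Rabs_le; lra).
  assert (B2 : Rabs (cosh (2 * c)) <= exp (2 * t)) by (unfold cosh; apply Rabs_le; lra).
  rewrite !Rabs_mult, (Rabs_right 2) by lra.
  pose proof (Rabs_pos (sinh (2 * c))). pose proof (Rabs_pos (cosh (2 * c))). nra.
Qed.

(** [Gam] is affine in x with slope D, which makes the start explicit; it is interior because |sinh
    2h| < cosh 2h and cosh 2t > 1. *)
Lemma start_point h t b : 0 < t -> -1 <= b <= 1 -> exists x, -1 < x < 1 /\ Gam h x t = b.
Proof.
  intros Ht Hb.
  assert (Hs : 0 < sinh (2 * t)) by (apply sinh_pos; lra).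
  assert (Hc : 1 < cosh (2 * t)).
  { pose proof (cosh2_sinh2 (2 * t)). pose proof (cosh_pos (2 * t)). nra. }
  pose proof (cosh_pos (2 * h)) as Hh.
  assert (Hd : - cosh (2 * h) < sinh (2 * h) < cosh (2 * h)).
  { unfold cosh, sinh. pose proof (exp_pos (2 * h)). pose proof (exp_pos (- (2 * h))). lra. }
  set (D := cosh (2 * t) + sinh (2 * t) * cosh (2 * h)).
  assert (HD : 0 < D) by (unfold D; nra).
  exists ((b + sinh (2 * t) * sinh (2 * h)) / D). split.
  - split; apply Rmult_lt_reg_r with D; auto; rewrite Rdiv_mult by lra; unfold D; nra.
  - unfold Gam, Psi. unfold D in *. field. lra.
Qed.

(* The momentum [p = pU] is optimal for the velocity [dGam], by convexity of the Hamiltonian. *)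
Lemma Legendre_optimal h x s q : 0 < wp h s -> 0 < wm h s -> -1 < Gam h x s < 1 ->
  let G := Gam h x s in let p := pU h s G in
  q * dGam h x s - Ham G q <= p * dGam h x s - Ham G p.
Proof.
  intros Hp Hm HG G p. unfold Ham.
  pose proof (exp_pU h s G HG Hp Hm) as E1. pose proof (exp_pU_opp h s G HG Hp Hm) as E2. fold p in E1, E2.
  rewrite dGam_ode by assumption. fold G.
  assert (D1 : (1 + G) * wm h s / wp h s = (1 - G) * exp (2 * p)) by (rewrite E1; field; unfold G; lra).
  assert (D2 : (1 - G) * wp h s / wm h s = (1 + G) * exp (- 2 * p)) by (rewrite E2; field; unfold G; lra).
  rewrite D1, D2.
  pose proof (exp_ineq1_le (2 * (q - p))) as I1. pose proof (exp_ineq1_le (- 2 * (q - p))) as I2.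
  replace (2 * q) with (2 * p + 2 * (q - p)) by ring. replace (- 2 * q) with (- 2 * p + - 2 * (q - p)) by ring.
  rewrite !exp_plus. pose proof (exp_pos (2 * p)). pose proof (exp_pos (- 2 * p)).
  assert (J1 : (1 - G) * exp (2 * p) * (1 + 2 * (q - p)) <= (1 - G) * exp (2 * p) * exp (2 * (q - p))).
  { apply Rmult_le_compat_l; [|exact I1]. apply Rmult_le_pos; unfold G; lra. }
  assert (J2 : (1 + G) * exp (- 2 * p) * (1 + - 2 * (q - p)) <= (1 + G) * exp (- 2 * p) * exp (- 2 * (q - p))).
  { apply Rmult_le_compat_l; [|exact I2]. apply Rmult_le_pos; unfold G; lra. }
  lra.
Qed.

Lemma continuity_pt_of_ex_derive (f : R -> R) x : ex_derive f x -> continuity_pt f x.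
Proof. intros H. apply continuity_pt_filterlim, (ex_derive_continuous f x H). Qed.

(** Equality case of the duality: along the characteristic of h ending at b, the supremum defining
    the Lagrangian is attained at [pU], so the derivative of [U] bounds the action density. The
    curve is interior before t and may touch -1 or 1 at time t itself. *)
Theorem action_upper_bound (h t b : R) : 0 < t -> -1 <= b <= 1 ->
  exists x gamma c, -1 < x < 1 /\ admissible t x b gamma /\
    integral_0t (action_gt gamma t) t c /\ c <= U h t b - U h 0 x.
Proof.
  intros Ht Hb. destruct (start_point h t b Ht Hb) as (x & Hx & Hend).
  assert (Hin : forall s, 0 <= s < t -> -1 < Gam h x s < 1).
  { intros s Hs. split.
    - apply Gam_gt_earlier with t; lra.
    - apply Gam_lt_earlier with t; lra. }
  set (f := fun s => U h s (Gam h x s)).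
  set (g := fun s => pU h s (Gam h x s) * dGam h x s - Ham (Gam h x s) (pU h s (Gam h x s))).
  destruct (integral_le_primitive (action_gt (Gam h x) t) f g t Ht) as (c & Hc & Hle).
  - intros s Hs. pose proof (Hin s Hs) as HG.
    pose proof (wp_pos h s (proj1 Hs)) as Hp. pose proof (wm_pos h s (proj1 Hs)) as Hm.
    repeat split.
    + apply derive_U_along; auto. apply derive_Gam.
    + apply continuity_pt_of_ex_derive. unfold g, pU, Ham.
      assert (ex_derive (fun s => Gam h x s) s) by (eexists; apply is_derive_Reals, derive_Gam).
      assert (ex_derive (fun s => wp h s) s) by (eexists; apply derive_wp).
      assert (ex_derive (fun s => wm h s) s) by (eexists; apply derive_wm).
      assert (ex_derive (fun s => dGam h x s) s) by (unfold dGam, cosh, sinh; auto_derive; exact I).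
      auto_derive. repeat split; auto; lra.
    + unfold g. pose proof (Legendre_optimal h x s 0 Hp Hm HG) as HL. cbv zeta in HL.
      rewrite Ham_0 in HL. lra.
  - unfold f, U. pose proof (wp_pos h t ltac:(lra)). pose proof (wm_pos h t ltac:(lra)).
    assert (CG : continuity_pt (Gam h x) t) by (apply derivable_continuous_pt; exists (dGam h x t); apply derive_Gam).
    assert (Cp : continuity_pt (fun s => ln (wp h s)) t).
    { apply continuity_pt_of_ex_derive. unfold wp in *. auto_derive. unfold wp in *; lra. }
    assert (Cm : continuity_pt (fun s => ln (wm h s)) t).
    { apply continuity_pt_of_ex_derive. unfold wm in *. auto_derive. unfold wm in *; lra. }
    assert (Ce : continuity_pt (fun s => ent (Gam h x s)) t).
    { refine (continuity_pt_comp (Gam h x) ent t CG _). apply continuity_ent. }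
    assert (C1 : continuity_pt (fun s => (1 + Gam h x s) / 2) t) by (unfold Rdiv; reg; exact CG).
    assert (C2 : continuity_pt (fun s => (1 - Gam h x s) / 2) t) by (unfold Rdiv; reg; exact CG).
    apply continuity_pt_minus; [apply continuity_pt_minus; [exact Ce|]|]; apply continuity_pt_mult; assumption.
  - intros y s (Hs & v & Hv & q & Hq). split; [exact Hs|].
    rewrite (uniqueness_limite _ _ _ _ Hv (derive_Gam h x s)) in Hq.
    assert (Hs' : 0 <= s < t) by lra.
    pose proof (Legendre_optimal h x s q (wp_pos h s (proj1 Hs')) (wm_pos h s (proj1 Hs')) (Hin s Hs')) as HL.
    cbv zeta in HL. unfold g. lra.
  - exists x, (Gam h x), c. repeat split; auto; try lra.
    + destruct (Req_dec s t) as [->|]; [lra|]. assert (-1 < Gam h x s < 1) by (apply Hin; lra). lra.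
    + destruct (Req_dec s t) as [->|]; [lra|]. assert (-1 < Gam h x s < 1) by (apply Hin; lra). lra.
    + apply Gam_0.
    + apply Gam_abs_cont. lra.
    + exact (proj1 Hc).
    + exact (proj2 Hc).
    + unfold f in Hle. rewrite Hend, Gam_0 in Hle. exact Hle.
Qed.

(** * The minimisation problem over the initial magnetisation *)

(* [Xt alpha theta t m] is the position at time [t] of the Hamilton flow issued from (m, I_0'(m)). *)
Definition Phi (alpha theta t m b : R) : R := alpha * (m * m) / 2 + U (alpha * m + theta) t b.
Definition Xt (alpha theta t m : R) : R := Gam (alpha * m + theta) m t.
(** The field at time t of the product measure started with field h: [pU h t b] is atanh b minus
    this quantity. *)
Definition field_B (h t : R) : R := (ln (wp h t) - ln (wm h t)) / 2.

Lemma U_at_0 h x : U h 0 x = ent x - h * x.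
Proof.
  unfold U. replace (wp h 0) with (exp h) by (unfold wp; rewrite Rmult_0_r, exp_0; field).
  replace (wm h 0) with (exp (- h)) by (unfold wm; rewrite Rmult_0_r, exp_0; field).
  rewrite !ln_exp. field.
Qed.

Lemma I0_ent alpha theta x : I0 alpha theta x = ent x - alpha * (x * x) / 2 - theta * x + Cst alpha theta.
Proof. unfold I0, J0, ent. field. Qed.

(** For a path from x, the lower bound uses the field alpha x + theta, whose product rate function
    is tangent to I_0 at x. For the upper bound, the characteristic of the minimiser m may start at
    some x other than m; the discrepancy alpha (x - m)^2 / 2 has the favourable sign. *)
Lemma It_of_minimizer alpha theta t b m : 0 <= alpha -> 0 < t -> -1 <= b <= 1 ->
  -1 <= m <= 1 -> (forall m', -1 <= m' <= 1 -> Phi alpha theta t m b <= Phi alpha theta t m' b) ->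
  It alpha theta t b = Cst alpha theta + Phi alpha theta t m b.
Proof.
  intros Ha Ht Hb Hm Hmin. unfold It. destruct (Rlt_dec 0 t); [|contradiction].
  apply glb_eq. split.
  - intros v (x & gamma & c & Hx & Hadm & Hint & ->).
    pose proof (action_lower_bound (alpha * x + theta) t x b c gamma Ht Hadm Hint) as Hlow.
    rewrite U_at_0 in Hlow. rewrite I0_ent. specialize (Hmin x Hx). unfold Phi in Hmin at 2. lra.
  - intros m' Hm'.
    destruct (action_upper_bound (alpha * m + theta) t b Ht Hb) as (x & gamma & c & Hx & Hadm & Hint & Hc).
    eapply Rle_trans; [apply Hm'|].
    { exists x, gamma, c. split; [lra|]. split; [exact Hadm|]. split; [exact Hint | reflexivity]. }
    rewrite I0_ent. rewrite U_at_0 in Hc. unfold Phi.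
    pose proof (Rle_0_sqr (x - m)) as Hsq. unfold Rsqr in Hsq.
    assert (0 <= alpha * ((x - m) * (x - m))) by (apply Rmult_le_pos; lra). lra.
Qed.

Lemma derive_Phi alpha theta t b m : 0 < t ->
  derivable_pt_lim (fun m => Phi alpha theta t m b) m
    (alpha * exp (- 2 * t) * (Xt alpha theta t m - b) / (wp (alpha * m + theta) t * wm (alpha * m + theta) t)).
Proof.
  intros Ht. set (h := alpha * m + theta).
  pose proof (wp_pos h t ltac:(lra)) as Hp. pose proof (wm_pos h t ltac:(lra)) as Hm.
  assert (Dp : is_derive (fun h => wp h t) h ((exp h * (1 + exp (- 2 * t)) - exp (- h) * (1 - exp (- 2 * t))) / 2)).
  { unfold wp. auto_derive; [exact I|]. field. }
  assert (Dm : is_derive (fun h => wm h t) h ((exp h * (1 - exp (- 2 * t)) - exp (- h) * (1 + exp (- 2 * t))) / 2)).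
  { unfold wm. auto_derive; [exact I|]. field. }
  set (dp := (exp h * (1 + exp (- 2 * t)) - exp (- h) * (1 - exp (- 2 * t))) / 2) in *.
  set (dm := (exp h * (1 - exp (- 2 * t)) - exp (- h) * (1 + exp (- 2 * t))) / 2) in *.
  assert (E : is_derive (fun m => Phi alpha theta t m b) m
    (alpha * m - (1 + b) / 2 * (alpha * dp / wp h t) - (1 - b) / 2 * (alpha * dm / wm h t))).
  { unfold Phi, U. auto_derive.
    - fold h. repeat split; try (eexists; eassumption); assumption.
    - fold h. replace (Derive (fun x => wp x t) h) with dp by (symmetry; apply is_derive_unique, Dp).
      replace (Derive (fun x => wm x t) h) with dm by (symmetry; apply is_derive_unique, Dm).
      field. lra. }
  apply is_derive_Reals. evar_last; [exact E|].
  apply Rmult_eq_reg_r with (wp h t * wm h t); [|apply Rgt_not_eq, Rmult_lt_0_compat; assumption].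
  transitivity (alpha * (m * (wp h t * wm h t) - (1 + b) / 2 * (dp * wm h t) - (1 - b) / 2 * (dm * wp h t)));
    [field; lra|].
  transitivity (alpha * exp (- 2 * t) * (Xt alpha theta t m - b)); [|field; lra].
  unfold Xt, Gam, Psi, dp, dm, wp, wm. fold h. rewrite !cosh_exp, !sinh_exp, (exp_double h), !exp_Ropp.
  replace (- 2 * t) with (- (2 * t)) by ring. rewrite exp_Ropp.
  pose proof (exp_pos h). pose proof (exp_pos (2 * t)). field. lra.
Qed.

Lemma Phi_increment alpha theta t b m m' : 0 < t -> m < m' ->
  exists c q, m < c < m' /\ 0 < q /\
    Phi alpha theta t m' b - Phi alpha theta t m b = alpha * q * (Xt alpha theta t c - b).
Proof.
  intros Ht Hm.
  destruct (MVT_cor2 (fun m => Phi alpha theta t m b) _ m m' Hm (fun c _ => derive_Phi alpha theta t b c Ht)) as (c & Hc1 & Hc2).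
  pose proof (wp_pos (alpha * c + theta) t ltac:(lra)) as Hp. pose proof (wm_pos (alpha * c + theta) t ltac:(lra)) as Hw.
  exists c, (exp (- 2 * t) / (wp (alpha * c + theta) t * wm (alpha * c + theta) t) * (m' - m)). split; [lra|]. split.
  - apply Rmult_lt_0_compat; [|lra]. apply Rdiv_lt_0_compat; [apply exp_pos | apply Rmult_lt_0_compat; assumption].
  - rewrite Hc1. field. lra.
Qed.

Lemma Phi_min_exists alpha theta t b : 0 < t ->
  exists m, -1 <= m <= 1 /\ forall m', -1 <= m' <= 1 -> Phi alpha theta t m b <= Phi alpha theta t m' b.
Proof.
  intros Ht. destruct (continuity_ab_min (fun m => Phi alpha theta t m b) (-1) 1) as (m & H1 & H2); [lra| |].
  - intros c _. apply derivable_continuous_pt. eexists. apply derive_Phi, Ht.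
  - exists m. auto.
Qed.

Lemma Phi_diff_b alpha theta t m b b' :
  Phi alpha theta t m b' - Phi alpha theta t m b = ent b' - ent b - (b' - b) * field_B (alpha * m + theta) t.
Proof. unfold Phi, U, field_B. field. Qed.

Lemma field_B_bound h t : 0 <= t -> Rabs (field_B h t) <= Rabs h.
Proof.
  intros Ht. pose proof (ln_wp_bounds h t Ht). pose proof (ln_wm_bounds h t Ht).
  unfold field_B. apply Rabs_le. lra.
Qed.

Lemma field_B_incr h h' t : 0 < t -> h < h' -> field_B h t < field_B h' t.
Proof.
  intros Ht Hh. unfold field_B.
  pose proof (wp_pos h t ltac:(lra)). pose proof (wm_pos h t ltac:(lra)).
  pose proof (wp_pos h' t ltac:(lra)). pose proof (wm_pos h' t ltac:(lra)).
  assert (L : ln (wp h t * wm h' t) < ln (wp h' t * wm h t)); [|rewrite !ln_mult in L by assumption; lra].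
  apply ln_increasing; [apply Rmult_lt_0_compat; assumption|].
  assert (E : wp h' t * wm h t - wp h t * wm h' t = 2 * exp (- 2 * t) * sinh (h' - h)).
  { unfold wp, wm, sinh. replace (- (h' - h)) with (h + - h') by ring. unfold Rminus. rewrite !exp_plus. field. }
  assert (0 < 2 * exp (- 2 * t) * sinh (h' - h)); [|lra].
  apply Rmult_lt_0_compat; [pose proof (exp_pos (- 2 * t)); lra | apply sinh_pos; lra].
Qed.

(** The minimiser m for b remains a competitor for b', so its product rate function touches I_t from
    above at b. *)
Lemma It_upper_tangent alpha theta t m b b' : 0 <= alpha -> 0 < t ->
  -1 <= b <= 1 -> -1 <= b' <= 1 -> -1 <= m <= 1 ->
  (forall m', -1 <= m' <= 1 -> Phi alpha theta t m b <= Phi alpha theta t m' b) ->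
  It alpha theta t b' - It alpha theta t b <= ent b' - ent b - (b' - b) * field_B (alpha * m + theta) t.
Proof.
  intros Ha Ht Hb Hb' Hm Hmin. rewrite (It_of_minimizer alpha theta t b m) by assumption.
  destruct (Phi_min_exists alpha theta t b' Ht) as (m1 & Hm1 & Hmin1).
  rewrite (It_of_minimizer alpha theta t b' m1) by assumption.
  rewrite <- Phi_diff_b. specialize (Hmin1 m Hm). lra.
Qed.

Lemma field_B_bound_uniform alpha theta t m : 0 <= alpha -> 0 <= t -> -1 <= m <= 1 ->
  Rabs (field_B (alpha * m + theta) t) <= alpha + Rabs theta.
Proof.
  intros Ha Ht Hm. eapply Rle_trans; [apply field_B_bound, Ht|].
  eapply Rle_trans; [apply Rabs_triang|]. rewrite Rabs_mult, (Rabs_right alpha) by lra.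
  assert (Rabs m <= 1) by (apply Rabs_le; lra). pose proof (Rabs_pos m). nra.
Qed.

(** The tangents at b and at b' show that I_t - ent is Lipschitz up to the end points; continuity of
    I_t on [-1,1] is thus inherited from [ent], in spite of the infinite boundary slopes. *)
Lemma It_near_ent alpha theta t b b' : 0 <= alpha -> 0 < t -> -1 <= b <= 1 -> -1 <= b' <= 1 ->
  Rabs ((It alpha theta t b' - It alpha theta t b) - (ent b' - ent b)) <= (alpha + Rabs theta) * Rabs (b' - b).
Proof.
  intros Ha Ht Hb Hb'.
  assert (H : forall b b', -1 <= b <= 1 -> -1 <= b' <= 1 ->
    (It alpha theta t b' - It alpha theta t b) - (ent b' - ent b) <= (alpha + Rabs theta) * Rabs (b' - b)).
  { clear b b' Hb Hb'. intros b b' Hb Hb'.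
    destruct (Phi_min_exists alpha theta t b Ht) as (m & Hm & Hmin).
    pose proof (It_upper_tangent alpha theta t m b b' Ha Ht Hb Hb' Hm Hmin).
    pose proof (field_B_bound_uniform alpha theta t m Ha ltac:(lra) Hm) as HB.
    assert (Rabs ((b' - b) * field_B (alpha * m + theta) t) <= (alpha + Rabs theta) * Rabs (b' - b)).
    { rewrite Rabs_mult. rewrite Rmult_comm. apply Rmult_le_compat_r; [apply Rabs_pos | exact HB]. }
    pose proof (Rle_abs (- ((b' - b) * field_B (alpha * m + theta) t))) as HR. rewrite Rabs_Ropp in HR. lra. }
  apply Rabs_le. split.
  - pose proof (H b' b Hb' Hb) as H1. rewrite Rabs_minus_sym in H1. lra.
  - apply H; assumption.
Qed.

(** * A criterion for membership in the class C^{1,partial} *)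

Definition cont_on_K (g : R -> R) : Prop :=
  forall x, -1 <= x <= 1 -> forall eps, 0 < eps -> exists delta, 0 < delta /\
     forall y, -1 <= y <= 1 -> Rabs (y - x) < delta -> Rabs (g y - g x) < eps.

Lemma ent_cont_on_K : cont_on_K ent.
Proof.
  intros x Hx e He. destruct (continuity_ent x e He) as (d & Hd & H). simpl in H. unfold Rdist in H.
  exists d. split; [exact Hd|]. intros y _ Hy. destruct (Req_dec y x) as [->|Hne].
  - rewrite Rminus_diag, Rabs_R0. exact He.
  - apply H. split; [split; [exact I | auto] | exact Hy].
Qed.

Lemma cont_on_K_of_Lipschitz_diff (f g : R -> R) K : 0 <= K -> cont_on_K f ->
  (forall b b', -1 <= b <= 1 -> -1 <= b' <= 1 -> Rabs ((g b' - g b) - (f b' - f b)) <= K * Rabs (b' - b)) ->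
  cont_on_K g.
Proof.
  intros HK Hf H x Hx e He. destruct (Hf x Hx (e / 2)) as (d & Hd & H1); [lra|].
  exists (Rmin d (e / (2 * (K + 1)))). split; [apply Rmin_pos; [exact Hd | apply Rdiv_lt_0_compat; lra]|].
  intros y Hy Hyx. pose proof (Rmin_l d (e / (2 * (K + 1)))). pose proof (Rmin_r d (e / (2 * (K + 1)))).
  specialize (H x y Hx Hy). specialize (H1 y Hy ltac:(lra)).
  assert (K * Rabs (y - x) <= e / 2).
  { apply Rle_trans with ((K + 1) * (e / (2 * (K + 1)))).
    - pose proof (Rabs_pos (y - x)). apply Rmult_le_compat; lra.
    - right. field. lra. }
  replace (g y - g x) with ((g y - g x - (f y - f x)) + (f y - f x)) by ring.
  eapply Rle_lt_trans; [apply Rabs_triang|]. lra.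
Qed.

Lemma derive_ent x : -1 < x < 1 -> derivable_pt_lim ent x ((ln (1 + x) - ln (1 - x)) / 2).
Proof.
  intros Hx. apply is_derive_Reals. unfold ent. auto_derive; [lra|].
  replace (1 + - x) with (1 - x) by ring. field. lra.
Qed.

Lemma atanh_cont x : -1 < x < 1 -> continuity_pt (fun x => (ln (1 + x) - ln (1 - x)) / 2) x.
Proof. intros Hx. apply continuity_pt_of_ex_derive. auto_derive. lra. Qed.

Lemma atanh_large (M : R) : exists delta, 0 < delta /\ forall x, 1 - delta < x < 1 -> M < (ln (1 + x) - ln (1 - x)) / 2.
Proof.
  pose proof (exp_pos (- 2 * M)) as Hp. set (d := Rmin 1 (exp (- 2 * M))).
  assert (Hd : 0 < d) by (apply Rmin_pos; lra).
  exists d. split; [exact Hd|]. intros x Hx.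
  assert (H1 : d <= 1) by apply Rmin_l. assert (H2 : d <= exp (- 2 * M)) by apply Rmin_r.
  assert (0 < ln (1 + x)) by (rewrite <- ln_1; apply ln_increasing; lra).
  assert (ln (1 - x) < - 2 * M) by (rewrite <- (ln_exp (- 2 * M)); apply ln_increasing; lra). lra.
Qed.

Lemma atanh_low (M : R) : exists delta, 0 < delta /\ forall x, -1 < x < -1 + delta -> (ln (1 + x) - ln (1 - x)) / 2 < M.
Proof.
  destruct (atanh_large (- M)) as (d & Hd & H). exists d. split; [exact Hd|]. intros x Hx.
  specialize (H (- x) ltac:(lra)). replace (1 + - x) with (1 - x) in H by ring. replace (1 - - x) with (1 + x) in H by ring. lra.
Qed.

(** The infinite boundary slopes come from atanh, and a bounded correction leaves them infinite. *)
Lemma C1partial_of_bounded_shift (g B : R -> R) (K : R) : cont_on_K g ->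
  (forall x, -1 < x < 1 -> derivable_pt_lim g x ((ln (1 + x) - ln (1 - x)) / 2 - B x)) ->
  (forall x, -1 < x < 1 -> continuity_pt B x) ->
  (forall x, -1 < x < 1 -> Rabs (B x) <= K) -> C1partial g.
Proof.
  intros Hc Hd HB HK. split; [exact Hc|].
  exists (fun x => (ln (1 + x) - ln (1 - x)) / 2 - B x). repeat split.
  - apply Hd; assumption.
  - apply continuity_pt_minus; [apply atanh_cont; assumption | apply HB; assumption].
  - intros M. destruct (atanh_large (M + K)) as (d & Hd' & H). exists (Rmin d 1).
    pose proof (Rmin_l d 1). pose proof (Rmin_r d 1). split; [apply Rmin_pos; lra|].
    intros x Hx. specialize (H x ltac:(lra)). specialize (HK x ltac:(lra)). pose proof (Rle_abs (B x)). lra.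
  - intros M. destruct (atanh_low (M - K)) as (d & Hd' & H). exists (Rmin d 1).
    pose proof (Rmin_l d 1). pose proof (Rmin_r d 1). split; [apply Rmin_pos; lra|].
    intros x Hx. specialize (H x ltac:(lra)). specialize (HK x ltac:(lra)).
    pose proof (Rle_abs (- B x)) as HR. rewrite Rabs_Ropp in HR. lra.
Qed.

Lemma derive_I0 alpha theta x : -1 < x < 1 ->
  derivable_pt_lim (I0 alpha theta) x ((ln (1 + x) - ln (1 - x)) / 2 - alpha * x - theta).
Proof.
  intros Hx. apply is_derive_Reals. unfold I0, J0. auto_derive; [lra|].
  replace (1 + - x) with (1 - x) by ring. field. lra.
Qed.

Lemma C1partial_It_0 alpha theta : C1partial (It alpha theta 0).
Proof.
  assert (E : forall b, It alpha theta 0 b = I0 alpha theta b).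
  { intros b. unfold It. destruct (Rlt_dec 0 0); [lra | reflexivity]. }
  apply C1partial_of_bounded_shift with (fun x => alpha * x + theta) (Rabs alpha + Rabs theta).
  - apply cont_on_K_of_Lipschitz_diff with ent (Rabs alpha + Rabs theta);
      [pose proof (Rabs_pos alpha); pose proof (Rabs_pos theta); lra | apply ent_cont_on_K |].
    intros b b' Hb Hb'. rewrite !E, !I0_ent.
    replace (_ - _) with (- (alpha * ((b + b') / 2) + theta) * (b' - b)) by field.
    rewrite Rabs_mult, Rabs_Ropp. apply Rmult_le_compat_r; [apply Rabs_pos|].
    eapply Rle_trans; [apply Rabs_triang|]. rewrite Rabs_mult.
    assert (Rabs ((b + b') / 2) <= 1) by (apply Rabs_le; lra). pose proof (Rabs_pos alpha). nra.
  - intros x Hx. apply derivable_pt_lim_ext with (I0 alpha theta); [intros; symmetry; apply E|].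
    replace (_ - _) with ((ln (1 + x) - ln (1 - x)) / 2 - alpha * x - theta) by ring. apply derive_I0, Hx.
  - intros x _. reg.
  - intros x Hx. eapply Rle_trans; [apply Rabs_triang|]. rewrite Rabs_mult.
    assert (Rabs x <= 1) by (apply Rabs_le; lra). pose proof (Rabs_pos alpha). nra.
Qed.

(** Total derivative in m of [Psi (alpha * m + theta) m], written with h = alpha m + theta. *)
Definition dPsi (alpha h m : R) : R := (1 - 2 * alpha) * cosh (2 * h) + 2 * alpha * m * sinh (2 * h).

Lemma derive_Xt alpha theta t m :
  derivable_pt_lim (Xt alpha theta t) m (cosh (2 * t) + sinh (2 * t) * dPsi alpha (alpha * m + theta) m).
Proof.
  apply is_derive_Reals. unfold Xt, Gam, Psi, dPsi.
  set (ct := cosh (2 * t)). set (st := sinh (2 * t)). unfold cosh, sinh.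
  auto_derive; [exact I|]. field.
Qed.

Lemma continuity_Xt alpha theta t m : continuity_pt (Xt alpha theta t) m.
Proof. apply derivable_continuous_pt. eexists. apply derive_Xt. Qed.

Lemma IVT_value (f : R -> R) a b v : a < b -> (forall x, continuity_pt f x) -> f a < v -> v < f b ->
  exists c, a < c < b /\ f c = v.
Proof.
  intros Hab Hf Ha Hb.
  destruct (Ranalysis5.IVT_interv (fun x => f x - v) a b) as (c & Hc1 & Hc2); try lra.
  - intros x _. apply continuity_pt_minus; [apply Hf | apply continuity_cst].
  - exists c. split; [|lra]. destruct (Req_dec c a) as [->|]; [lra|]. destruct (Req_dec c b) as [->|]; lra.
Qed.

(** Initial points outside [l,r] are allowed provided that their characteristics have left (-1,1) on
    their own side: they never minimise for interior b. The minimiser M b is then the inverse of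
    X_t, continuous by strict monotonicity, and I_t has the derivative atanh b - B (M b), where B is
    [field_B] of the field. *)
Theorem C1partial_of_monotone_Xt alpha theta t l r : 0 <= alpha -> 0 < t ->
  -1 <= l -> l < r -> r <= 1 ->
  (forall m m', l <= m -> m < m' -> m' <= r -> Xt alpha theta t m < Xt alpha theta t m') ->
  (forall m, -1 <= m <= l -> Xt alpha theta t m <= -1) ->
  (forall m, r <= m <= 1 -> 1 <= Xt alpha theta t m) ->
  C1partial (It alpha theta t).
Proof.
  intros Ha Ht Hl Hlr Hr Hmono Hleft Hright.
  assert (HM : forall b, exists m, -1 < b < 1 -> l < m < r /\ Xt alpha theta t m = b).
  { intros b. destruct (classic (-1 < b < 1)) as [Hb|Hb]; [|exists 0; tauto].
    destruct (IVT_value (Xt alpha theta t) l r b Hlr) as (m & Hm & Hmb).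
    - intros; apply continuity_Xt.
    - specialize (Hleft l ltac:(lra)). lra.
    - specialize (Hright r ltac:(lra)). lra.
    - exists m. auto. }
  apply choice in HM. destruct HM as [M HM].
  assert (Hmin : forall b, -1 < b < 1 -> forall m', -1 <= m' <= 1 -> Phi alpha theta t (M b) b <= Phi alpha theta t m' b).
  { intros b Hb m' Hm'. destruct (HM b Hb) as [H1 H2].
    destruct (Rtotal_order (M b) m') as [H|[<-|H]]; [| lra |].
    - destruct (Phi_increment alpha theta t b _ _ Ht H) as (c & q & Hc & Hq & E).
      assert (b <= Xt alpha theta t c).
      { destruct (Rle_or_lt c r).
        - rewrite <- H2. left. apply Hmono; lra.
        - specialize (Hright c ltac:(lra)). lra. }
      assert (0 <= alpha * q * (Xt alpha theta t c - b)) by (apply Rmult_le_pos; [apply Rmult_le_pos; lra | lra]). lra.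
    - destruct (Phi_increment alpha theta t b _ _ Ht H) as (c & q & Hc & Hq & E).
      assert (Xt alpha theta t c <= b).
      { destruct (Rle_or_lt l c).
        - rewrite <- H2. left. apply Hmono; lra.
        - specialize (Hleft c ltac:(lra)). lra. }
      assert (0 <= alpha * q * (b - Xt alpha theta t c)) by (apply Rmult_le_pos; [apply Rmult_le_pos; lra | lra]). lra. }
  assert (HMc : forall b, -1 < b < 1 -> continuity_pt M b).
  { intros b Hb e He. destruct (HM b Hb) as [H1 H2].
    set (q := Rmin (e / 2) (Rmin ((M b - l) / 2) ((r - M b) / 2))).
    assert (Hq : 0 < q) by (unfold q; repeat apply Rmin_pos; lra).
    assert (Hq1 : q <= e / 2) by apply Rmin_l.
    assert (Hq2 : q <= (M b - l) / 2) by (eapply Rle_trans; [apply Rmin_r | apply Rmin_l]).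
    assert (Hq3 : q <= (r - M b) / 2) by (eapply Rle_trans; [apply Rmin_r | apply Rmin_r]).
    assert (X1 : Xt alpha theta t (M b - q) < b) by (apply Rlt_le_trans with (Xt alpha theta t (M b)); [apply Hmono; lra | lra]).
    assert (X2 : b < Xt alpha theta t (M b + q)) by (apply Rle_lt_trans with (Xt alpha theta t (M b)); [lra | apply Hmono; lra]).
    set (d := Rmin (Rmin (b - Xt alpha theta t (M b - q)) (Xt alpha theta t (M b + q) - b)) (Rmin (1 - b) (b + 1))).
    assert (Hd : 0 < d) by (unfold d; repeat apply Rmin_pos; lra).
    assert (D1 : d <= b - Xt alpha theta t (M b - q)) by (eapply Rle_trans; [apply Rmin_l | apply Rmin_l]).
    assert (D2 : d <= Xt alpha theta t (M b + q) - b) by (eapply Rle_trans; [apply Rmin_l | apply Rmin_r]).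
    assert (D3 : d <= 1 - b) by (eapply Rle_trans; [apply Rmin_r | apply Rmin_l]).
    assert (D4 : d <= b + 1) by (eapply Rle_trans; [apply Rmin_r | apply Rmin_r]).
    exists d. split; [exact Hd|]. intros b' [_ Hb']. simpl in *. unfold Rdist in *. apply Rabs_def2 in Hb'.
    destruct (HM b' ltac:(lra)) as [H3 H4].
    assert (M b - q < M b').
    { apply Rnot_le_lt. intros Hle. destruct Hle as [Hlt|E].
      - assert (Xt alpha theta t (M b') < Xt alpha theta t (M b - q)) by (apply Hmono; lra). lra.
      - rewrite E in H4. lra. }
    assert (M b' < M b + q).
    { apply Rnot_le_lt. intros Hle. destruct Hle as [Hlt|E].
      - assert (Xt alpha theta t (M b + q) < Xt alpha theta t (M b')) by (apply Hmono; lra). lra.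
      - rewrite <- E in H4. lra. }
    apply Rabs_def1; lra. }
  assert (HBc : forall h, continuity_pt (fun h => field_B h t) h).
  { intros h. apply continuity_pt_of_ex_derive. unfold field_B.
    pose proof (wp_pos h t ltac:(lra)). pose proof (wm_pos h t ltac:(lra)).
    unfold wp, wm in *. auto_derive. unfold Rminus in *. auto. }
  assert (HBM : forall b, -1 < b < 1 -> continuity_pt (fun b => field_B (alpha * M b + theta) t) b).
  { intros b Hb. refine (continuity_pt_comp (fun b => alpha * M b + theta) (fun h => field_B h t) b _ _); [|apply HBc].
    apply continuity_pt_plus; [apply continuity_pt_mult; [|apply HMc, Hb]|]; apply continuity_cst. }
  apply C1partial_of_bounded_shift with (fun b => field_B (alpha * M b + theta) t) (alpha + Rabs theta).
  - apply cont_on_K_of_Lipschitz_diff with ent (alpha + Rabs theta);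
      [pose proof (Rabs_pos theta); lra | apply ent_cont_on_K |].
    intros; apply It_near_ent; assumption.
  - intros b Hb e He.
    destruct (derive_ent b Hb (e / 2)) as ([d1 Hd1] & He1); [lra|]. simpl in He1.
    destruct (HBM b Hb (e / 2)) as (d2 & Hd2 & He2); [lra|]. simpl in He2. unfold Rdist in He2.
    assert (Hd : 0 < Rmin (Rmin d1 d2) (Rmin (1 - b) (b + 1))) by (repeat apply Rmin_pos; lra).
    exists (mkposreal _ Hd). simpl. intros k Hk0 Hk.
    pose proof (Rmin_l (Rmin d1 d2) (Rmin (1 - b) (b + 1))). pose proof (Rmin_r (Rmin d1 d2) (Rmin (1 - b) (b + 1))).
    pose proof (Rmin_l d1 d2). pose proof (Rmin_r d1 d2). pose proof (Rmin_l (1 - b) (b + 1)). pose proof (Rmin_r (1 - b) (b + 1)).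
    specialize (He1 k Hk0 ltac:(lra)).
    assert (Hbk : -1 < b + k < 1) by (apply Rabs_def2 in Hk; lra).
    assert (He2' : Rabs (field_B (alpha * M (b + k) + theta) t - field_B (alpha * M b + theta) t) < e / 2).
    { apply He2. split; [split; [exact I | lra]|]. replace (b + k - b) with k by ring. lra. }
    destruct (HM b Hb) as [Hm1 _]. destruct (HM (b + k) Hbk) as [Hm2 _].
    pose proof (It_upper_tangent alpha theta t (M b) b (b + k) Ha Ht ltac:(lra) ltac:(lra) ltac:(lra) (Hmin b Hb)) as T1.
    pose proof (It_upper_tangent alpha theta t (M (b + k)) (b + k) b Ha Ht ltac:(lra) ltac:(lra) ltac:(lra) (Hmin _ Hbk)) as T2.
    set (B0 := field_B (alpha * M b + theta) t) in *. set (B1 := field_B (alpha * M (b + k) + theta) t) in *.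
    replace (b + k - b) with k in T1 by ring. replace (b - (b + k)) with (- k) in T2 by ring.
    set (dI := It alpha theta t (b + k) - It alpha theta t b) in *.
    set (dE := ent (b + k) - ent b) in *. set (A := (ln (1 + b) - ln (1 - b)) / 2) in *.
    (* The upper tangents at b and at b + k enclose [dI - dE + k * B0] between [- k * (B1 - B0)] and
       0. *)
    assert (S : Rabs (dI - dE + k * B0) <= Rabs k * (e / 2)).
    { assert (Rabs (k * (B1 - B0)) <= Rabs k * (e / 2)) by (rewrite Rabs_mult; apply Rmult_le_compat_l; [apply Rabs_pos | lra]).
      pose proof (Rle_abs (k * (B1 - B0))). pose proof (Rabs_pos (k * (B1 - B0))).
      unfold dI, dE in *. apply Rabs_le. lra. }
    replace (dI / k - (A - B0)) with ((dE / k - A) + (dI - dE + k * B0) / k) by (field; exact Hk0).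
    eapply Rle_lt_trans; [apply Rabs_triang|].
    assert (Rabs ((dI - dE + k * B0) / k) <= e / 2); [|lra].
    unfold Rdiv at 1. rewrite Rabs_mult, Rabs_inv. pose proof (Rabs_pos_lt k Hk0).
    apply Rmult_le_reg_r with (Rabs k); [assumption|]. rewrite Rmult_assoc, Rinv_l by lra. lra.
  - exact HBM.
  - intros b Hb. destruct (HM b Hb). apply field_B_bound_uniform; lra.
Qed.

(** * Non-differentiability at a fold *)

Lemma derivative_at_local_min (f : R -> R) x d r : derivable_pt_lim f x d -> 0 < r ->
  (forall k, Rabs k < r -> f x <= f (x + k)) -> d = 0.
Proof.
  intros Hd Hr Hmin. destruct (Req_dec d 0) as [|Hne]; [assumption | exfalso].
  destruct (Hd (Rabs d)) as ([q Hq] & H); [apply Rabs_pos_lt, Hne|]. simpl in H.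
  assert (Hm : 0 < Rmin q r / 2) by (assert (0 < Rmin q r) by (apply Rmin_pos; lra); lra).
  pose proof (Rmin_l q r). pose proof (Rmin_r q r). set (k := Rmin q r / 2) in *.
  destruct (Rle_or_lt d 0).
  - specialize (H k ltac:(lra)). specialize (Hmin k). rewrite Rabs_right in * by lra.
    specialize (H ltac:(unfold k; lra)). specialize (Hmin ltac:(unfold k; lra)). rewrite (Rabs_left d) in H by lra.
    apply Rabs_def2 in H.
    assert (0 <= (f (x + k) - f x) / k) by (apply Rmult_le_pos; [lra | left; apply Rinv_0_lt_compat; lra]). lra.
  - specialize (H (- k) ltac:(lra)). specialize (Hmin (- k)). rewrite Rabs_Ropp in *. rewrite (Rabs_right k) in * by lra.
    specialize (H ltac:(unfold k; lra)). specialize (Hmin ltac:(unfold k; lra)). rewrite (Rabs_right d) in H by lra.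
    apply Rabs_def2 in H.
    assert (0 <= (f (x + - k) - f x) / k) by (apply Rmult_le_pos; [lra | left; apply Rinv_0_lt_compat; lra]).
    replace ((f (x + - k) - f x) / - k) with (- ((f (x + - k) - f x) / k)) in H by (field; lra). lra.
Qed.

Lemma derivative_of_supporting_line (f : R -> R) x d s r : derivable_pt_lim f x d -> 0 < r ->
  (forall k, Rabs k < r -> f x + s * k <= f (x + k)) -> d = s.
Proof.
  intros Hd Hr H. assert (d - s = 0); [|lra].
  apply (derivative_at_local_min (fun y => f y - s * y) x (d - s) r); [|exact Hr|].
  - apply is_derive_Reals. apply is_derive_Reals in Hd.
    apply (is_derive_minus f (fun y => s * y) x d s); [exact Hd|]. auto_derive; [exact I | ring].
  - intros k Hk. specialize (H k Hk). lra.
Qed.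

Lemma derivable_pt_lim_lt_right (f : R -> R) x d r : derivable_pt_lim f x d -> d < 0 -> 0 < r ->
  exists k, 0 < k < r /\ forall k', 0 < k' <= k -> f (x + k') < f x.
Proof.
  intros Hd Hneg Hr. destruct (Hd (- d)) as ([q Hq] & H); [lra|]. simpl in H.
  pose proof (Rmin_l q r). pose proof (Rmin_r q r). assert (0 < Rmin q r) by (apply Rmin_pos; lra).
  exists (Rmin q r / 2). split; [lra|]. intros k' Hk'.
  specialize (H k' ltac:(lra)). rewrite (Rabs_right k') in H by lra. specialize (H ltac:(lra)).
  apply Rabs_def2 in H. apply Rnot_le_lt. intros Hle.
  assert (0 <= (f (x + k') - f x) / k') by (apply Rmult_le_pos; [lra | left; apply Rinv_0_lt_compat; lra]). lra.
Qed.

Lemma derivable_pt_lim_reflect (f : R -> R) x d : derivable_pt_lim f x d ->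
  derivable_pt_lim (fun y => f (- y)) (- x) (- d).
Proof.
  intros H. apply is_derive_Reals. apply is_derive_Reals in H.
  rewrite <- (Ropp_involutive x) in H at 1.
  evar_last; [apply (is_derive_comp f (fun y => - y) (- x) d (-1) H)|].
  - auto_derive; [exact I | ring].
  - unfold scal; simpl; unfold mult; simpl; ring.
Qed.

Lemma derivable_pt_lim_lt_left (f : R -> R) x d r : derivable_pt_lim f x d -> 0 < d -> 0 < r ->
  exists k, 0 < k < r /\ forall k', 0 < k' <= k -> f (x - k') < f x.
Proof.
  intros Hd Hpos Hr.
  destruct (derivable_pt_lim_lt_right _ _ _ r (derivable_pt_lim_reflect _ _ _ Hd)) as (k & Hk & H); [lra | exact Hr |].
  exists k. split; [exact Hk|]. intros k' Hk'. specialize (H k' Hk').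
  rewrite Ropp_involutive in H. replace (x - k') with (- (- x + k')) by ring. exact H.
Qed.

Lemma continuous_min_interior (f : R -> R) a b da db : a < b ->
  (forall c, a <= c <= b -> exists d, derivable_pt_lim f c d) ->
  derivable_pt_lim f a da -> da < 0 -> derivable_pt_lim f b db -> 0 < db ->
  exists c, a < c < b /\ forall x, a <= x <= b -> f c <= f x.
Proof.
  intros Hab Hf Ha Hda Hb Hdb.
  destruct (continuity_ab_min f a b) as (c & Hc & Hcab); [lra| |].
  - intros c Hc. destruct (Hf c Hc) as [d Hd]. apply derivable_continuous_pt. exists d; exact Hd.
  - exists c. split; [|exact Hc]. split.
    + destruct (Req_dec c a) as [->|]; [exfalso | lra].
      destruct (derivable_pt_lim_lt_right f a da (b - a) Ha Hda) as (k & Hk & H); [lra|].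
      specialize (H k ltac:(lra)). specialize (Hc (a + k) ltac:(lra)). lra.
    + destruct (Req_dec c b) as [->|]; [exfalso | lra].
      destruct (derivable_pt_lim_lt_left f b db (b - a) Hb Hdb) as (k & Hk & H); [lra|].
      specialize (H k ltac:(lra)). specialize (Hc (b - k) ltac:(lra)). lra.
Qed.

(* If [I_t] were differentiable on (-1,1), its derivative would be atanh b - B (M b) for every
   minimiser M b, and by Darboux's property the value B (mc) would be attained; but the critical
   point [mc] lies on the decreasing part of [Xt], so it is never a minimiser. *)
Theorem nondifferentiable_of_fold alpha theta t mc D b1 b2 : 0 < alpha -> 0 < t -> -1 < mc < 1 ->
  derivable_pt_lim (Xt alpha theta t) mc D -> D < 0 ->
  -1 < b1 -> b1 < b2 -> b2 < 1 ->
  (forall m, mc <= m <= 1 -> b1 < Xt alpha theta t m) ->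
  (forall m, -1 <= m <= mc -> Xt alpha theta t m < b2) ->
  exists x, -1 < x < 1 /\ ~ exists l, derivable_pt_lim (It alpha theta t) x l.
Proof.
  intros Ha Ht Hmc HD HDneg Hb1 Hb12 Hb2 HX1 HX2. apply NNPP. intros Hno.
  assert (Hdiff : forall b, -1 < b < 1 -> exists l, derivable_pt_lim (It alpha theta t) b l).
  { intros b Hb. apply NNPP. intros H. apply Hno. exists b. auto. }
  set (beta := field_B (alpha * mc + theta) t).
  set (G := fun b => ent b - It alpha theta t b - beta * b).
  assert (HG : forall b m, -1 < b < 1 -> -1 <= m <= 1 ->
     (forall m', -1 <= m' <= 1 -> Phi alpha theta t m b <= Phi alpha theta t m' b) ->
     derivable_pt_lim G b (field_B (alpha * m + theta) t - beta)).
  { intros b m Hb Hm Hmin. destruct (Hdiff b Hb) as [l Hl].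
    assert (HGd : derivable_pt_lim G b ((ln (1 + b) - ln (1 - b)) / 2 - l - beta)).
    { unfold G. apply (derivable_pt_lim_minus (fun b => ent b - It alpha theta t b) (fun b => beta * b)).
      - apply (derivable_pt_lim_minus ent (It alpha theta t)); [apply derive_ent, Hb | exact Hl].
      - apply is_derive_Reals. auto_derive; [exact I | ring]. }
    rewrite <- (derivative_of_supporting_line G b _ (field_B (alpha * m + theta) t - beta) (Rmin (1 - b) (b + 1)) HGd); auto.
    - apply Rmin_pos; lra.
    - intros k Hk. pose proof (Rmin_l (1 - b) (b + 1)). pose proof (Rmin_r (1 - b) (b + 1)). apply Rabs_def2 in Hk.
      pose proof (It_upper_tangent alpha theta t m b (b + k) ltac:(lra) Ht ltac:(lra) ltac:(lra) Hm Hmin). unfold G. lra. }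
  destruct (Phi_min_exists alpha theta t b1 Ht) as (m1 & Hm1 & Hmin1).
  destruct (Phi_min_exists alpha theta t b2 Ht) as (m2 & Hm2 & Hmin2).
  (* For b1, [Phi] increases in m from mc on, since X_t exceeds b1 there, so its minimiser lies to
     the left of mc; the situation for b2 is symmetric. *)
  assert (L1 : m1 < mc).
  { apply Rnot_le_lt. intros Hle.
    destruct (derivable_pt_lim_lt_left _ _ _ (m1 + 1) (derive_Phi alpha theta t b1 m1 Ht)) as (k & Hk & H).
    - specialize (HX1 m1 ltac:(lra)).
      apply Rdiv_lt_0_compat; [repeat apply Rmult_lt_0_compat; try lra; apply exp_pos|].
      apply Rmult_lt_0_compat; [apply wp_pos | apply wm_pos]; lra.
    - lra.
    - specialize (H k ltac:(lra)). specialize (Hmin1 (m1 - k) ltac:(lra)). lra. }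
  assert (L2 : mc < m2).
  { apply Rnot_le_lt. intros Hle.
    destruct (derivable_pt_lim_lt_right _ _ _ (1 - m2) (derive_Phi alpha theta t b2 m2 Ht)) as (k & Hk & H).
    - specialize (HX2 m2 ltac:(lra)).
      assert (0 < alpha * exp (- 2 * t) * (b2 - Xt alpha theta t m2) / (wp (alpha * m2 + theta) t * wm (alpha * m2 + theta) t)).
      { apply Rdiv_lt_0_compat; [repeat apply Rmult_lt_0_compat; try lra; apply exp_pos|].
        apply Rmult_lt_0_compat; [apply wp_pos | apply wm_pos]; lra. }
      unfold Rdiv in *. lra.
    - lra.
    - specialize (H k ltac:(lra)). specialize (Hmin2 (m2 + k) ltac:(lra)). lra. }
  assert (G1 : derivable_pt_lim G b1 (field_B (alpha * m1 + theta) t - beta)) by (apply HG; auto; lra).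
  assert (G2 : derivable_pt_lim G b2 (field_B (alpha * m2 + theta) t - beta)) by (apply HG; auto; lra).
  assert (Hinj : forall m m', m < m' -> field_B (alpha * m + theta) t < field_B (alpha * m' + theta) t).
  { intros m m' H. apply field_B_incr; [exact Ht|]. assert (alpha * m < alpha * m') by (apply Rmult_lt_compat_l; lra). lra. }
  assert (Hint : exists c, b1 < c < b2 /\ forall x, b1 <= x <= b2 -> G c <= G x).
  { eapply continuous_min_interior; [exact Hb12 | | exact G1 | | exact G2 |].
  - intros b Hb. destruct (Phi_min_exists alpha theta t b Ht) as (m & Hm & Hmin).
    eexists. apply (HG b m); auto; lra.
  - unfold beta. specialize (Hinj _ _ L1). lra.
  - unfold beta. specialize (Hinj _ _ L2). lra. }
  destruct Hint as (c & Hc & Hcmin).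
  - destruct (Phi_min_exists alpha theta t c Ht) as (m & Hm & Hmin).
    assert (Gc : derivable_pt_lim G c (field_B (alpha * m + theta) t - beta)) by (apply HG; auto; lra).
    assert (E : field_B (alpha * m + theta) t - beta = 0).
    { apply (derivative_at_local_min G c _ (Rmin (c - b1) (b2 - c)) Gc); [apply Rmin_pos; lra|].
      intros k Hk. pose proof (Rmin_l (c - b1) (b2 - c)). pose proof (Rmin_r (c - b1) (b2 - c)).
      apply Rabs_def2 in Hk. apply Hcmin; lra. }
    assert (m = mc).
    { destruct (Rtotal_order m mc) as [H|[H|H]]; [|exact H|]; apply Hinj in H; unfold beta in E; lra. }
    subst m.
    assert (E0 : alpha * exp (- 2 * t) * (Xt alpha theta t mc - c) / (wp (alpha * mc + theta) t * wm (alpha * mc + theta) t) = 0).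
    { apply (derivative_at_local_min (fun m => Phi alpha theta t m c) mc _ (Rmin (1 - mc) (mc + 1)) (derive_Phi alpha theta t c mc Ht)); [apply Rmin_pos; lra|].
      intros k Hk. pose proof (Rmin_l (1 - mc) (mc + 1)). pose proof (Rmin_r (1 - mc) (mc + 1)).
      apply Rabs_def2 in Hk. apply Hmin; lra. }
    assert (EX : Xt alpha theta t mc = c).
    { assert (0 < alpha * exp (- 2 * t)) by (apply Rmult_lt_0_compat; [lra | apply exp_pos]).
      assert (0 < wp (alpha * mc + theta) t * wm (alpha * mc + theta) t) by (apply Rmult_lt_0_compat; [apply wp_pos | apply wm_pos]; lra).
      apply Rmult_integral in E0. destruct E0 as [E0|E0].
      - apply Rmult_integral in E0. destruct E0; lra.
      - exfalso. apply (Rinv_neq_0_compat (wp (alpha * mc + theta) t * wm (alpha * mc + theta) t)); [lra | exact E0]. }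
    (* Just to the right of mc, X_t falls below c = X_t mc, so [Phi] decreases there and mc is not a
       minimiser. *)
    destruct (derivable_pt_lim_lt_right _ mc D (1 - mc) HD HDneg) as (k & Hk & Hdec); [lra|].
    destruct (Phi_increment alpha theta t c mc (mc + k) Ht) as (z & q & Hz & Hq & Ez); [lra|].
    specialize (Hdec (z - mc) ltac:(lra)). replace (mc + (z - mc)) with z in Hdec by ring.
    specialize (Hmin (mc + k) ltac:(lra)).
    assert (0 < alpha * q * (c - Xt alpha theta t z)) by (repeat apply Rmult_lt_0_compat; lra). lra.
Qed.

(** * The Hamilton flow and overhangs *)

(** The flow is given explicitly by [Gam] and [pU] along it. The equations must hold slightly beyond
    [0,t]; the formulas need only 1 + Gam, 1 - Gam and both weights to be positive, which persists
    past both ends by continuity. *)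
Lemma Gt_characteristic alpha theta t m : 0 < t -> -1 < m < 1 -> -1 < Xt alpha theta t m < 1 ->
  Gt alpha theta t (Xt alpha theta t m) (pU (alpha * m + theta) t (Xt alpha theta t m)).
Proof.
  intros Ht Hm HX. set (h := alpha * m + theta). unfold Xt in *. fold h in HX |- *.
  exists m, (pU h 0 m). split; [exact Hm|]. split.
  { replace (pU h 0 m) with ((ln (1 + m) - ln (1 - m)) / 2 - alpha * m - theta); [apply derive_I0, Hm|].
    unfold pU. replace (wp h 0) with (exp h) by (unfold wp; rewrite Rmult_0_r, exp_0; field).
    replace (wm h 0) with (exp (- h)) by (unfold wm; rewrite Rmult_0_r, exp_0; field).
    rewrite !ln_exp. unfold h. field. }
  exists (Gam h m), (fun s => pU h s (Gam h m s)). rewrite Gam_0. repeat split; try reflexivity.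
  assert (HC : forall s, continuity_pt (Gam h m) s) by (intros s; apply derivable_continuous_pt; eexists; apply derive_Gam).
  assert (Hin : forall s, 0 <= s <= t -> -1 < Gam h m s < 1).
  { intros s Hs. destruct (Req_dec s t) as [->|]; [exact HX|]. split.
    - apply Gam_gt_earlier with t; lra.
    - apply Gam_lt_earlier with t; lra. }
  assert (Hext : exists d, 0 < d /\ forall s, (Rabs (s - 0) < d \/ Rabs (s - t) < d) ->
     0 < 1 + Gam h m s /\ 0 < 1 - Gam h m s /\ 0 < wp h s /\ 0 < wm h s).
  { assert (Hloc : forall s0, 0 <= s0 <= t -> exists d, 0 < d /\ forall s, Rabs (s - s0) < d ->
       0 < 1 + Gam h m s /\ 0 < 1 - Gam h m s /\ 0 < wp h s /\ 0 < wm h s).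
    { intros s0 Hs0. specialize (Hin s0 Hs0).
      destruct (continuity_pt_locally_gt (fun s => 1 + Gam h m s) s0 0) as (d1 & P1 & Q1); [reg; apply HC | lra |].
      destruct (continuity_pt_locally_gt (fun s => 1 - Gam h m s) s0 0) as (d2 & P2 & Q2); [reg; apply HC | lra |].
      destruct (continuity_pt_locally_gt (fun s => wp h s) s0 0) as (d3 & P3 & Q3);
        [apply continuity_pt_of_ex_derive; eexists; apply derive_wp | apply wp_pos; lra |].
      destruct (continuity_pt_locally_gt (fun s => wm h s) s0 0) as (d4 & P4 & Q4);
        [apply continuity_pt_of_ex_derive; eexists; apply derive_wm | apply wm_pos; lra |].
      exists (Rmin (Rmin d1 d2) (Rmin d3 d4)). split; [repeat apply Rmin_pos; assumption|].
      intros s Hs. pose proof (Rmin_l (Rmin d1 d2) (Rmin d3 d4)). pose proof (Rmin_r (Rmin d1 d2) (Rmin d3 d4)).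
      pose proof (Rmin_l d1 d2). pose proof (Rmin_r d1 d2). pose proof (Rmin_l d3 d4). pose proof (Rmin_r d3 d4).
      repeat split; [apply Q1 | apply Q2 | apply Q3 | apply Q4]; lra. }
    destruct (Hloc 0) as (d1 & P1 & Q1); [lra|]. destruct (Hloc t) as (d2 & P2 & Q2); [lra|].
    exists (Rmin d1 d2). split; [apply Rmin_pos; assumption|]. intros s Hs.
    pose proof (Rmin_l d1 d2). pose proof (Rmin_r d1 d2). destruct Hs; [apply Q1 | apply Q2]; lra. }
  destruct Hext as (d & Hd & Hext). exists d. split; [exact Hd|]. intros s Hs.
  assert (Hs' : 0 < 1 + Gam h m s /\ 0 < 1 - Gam h m s /\ 0 < wp h s /\ 0 < wm h s).
  { destruct (Rlt_or_le s 0); [apply Hext; left; apply Rabs_def1; lra|].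
    destruct (Rlt_or_le t s); [apply Hext; right; apply Rabs_def1; lra|].
    specialize (Hin s ltac:(lra)). repeat split; try lra; [apply wp_pos | apply wm_pos]; lra. }
  destruct Hs' as (A1 & A2 & A3 & A4). set (X := Gam h m s) in *. set (p := pU h s X).
  assert (HXs : -1 < X < 1) by lra.
  pose proof (exp_pU h s X HXs A3 A4) as E1. pose proof (exp_pU_opp h s X HXs A3 A4) as E2. fold p in E1, E2.
  exists (dGam h m s), ((exp (2 * p) - exp (- 2 * p)) / 2). repeat split.
  - apply derive_Gam.
  - apply is_derive_Reals.
    assert (DG : is_derive (fun s => Gam h m s) s (dGam h m s)) by (apply is_derive_Reals, derive_Gam).
    pose proof (derive_wp h s) as Dp. pose proof (derive_wm h s) as Dm.
    assert (E : is_derive (fun s => pU h s (Gam h m s)) s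
      ((dGam h m s / (1 + X) + dGam h m s / (1 - X) - (wm h s - wp h s) / wp h s + (wp h s - wm h s) / wm h s) / 2)).
    { unfold pU. auto_derive.
      - fold X. repeat split; try (eexists; eassumption); lra.
      - fold X. replace (Derive (fun x => Gam h m x) s) with (dGam h m s) by (symmetry; apply is_derive_unique, DG).
        replace (Derive (fun x => wp h x) s) with (wm h s - wp h s) by (symmetry; apply is_derive_unique, Dp).
        replace (Derive (fun x => wm h x) s) with (wp h s - wm h s) by (symmetry; apply is_derive_unique, Dm).
        field. lra. }
    evar_last; [exact E|]. rewrite E1, E2, (dGam_ode h m s A3 A4). fold X. field. lra.
  - apply is_derive_Reals. unfold Ham. auto_derive; [exact I|].
    rewrite (dGam_ode h m s A3 A4). fold X. fold p. rewrite E1, E2. field. lra.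
  - apply is_derive_Reals. unfold Ham. fold p. auto_derive; [exact I|]. field.
Qed.

(** At a common position the two momenta differ exactly by the values of [field_B], which is
    strictly increasing in the field. *)
Theorem overhang_of_collision alpha theta t m1 m2 : 0 < alpha -> 0 < t ->
  -1 < m1 < 1 -> -1 < m2 < 1 -> m1 <> m2 -> Xt alpha theta t m1 = Xt alpha theta t m2 ->
  -1 < Xt alpha theta t m1 < 1 -> overhang alpha theta t.
Proof.
  intros Ha Ht H1 H2 Hne E HX.
  exists (Xt alpha theta t m1), (pU (alpha * m1 + theta) t (Xt alpha theta t m1)), (pU (alpha * m2 + theta) t (Xt alpha theta t m2)).
  split; [|split].
  - rewrite <- E. unfold pU. intros Heq.
    assert (EB : field_B (alpha * m1 + theta) t = field_B (alpha * m2 + theta) t) by (unfold field_B; lra).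
    destruct (Rtotal_order m1 m2) as [H|[H|H]]; [|contradiction|].
    + assert (alpha * m1 < alpha * m2) by (apply Rmult_lt_compat_l; lra).
      pose proof (field_B_incr (alpha * m1 + theta) (alpha * m2 + theta) t Ht ltac:(lra)). lra.
    + assert (alpha * m2 < alpha * m1) by (apply Rmult_lt_compat_l; lra).
      pose proof (field_B_incr (alpha * m2 + theta) (alpha * m1 + theta) t Ht ltac:(lra)). lra.
  - apply Gt_characteristic; assumption.
  - rewrite E. apply Gt_characteristic; try assumption. rewrite <- E. exact HX.
Qed.

(** * Long times *)

(** Coefficient of sinh 2t once exp (-2t) m has been split off from X_t: where it is nonzero, the
    characteristic eventually leaves (-1,1) on the side of its sign. *)
Definition Drift (alpha theta m : R) : R := m + Psi (alpha * m + theta) m.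

Lemma cosh_sinh_exp y : cosh y = exp (- y) + sinh y.
Proof. unfold cosh, sinh. field. Qed.

Lemma Xt_Drift alpha theta t m : Xt alpha theta t m = exp (- (2 * t)) * m + sinh (2 * t) * Drift alpha theta m.
Proof. unfold Xt, Gam, Drift. rewrite (cosh_sinh_exp (2 * t)). ring. Qed.

(** The drift has the sign of the gap m - tanh (alpha m + theta), whose zeros are the critical
    points of I_0. *)
Lemma Drift_tanh alpha theta m : let h := alpha * m + theta in
  Drift alpha theta m = 2 * (cosh h * cosh h) * (m - tanh h).
Proof.
  intros h. unfold Drift, Psi. fold h. rewrite cosh_double, sinh_double. unfold tanh. pose proof (cosh_pos h).
  pose proof (cosh2_sinh2 h) as E.
  transitivity (m * (cosh h * cosh h - sinh h * sinh h) + (m * (cosh h * cosh h + sinh h * sinh h) - 2 * sinh h * cosh h)).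
  - rewrite E. ring.
  - field. lra.
Qed.

Lemma derive_Drift alpha theta m :
  derivable_pt_lim (Drift alpha theta) m (1 + dPsi alpha (alpha * m + theta) m).
Proof.
  apply is_derive_Reals. unfold Drift, Psi, dPsi, cosh, sinh. auto_derive; [exact I|]. field.
Qed.

Lemma cosh_ge1 y : 1 <= cosh y.
Proof. pose proof (cosh2_sinh2 y). pose proof (cosh_pos y). nra. Qed.

Lemma sinh_ge y : 0 <= y -> y <= sinh y.
Proof.
  intros [Hy|<-]; [|rewrite sinh_0; lra].
  destruct (MVT_cor2 sinh cosh 0 y Hy (fun c _ => derivable_pt_lim_sinh c)) as (c & Hc & _).
  rewrite sinh_0 in Hc. pose proof (cosh_ge1 c). nra.
Qed.

Lemma cosh_incr x y : 0 <= x -> x < y -> cosh x < cosh y.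
Proof.
  intros Hx Hxy. destruct (MVT_cor2 cosh sinh x y Hxy (fun c _ => derivable_pt_lim_cosh c)) as (c & Hc & Hc').
  assert (0 < sinh c) by (apply sinh_pos; lra). nra.
Qed.

Lemma cosh_even y : cosh (- y) = cosh y.
Proof. unfold cosh. rewrite Ropp_involutive. field. Qed.

Lemma sinh_odd y : sinh (- y) = - sinh y.
Proof. unfold sinh. rewrite Ropp_involutive. field. Qed.

Lemma tanh_0 : tanh 0 = 0.
Proof. unfold tanh. rewrite sinh_0. unfold Rdiv. ring. Qed.

Lemma tanh_exp y : tanh y = 1 - 2 / (exp (2 * y) + 1).
Proof.
  unfold tanh. rewrite sinh_exp, cosh_exp, exp_double. pose proof (exp_pos y). field. repeat split; nra.
Qed.

Lemma derive_tanh y : derivable_pt_lim tanh y (1 / (cosh y * cosh y)).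
Proof.
  pose proof (cosh_pos y) as Hc. apply is_derive_Reals.
  replace (1 / (cosh y * cosh y)) with ((cosh y * cosh y - sinh y * sinh y) / (cosh y * cosh y)) by (rewrite cosh2_sinh2; reflexivity).
  unfold tanh, cosh, sinh in *. auto_derive; [unfold Rdiv in *; lra|]. field.
  pose proof (exp_pos y). pose proof (exp_pos (- y)). lra.
Qed.

Lemma atanh_tanh y : (ln (1 + tanh y) - ln (1 - tanh y)) / 2 = y.
Proof.
  pose proof (cosh_pos y). pose proof (exp_pos y). pose proof (exp_pos (- y)).
  replace (1 + tanh y) with (exp y / cosh y) by (unfold tanh, sinh, cosh in *; field; lra).
  replace (1 - tanh y) with (exp (- y) / cosh y) by (unfold tanh, sinh, cosh in *; field; lra).
  rewrite !ln_div, !ln_exp by assumption. field.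
Qed.

Lemma tanh_atanh x : -1 < x < 1 -> tanh ((ln (1 + x) - ln (1 - x)) / 2) = x.
Proof.
  intros Hx. rewrite tanh_exp.
  replace (2 * ((ln (1 + x) - ln (1 - x)) / 2)) with (ln (1 + x) + - ln (1 - x)) by field.
  rewrite exp_plus, exp_Ropp, !exp_ln by lra. field. lra.
Qed.

Lemma I0_critical_iff alpha theta x : -1 < x < 1 ->
  (derivable_pt_lim (I0 alpha theta) x 0 <-> x = tanh (alpha * x + theta)).
Proof.
  intros Hx. pose proof (derive_I0 alpha theta x Hx) as H. split; intros H0.
  - pose proof (uniqueness_limite _ _ _ _ H H0) as E.
    rewrite <- (tanh_atanh x Hx) at 1. f_equal. lra.
  - replace 0 with ((ln (1 + x) - ln (1 - x)) / 2 - alpha * x - theta); [exact H|].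
    rewrite H0 at 1 2. rewrite atanh_tanh. ring.
Qed.

Lemma derive_gap alpha theta m :
  derivable_pt_lim (fun m => m - tanh (alpha * m + theta)) m
    (1 - alpha / (cosh (alpha * m + theta) * cosh (alpha * m + theta))).
Proof.
  apply is_derive_Reals. pose proof (derive_tanh (alpha * m + theta)) as H. apply is_derive_Reals in H.
  evar_last.
  - apply (is_derive_minus (fun m => m) (fun m => tanh (alpha * m + theta)) m 1).
    + apply (is_derive_id m).
    + apply (is_derive_comp tanh (fun m => alpha * m + theta) m _ alpha H). auto_derive; [exact I | ring].
  - unfold minus, plus, opp, scal; simpl. unfold mult; simpl. pose proof (cosh_pos (alpha * m + theta)). field. lra.
Qed.

(** Product rule for the drift written as 2 cosh^2 h times the gap; at a zero of the gap only the
    first term survives. *)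
Lemma dPsi_gap alpha h m :
  1 + dPsi alpha h m = 2 * (cosh h * cosh h) * (1 - alpha / (cosh h * cosh h)) + 4 * alpha * (cosh h * sinh h) * (m - tanh h).
Proof.
  unfold dPsi, tanh. rewrite cosh_double, sinh_double. pose proof (cosh_pos h).
  transitivity (2 * (cosh h * cosh h) - 2 * alpha * (cosh h * cosh h - sinh h * sinh h)
     + 4 * alpha * (cosh h * sinh h) * m - 4 * alpha * (sinh h * sinh h)
     + (1 - (cosh h * cosh h - sinh h * sinh h))).
  - ring.
  - rewrite (cosh2_sinh2 h). field. lra.
Qed.

Lemma continuity_dPsi alpha theta m : continuity_pt (fun m => dPsi alpha (alpha * m + theta) m) m.
Proof.
  apply continuity_pt_of_ex_derive. unfold dPsi, cosh, sinh. auto_derive. exact I.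
Qed.

(* If the zero [x] of the gap is degenerate and [x <> 0], strict concavity of tanh on the half-line
   of [x] prevents the gap from changing sign there; so degeneracy forces alpha = 1 and theta = 0. *)
Lemma Drift_mono_near_zero alpha theta x : 0 <= alpha -> -1 < x < 1 -> x = tanh (alpha * x + theta) ->
  (forall m, -1 <= m < x -> m - tanh (alpha * m + theta) < 0) ->
  (forall m, x < m <= 1 -> 0 < m - tanh (alpha * m + theta)) ->
  exists r, 0 < r /\ -1 < x - r /\ x + r < 1 /\
    forall m, x - r < m < x + r -> 0 <= 1 + dPsi alpha (alpha * m + theta) m.
Proof.
  intros Ha Hx Hz Hneg Hpos. set (h := alpha * x + theta) in *.
  assert (Hr0 : 0 < Rmin (x + 1) (1 - x) / 2) by (assert (0 < Rmin (x + 1) (1 - x)) by (apply Rmin_pos; lra); lra).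
  pose proof (Rmin_l (x + 1) (1 - x)). pose proof (Rmin_r (x + 1) (1 - x)).
  set (r0 := Rmin (x + 1) (1 - x) / 2) in *.
  assert (Hr1 : -1 < x - r0 /\ x + r0 < 1) by (unfold r0; lra).
  pose proof (cosh_pos h) as Hc. assert (Hcc : 0 < cosh h * cosh h) by (apply Rmult_lt_0_compat; assumption).
  pose proof (derive_gap alpha theta x) as Dg. fold h in Dg.
  pose proof (dPsi_gap alpha h x) as EP. rewrite <- Hz, Rminus_diag, Rmult_0_r, Rplus_0_r in EP.
  destruct (Rtotal_order (1 - alpha / (cosh h * cosh h)) 0) as [Hs|[Hs|Hs]].
  - exfalso. destruct (derivable_pt_lim_lt_right _ x _ (1 - x) Dg Hs) as (k & Hk & H2); [lra|].
    specialize (H2 k ltac:(lra)). fold h in H2. rewrite <- Hz in H2. specialize (Hpos (x + k) ltac:(lra)). lra.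
  - assert (Hac : alpha = cosh h * cosh h).
    { apply Rmult_eq_reg_r with (/ (cosh h * cosh h)); [|apply Rinv_neq_0_compat; lra]. rewrite Rinv_r by lra. unfold Rdiv in Hs. lra. }
    assert (Ha1 : 1 <= alpha) by (pose proof (cosh_ge1 h); nra).
    assert (Hdec : forall y, cosh y < cosh h -> 1 - alpha / (cosh y * cosh y) < 0).
    { intros y Hy. pose proof (cosh_pos y). assert (0 < cosh y * cosh y) by (apply Rmult_lt_0_compat; assumption).
      assert (1 < alpha / (cosh y * cosh y)); [|lra].
      apply Rmult_lt_reg_r with (cosh y * cosh y); [assumption|]. rewrite Rdiv_mult by lra. rewrite Hac. nra. }
    destruct (Rtotal_order h 0) as [Hh|[Hh|Hh]].
    (* This k keeps the field between h and h / 2, where cosh is below cosh h; the gap then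
       decreases to the right of x, against its sign. *)
    + exfalso. set (k := Rmin r0 (- h / (2 * alpha))).
      assert (Hk : 0 < k) by (apply Rmin_pos; [lra | apply Rdiv_lt_0_compat; lra]).
      assert (Hk1 : k <= r0) by apply Rmin_l. assert (Hk2 : k <= - h / (2 * alpha)) by apply Rmin_r.
      assert (Hk3 : alpha * k <= - h / 2).
      { apply Rle_trans with (alpha * (- h / (2 * alpha))); [apply Rmult_le_compat_l; lra|]. right. field. lra. }
      destruct (MVT_cor2 _ _ x (x + k) ltac:(lra) (fun c _ => derive_gap alpha theta c)) as (c & Hc1 & Hc2).
      cbv beta in Hc1. fold h in Hc1. rewrite <- Hz in Hc1. specialize (Hpos (x + k) ltac:(lra)).
      specialize (Hdec (alpha * c + theta)).
      assert (alpha * x < alpha * c) by (apply Rmult_lt_compat_l; lra).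
      assert (alpha * c < alpha * (x + k)) by (apply Rmult_lt_compat_l; lra).
      assert (cosh (alpha * c + theta) < cosh h).
      { rewrite <- (cosh_even (alpha * c + theta)), <- (cosh_even h). apply cosh_incr; unfold h in *; lra. }
      specialize (Hdec H3). nra.
    + assert (Hx0 : x = 0) by (rewrite Hz, Hh; apply tanh_0).
      assert (Hth : theta = 0) by (unfold h in Hh; rewrite Hx0 in Hh; lra).
      assert (Hal : alpha = 1) by (rewrite Hac, Hh, cosh_0; ring).
      exists r0. split; [lra|]. split; [lra|]. split; [lra|]. intros m _. rewrite Hal, Hth.
      replace (1 * m + 0) with m by ring.
      (* Here 1 + dPsi = 4 m sinh m cosh m - 2 sinh^2 m, which is nonnegative because sinh m <= m
         cosh m. *)
      assert (Heven : forall m, 0 <= m -> 0 <= 1 + dPsi 1 m m).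
      { clear. intros m [Hm|<-].
        - unfold dPsi. rewrite cosh_double, sinh_double.
          destruct (MVT_cor2 sinh cosh 0 m Hm (fun c _ => derivable_pt_lim_sinh c)) as (c & Hc & Hc').
          rewrite sinh_0 in Hc. assert (cosh c < cosh m) by (apply cosh_incr; lra).
          pose proof (sinh_pos m Hm). pose proof (cosh2_sinh2 m). pose proof (cosh_pos m).
          assert (sinh m <= m * cosh m) by nra.
          assert (sinh m * sinh m <= sinh m * (m * cosh m)) by (apply Rmult_le_compat_l; lra).
          nra.
        - unfold dPsi. rewrite Rmult_0_r, cosh_0. lra. }
      destruct (Rle_or_lt 0 m) as [Hm|Hm]; [apply Heven, Hm|].
      replace (1 + dPsi 1 m m) with (1 + dPsi 1 (- m) (- m)); [apply Heven; lra|].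
      unfold dPsi. replace (2 * - m) with (- (2 * m)) by ring. rewrite cosh_even, sinh_odd. ring.
    + exfalso. set (k := Rmin r0 (h / (2 * alpha))).
      assert (Hk : 0 < k) by (apply Rmin_pos; [lra | apply Rdiv_lt_0_compat; lra]).
      assert (Hk1 : k <= r0) by apply Rmin_l. assert (Hk2 : k <= h / (2 * alpha)) by apply Rmin_r.
      assert (Hk3 : alpha * k <= h / 2).
      { apply Rle_trans with (alpha * (h / (2 * alpha))); [apply Rmult_le_compat_l; lra|]. right. field. lra. }
      destruct (MVT_cor2 _ _ (x - k) x ltac:(lra) (fun c _ => derive_gap alpha theta c)) as (c & Hc1 & Hc2).
      cbv beta in Hc1. fold h in Hc1. rewrite <- Hz in Hc1. specialize (Hneg (x - k) ltac:(lra)).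
      specialize (Hdec (alpha * c + theta)).
      assert (alpha * c < alpha * x) by (apply Rmult_lt_compat_l; lra).
      assert (alpha * (x - k) < alpha * c) by (apply Rmult_lt_compat_l; lra).
      assert (cosh (alpha * c + theta) < cosh h) by (apply cosh_incr; unfold h in *; lra).
      specialize (Hdec H3). nra.
  - destruct (continuity_pt_locally_gt (fun m => 1 + dPsi alpha (alpha * m + theta) m) x 0) as (d & Hd & H2).
    + apply continuity_pt_plus; [apply continuity_cst | apply continuity_dPsi].
    + fold h. rewrite EP. apply Rmult_lt_0_compat; lra.
    + exists (Rmin d r0). pose proof (Rmin_l d r0). pose proof (Rmin_r d r0).
      split; [apply Rmin_pos; lra|]. split; [lra|]. split; [lra|]. intros m Hm. left. apply H2. apply Rabs_def1; lra.
Qed.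

Lemma continuity_Drift alpha theta m : continuity_pt (Drift alpha theta) m.
Proof. apply derivable_continuous_pt. eexists. apply derive_Drift. Qed.

Lemma cosh_sq_pos y : 0 < cosh y * cosh y.
Proof. apply Rmult_lt_0_compat; apply cosh_pos. Qed.

Lemma Drift_sign_neg alpha theta m : m - tanh (alpha * m + theta) < 0 -> Drift alpha theta m < 0.
Proof. rewrite (Drift_tanh alpha theta m). pose proof (cosh_sq_pos (alpha * m + theta)). nra. Qed.

Lemma Drift_sign_pos alpha theta m : 0 < m - tanh (alpha * m + theta) -> 0 < Drift alpha theta m.
Proof. rewrite (Drift_tanh alpha theta m). pose proof (cosh_sq_pos (alpha * m + theta)). nra. Qed.

Lemma continuous_pos_bound (f : R -> R) a b : a <= b -> (forall x, continuity_pt f x) ->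
  (forall x, a <= x <= b -> 0 < f x) -> exists c, 0 < c /\ forall x, a <= x <= b -> c <= f x.
Proof.
  intros Hab Hf Hpos. destruct (continuity_ab_min f a b Hab) as (c & Hc & Hcab); [intros; apply Hf|].
  exists (f c). split; [apply Hpos, Hcab | exact Hc].
Qed.

Definition monotone_char (alpha theta t : R) : Prop :=
  exists l r, -1 <= l /\ l < r /\ r <= 1 /\
    (forall m m', l <= m -> m < m' -> m' <= r -> Xt alpha theta t m < Xt alpha theta t m') /\
    (forall m, -1 <= m <= l -> Xt alpha theta t m <= -1) /\
    (forall m, r <= m <= 1 -> 1 <= Xt alpha theta t m).

Lemma C1partial_of_monotone_char alpha theta t : 0 <= alpha -> 0 < t -> monotone_char alpha theta t ->
  C1partial (It alpha theta t).
Proof.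
  intros Ha Ht (l & r & H1 & H2 & H3 & H4 & H5 & H6).
  apply (C1partial_of_monotone_Xt alpha theta t l r); assumption.
Qed.

Lemma exp_decay_bounds t m : 0 < t -> -1 <= m <= 1 -> -1 <= exp (- (2 * t)) * m <= 1.
Proof.
  intros Ht Hm. pose proof (exp_pos (- (2 * t))). assert (exp (- (2 * t)) <= 1) by (apply exp_le_1; lra). nra.
Qed.

(** The gap is negative before its only zero x and positive after it. Near x the drift is
    nondecreasing, and the term exp (-2t) m makes X_t strictly increasing. Farther away the drift is
    bounded away from 0, so the characteristics have left (-1,1) after a uniform time. *)
Theorem C1partial_eventually alpha theta : 0 <= alpha ->
  (exists x, -1 < x < 1 /\ derivable_pt_lim (I0 alpha theta) x 0 /\
     forall y, -1 < y < 1 -> derivable_pt_lim (I0 alpha theta) y 0 -> y = x) ->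
  exists tstar, 0 <= tstar /\ forall t, tstar <= t -> C1partial (It alpha theta t).
Proof.
  intros Ha (x & Hx & Hcrit & Huniq). apply I0_critical_iff in Hcrit; [|exact Hx].
  set (gap := fun m => m - tanh (alpha * m + theta)).
  assert (Hgc : forall m, continuity_pt gap m) by (intros m; apply derivable_continuous_pt; eexists; apply derive_gap).
  assert (Hz : forall y, -1 < y < 1 -> gap y = 0 -> y = x).
  { intros y Hy H. apply Huniq; [exact Hy|]. apply I0_critical_iff; [exact Hy|]. unfold gap in H. lra. }
  assert (Hneg : forall m, -1 <= m < x -> gap m < 0).
  { assert (G1 : gap (-1) < 0) by (unfold gap; pose proof (tanh_bound (alpha * -1 + theta)); lra).
    intros m Hm. destruct (Req_dec m (-1)) as [->|Hne]; [exact G1|].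
    apply Rnot_le_lt. intros [H|H].
    - destruct (IVT_value gap (-1) m 0) as (c & Hc & Hc0); auto; [lra|]. apply Hz in Hc0; lra.
    - symmetry in H. apply Hz in H; lra. }
  assert (Hpos : forall m, x < m <= 1 -> 0 < gap m).
  { assert (G1 : 0 < gap 1) by (unfold gap; pose proof (tanh_bound (alpha * 1 + theta)); lra).
    intros m Hm. destruct (Req_dec m 1) as [->|Hne]; [exact G1|].
    apply Rnot_le_lt. intros [H|H].
    - destruct (IVT_value gap m 1 0) as (c & Hc & Hc0); auto; [lra|]. apply Hz in Hc0; lra.
    - apply Hz in H; lra. }
  destruct (Drift_mono_near_zero alpha theta x Ha Hx Hcrit Hneg Hpos) as (r & Hr & Hr1 & Hr2 & Hmono).
  destruct (continuous_pos_bound (Drift alpha theta) (x + r) 1) as (c1 & Hc1 & HD1); [lra | apply continuity_Drift | |].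
  { intros m Hm. apply Drift_sign_pos, Hpos. lra. }
  destruct (continuous_pos_bound (fun m => - Drift alpha theta m) (-1) (x - r)) as (c2 & Hc2 & HD2); [lra | | |].
  { intros m. apply continuity_pt_opp, continuity_Drift. }
  { intros m Hm. assert (Drift alpha theta m < 0); [apply Drift_sign_neg, Hneg; lra | lra]. }
  assert (I1 : 0 < / c1) by (apply Rinv_0_lt_compat; lra). assert (I2 : 0 < / c2) by (apply Rinv_0_lt_compat; lra).
  (* From this time on t c1 >= 1 and t c2 >= 1, so sinh 2t >= 2t makes the drift term at least 2 in
     size, against |exp (-2t) m| <= 1. *)
  exists (1 + / c1 + / c2). split; [lra|]. intros t Ht.
  assert (Ht0 : 0 < t) by lra. assert (Hs : 2 * t <= sinh (2 * t)) by (apply sinh_ge; lra).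
  assert (T1 : 1 <= t * c1) by (apply Rle_trans with (/ c1 * c1); [rewrite Rinv_l; lra | apply Rmult_le_compat_r; lra]).
  assert (T2 : 1 <= t * c2) by (apply Rle_trans with (/ c2 * c2); [rewrite Rinv_l; lra | apply Rmult_le_compat_r; lra]).
  apply C1partial_of_monotone_char; [exact Ha | exact Ht0|].
  exists (x - r), (x + r). repeat split; try lra.
  - intros m m' H1 H2 H3. rewrite !Xt_Drift.
    destruct (MVT_cor2 _ _ m m' H2 (fun c _ => derive_Drift alpha theta c)) as (c & Hc & Hcm).
    specialize (Hmono c ltac:(lra)).
    assert (0 <= Drift alpha theta m' - Drift alpha theta m) by (rewrite Hc; apply Rmult_le_pos; lra).
    pose proof (exp_pos (- (2 * t))).
    assert (exp (- (2 * t)) * m < exp (- (2 * t)) * m') by (apply Rmult_lt_compat_l; lra).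
    assert (0 <= sinh (2 * t) * (Drift alpha theta m' - Drift alpha theta m)) by (apply Rmult_le_pos; lra). lra.
  - intros m Hm. rewrite Xt_Drift. pose proof (exp_decay_bounds t m Ht0 ltac:(lra)). specialize (HD2 m Hm).
    assert (2 * t * c2 <= sinh (2 * t) * - Drift alpha theta m) by (apply Rmult_le_compat; lra). lra.
  - intros m Hm. rewrite Xt_Drift. pose proof (exp_decay_bounds t m Ht0 ltac:(lra)). specialize (HD1 m Hm).
    assert (2 * t * c1 <= sinh (2 * t) * Drift alpha theta m) by (apply Rmult_le_compat; lra). lra.
Qed.

(** * Large fields *)

Definition folded_char (alpha theta t : R) : Prop :=
  exists mc b1 b2, -1 < mc < 1 /\ cosh (2 * t) + sinh (2 * t) * dPsi alpha (alpha * mc + theta) mc < 0 /\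
    -1 < b1 /\ b1 < b2 /\ b2 < 1 /\
    (forall m, mc <= m <= 1 -> b1 < Xt alpha theta t m) /\
    (forall m, -1 <= m <= mc -> Xt alpha theta t m < b2).

Definition colliding_char (alpha theta t : R) : Prop :=
  exists m1 m2, -1 < m1 < 1 /\ -1 < m2 < 1 /\ m1 <> m2 /\ Xt alpha theta t m1 = Xt alpha theta t m2 /\
    -1 < Xt alpha theta t m1 < 1.

(** Spin-flip symmetry, which reduces negative fields to positive ones. The monotone, folded and
    colliding properties are stated through [Xt] and its slope so that they follow this
    reflection. *)
Lemma Xt_opp alpha theta t m : Xt alpha (- theta) t m = - Xt alpha theta t (- m).
Proof.
  unfold Xt. replace (alpha * m + - theta) with (- (alpha * - m + theta)) by ring.
  rewrite <- Gam_opp, Ropp_involutive. reflexivity.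
Qed.

Lemma monotone_char_opp alpha theta t : monotone_char alpha theta t -> monotone_char alpha (- theta) t.
Proof.
  intros (l & r & H1 & H2 & H3 & H4 & H5 & H6). exists (- r), (- l). repeat split; try lra.
  - intros m m' A1 A2 A3. rewrite !Xt_opp. specialize (H4 (- m') (- m)). lra.
  - intros m Hm. rewrite Xt_opp. specialize (H6 (- m)). lra.
  - intros m Hm. rewrite Xt_opp. specialize (H5 (- m)). lra.
Qed.

Lemma folded_char_opp alpha theta t : folded_char alpha theta t -> folded_char alpha (- theta) t.
Proof.
  intros (mc & b1 & b2 & H1 & H2 & H3 & H4 & H5 & H6 & H7). exists (- mc), (- b2), (- b1). repeat split; try lra.
  - replace (dPsi alpha (alpha * - mc + - theta) (- mc)) with (dPsi alpha (alpha * mc + theta) mc); [exact H2|].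
    unfold dPsi. replace (2 * (alpha * - mc + - theta)) with (- (2 * (alpha * mc + theta))) by ring.
    rewrite cosh_even, sinh_odd. ring.
  - intros m Hm. rewrite Xt_opp. specialize (H7 (- m)). lra.
  - intros m Hm. rewrite Xt_opp. specialize (H6 (- m)). lra.
Qed.

Lemma colliding_char_opp alpha theta t : colliding_char alpha theta t -> colliding_char alpha (- theta) t.
Proof.
  intros (m1 & m2 & H1 & H2 & H3 & H4 & H5). exists (- m1), (- m2). rewrite !Xt_opp, !Ropp_involutive.
  repeat split; lra.
Qed.

Lemma Xt_left_end alpha theta t : 0 < t -> Xt alpha theta t (-1) < -1.
Proof.
  intros Ht. unfold Xt, Gam, Psi. set (h := alpha * -1 + theta).
  assert (E : -1 * cosh (2 * h) - sinh (2 * h) = - exp (2 * h)) by (unfold cosh, sinh; field).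
  rewrite E. pose proof (exp_pos (2 * h)). pose proof (cosh_ge1 (2 * t)). pose proof (sinh_pos (2 * t) ltac:(lra)). nra.
Qed.

Lemma Xt_right_end alpha theta t : 0 < t -> 1 < Xt alpha theta t 1.
Proof.
  intros Ht. pose proof (Xt_left_end alpha (- theta) t Ht) as H. rewrite Xt_opp in H.
  replace (- -1) with 1 in H by ring. lra.
Qed.

Lemma Xt_strict_incr alpha theta t l r :
  (forall q, l < q < r -> 0 < cosh (2 * t) + sinh (2 * t) * dPsi alpha (alpha * q + theta) q) ->
  forall m m', l <= m -> m < m' -> m' <= r -> Xt alpha theta t m < Xt alpha theta t m'.
Proof.
  intros H m m' H1 H2 H3.
  destruct (MVT_cor2 _ _ m m' H2 (fun c _ => derive_Xt alpha theta t c)) as (q & Hq & Hqm).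
  specialize (H q ltac:(lra)). nra.
Qed.

Section Large_field.
Variables alpha theta : R.
Hypothesis Ha : 1 < alpha.
Hypothesis Hth : 2 * alpha < theta.

Let hh (m : R) : R := alpha * m + theta.
Let slope (m : R) : R := dPsi alpha (hh m) m.
(** The derivative of [slope] divided by the positive factor [4 * alpha * cosh (2 * hh m)]. *)
Let zz (m : R) : R := alpha * m - (alpha - 1) * tanh (2 * hh m).

Lemma field_large m : -1 <= m <= 1 -> alpha < hh m.
Proof using Ha Hth. intros Hm. unfold hh. nra. Qed.

Lemma derive_zz m : derivable_pt_lim zz m (alpha - 2 * alpha * (alpha - 1) / (cosh (2 * hh m) * cosh (2 * hh m))).
Proof.
  apply is_derive_Reals. pose proof (derive_tanh (2 * hh m)) as H. apply is_derive_Reals in H.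
  evar_last.
  - apply (is_derive_minus (fun m => alpha * m) (fun m => (alpha - 1) * tanh (2 * hh m)) m alpha).
    + auto_derive; [exact I | ring].
    + apply (is_derive_scal (fun m => tanh (2 * hh m)) m (alpha - 1)).
      apply (is_derive_comp tanh (fun m => 2 * hh m) m _ (2 * alpha) H). unfold hh. auto_derive; [exact I | ring].
  - unfold minus, plus, opp, scal; simpl. unfold mult; simpl. pose proof (cosh_pos (2 * hh m)). field. lra.
Qed.

(** Since the field exceeds alpha, cosh^2 at twice the field is above 1 + 4 alpha^2, hence above 2
    (alpha - 1), and the derivative of [zz] is positive. *)
Lemma zz_incr m m' : -1 <= m -> m < m' -> m' <= 1 -> zz m < zz m'.
Proof using Ha Hth.
  intros H1 H2 H3. destruct (MVT_cor2 _ _ m m' H2 (fun c _ => derive_zz c)) as (c & Hc & Hcm).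
  pose proof (field_large c ltac:(lra)) as Hf.
  pose proof (sinh_ge (2 * hh c) ltac:(lra)) as Hs. pose proof (cosh2_sinh2 (2 * hh c)) as Hcs. pose proof (cosh_pos (2 * hh c)) as Hcp.
  assert (Hbig : 2 * (alpha - 1) < cosh (2 * hh c) * cosh (2 * hh c)) by nra.
  assert (0 < alpha - 2 * alpha * (alpha - 1) / (cosh (2 * hh c) * cosh (2 * hh c))).
  { assert (0 < cosh (2 * hh c) * cosh (2 * hh c)) by nra.
    replace (alpha - _) with (alpha * (cosh (2 * hh c) * cosh (2 * hh c) - 2 * (alpha - 1)) / (cosh (2 * hh c) * cosh (2 * hh c))) by (field; lra).
    apply Rdiv_lt_0_compat; [apply Rmult_lt_0_compat; lra | assumption]. }
  assert (0 < zz m' - zz m) by (rewrite Hc; apply Rmult_lt_0_compat; lra). lra.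
Qed.

Lemma derive_slope m : derivable_pt_lim slope m (4 * alpha * cosh (2 * hh m) * zz m).
Proof.
  pose proof (cosh_pos (2 * hh m)) as Hc.
  assert (E : is_derive slope m ((1 - 2 * alpha) * (2 * alpha * sinh (2 * hh m)) + 2 * alpha * sinh (2 * hh m) + 2 * alpha * m * (2 * alpha * cosh (2 * hh m)))).
  { unfold slope, dPsi, hh, cosh, sinh. auto_derive; [exact I|]. field. }
  apply is_derive_Reals. evar_last; [exact E|]. unfold zz, tanh. field. lra.
Qed.

Lemma continuity_pt_Rabs (f : R -> R) x : continuity_pt f x -> continuity_pt (fun y => Rabs (f y)) x.
Proof. intros Hf. exact (continuity_pt_comp f Rabs x Hf (Rcontinuity_abs (f x))). Qed.

Lemma continuity_slope m : continuity_pt slope m.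
Proof. apply derivable_continuous_pt. eexists. apply derive_slope. Qed.

(** [zz] increases from a negative to a positive value, so [slope] has a single valley and X_t has
    at most two critical points for each t > 0. *)
Lemma slope_minimum : exists m0, -1 < m0 < 1 /\ zz m0 = 0 /\
  (forall m, -1 <= m <= 1 -> slope m0 <= slope m) /\
  (forall m m', m0 <= m -> m < m' -> m' <= 1 -> slope m < slope m').
Proof using Ha Hth.
  destruct (IVT_value zz (-1) 1 0) as (m0 & Hm0 & Hz).
  - lra.
  - intros m. apply derivable_continuous_pt. eexists. apply derive_zz.
  - unfold zz. pose proof (tanh_bound (2 * hh (-1))). nra.
  - unfold zz. pose proof (tanh_bound (2 * hh 1)). nra.
  - assert (Hinc : forall m m', m0 <= m -> m < m' -> m' <= 1 -> slope m < slope m').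
    { intros m m' H1 H2 H3. destruct (MVT_cor2 _ _ m m' H2 (fun c _ => derive_slope c)) as (c & Hc & Hcm).
      pose proof (zz_incr m0 c ltac:(lra) ltac:(lra) ltac:(lra)). pose proof (cosh_pos (2 * hh c)).
      assert (0 < slope m' - slope m) by (rewrite Hc; apply Rmult_lt_0_compat; [apply Rmult_lt_0_compat; [apply Rmult_lt_0_compat|]|]; lra). lra. }
    exists m0. repeat split; try lra; auto.
    intros m Hm. destruct (Rtotal_order m m0) as [H|[->|H]]; [|lra|].
    + destruct (MVT_cor2 _ _ m m0 H (fun c _ => derive_slope c)) as (c & Hc & Hcm).
      pose proof (zz_incr c m0 ltac:(lra) ltac:(lra) ltac:(lra)). pose proof (cosh_pos (2 * hh c)).
      assert (0 < 4 * alpha * cosh (2 * hh c) * - zz c * (m0 - m)) by (apply Rmult_lt_0_compat; [apply Rmult_lt_0_compat; [apply Rmult_lt_0_compat|]|]; lra). lra.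
    + left. apply Hinc; lra.
Qed.

Lemma fold_times : exists t0 t1 t2, 0 < t0 /\ t0 < t1 /\ t1 <= t2 /\
  (forall t, 0 < t < t0 -> monotone_char alpha theta t) /\
  (forall t, t0 < t < t2 -> colliding_char alpha theta t) /\
  (forall t, t0 < t < t1 -> folded_char alpha theta t) /\
  (forall t, t2 < t -> monotone_char alpha theta t).
Proof using Ha Hth.
  destruct slope_minimum as (m0 & Hm0 & Hz0 & Hmin & Hinc).
  set (tau := tanh (2 * hh m0)). set (c := cosh (2 * hh m0)).
  assert (Htau : 0 < tau < 1).
  { pose proof (tanh_bound (2 * hh m0)). split; [|unfold tau; lra]. unfold tau. rewrite <- tanh_0.
    apply tanh_incr. pose proof (field_large m0 ltac:(lra)). lra. }
  assert (Ez : alpha * m0 = (alpha - 1) * tau) by (unfold zz in Hz0; fold tau in Hz0; lra).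
  assert (Hm0p : 0 < m0) by nra.
  assert (Hm0lt : m0 < 1 - 1 / alpha).
  { apply Rmult_lt_reg_l with alpha; [lra|]. replace (alpha * (1 - 1 / alpha)) with (alpha - 1) by (field; lra). nra. }
  assert (Hc1 : 1 < c).
  { unfold c. rewrite <- cosh_0. apply cosh_incr; [lra|]. pose proof (field_large m0 ltac:(lra)). lra. }
  assert (Hsh : sinh (2 * hh m0) = c * tau) by (unfold tau, tanh; fold c; field; lra).
  set (K0 := - slope m0).
  assert (EK : K0 = c * (1 + 2 * (alpha - 1) * (1 - tau * tau))).
  { unfold K0, slope, dPsi. rewrite Hsh. fold c.
    replace (2 * alpha * m0 * (c * tau)) with (2 * (alpha * m0) * (c * tau)) by ring. rewrite Ez. ring. }
  (* Thus K0 > 1, which makes coth (2 t0) = K0 solvable; the comparison with c also serves to place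
     the birth point of the fold. *)
  assert (HKc : c <= K0).
  { rewrite EK. assert (0 <= 2 * (alpha - 1) * (1 - tau * tau)) by (apply Rmult_le_pos; nra). nra. }
  (* [t0] solves coth (2 t0) = K0: it is the first time at which [Xt] has a critical point. *)
  set (t0 := ln ((K0 + 1) / (K0 - 1)) / 4).
  assert (Hratio : 1 < (K0 + 1) / (K0 - 1)).
  { apply Rmult_lt_reg_r with (K0 - 1); [lra|]. rewrite Rdiv_mult by lra. lra. }
  assert (Ht0 : 0 < t0).
  { unfold t0. assert (0 < ln ((K0 + 1) / (K0 - 1))) by (rewrite <- ln_1; apply ln_increasing; lra). lra. }
  assert (Esgn : forall t, cosh (2 * t) - K0 * sinh (2 * t) = exp (- (2 * t)) / 2 * (K0 - 1) * (exp (4 * t0) - exp (4 * t))).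
  { intros t. replace (exp (4 * t0)) with ((K0 + 1) / (K0 - 1)).
    - unfold cosh, sinh. replace (4 * t) with (2 * t + 2 * t) by ring. rewrite exp_plus, exp_Ropp.
      pose proof (exp_pos (2 * t)). field. lra.
    - unfold t0. replace (4 * (ln ((K0 + 1) / (K0 - 1)) / 4)) with (ln ((K0 + 1) / (K0 - 1))) by field.
      rewrite exp_ln; lra. }
  assert (Spos : forall t, t < t0 -> 0 < cosh (2 * t) - K0 * sinh (2 * t)).
  { intros t Ht. rewrite Esgn. pose proof (exp_pos (- (2 * t))). assert (exp (4 * t) < exp (4 * t0)) by (apply exp_increasing; lra).
    repeat apply Rmult_lt_0_compat; lra. }
  assert (Sneg : forall t, t0 < t -> cosh (2 * t) - K0 * sinh (2 * t) < 0).
  { intros t Ht. rewrite Esgn. pose proof (exp_pos (- (2 * t))). assert (exp (4 * t0) < exp (4 * t)) by (apply exp_increasing; lra).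
    assert (0 < exp (- (2 * t)) / 2 * (K0 - 1) * (exp (4 * t) - exp (4 * t0))) by (repeat apply Rmult_lt_0_compat; lra). lra. }
  assert (Szero : cosh (2 * t0) = K0 * sinh (2 * t0)) by (pose proof (Esgn t0); rewrite Rminus_diag, Rmult_0_r in H; lra).
  assert (Dneg : forall t, t0 < t -> cosh (2 * t) + sinh (2 * t) * slope m0 < 0).
  { intros t Ht. pose proof (Sneg t Ht). unfold K0 in *. lra. }
  (* m <= m0 < 1 - 1 / alpha <= tanh alpha, the last step because exp (2 alpha) + 1 >= 2 alpha. *)
  assert (Hgap : forall m, -1 <= m <= m0 -> Drift alpha theta m < 0).
  { intros m Hm. apply Drift_sign_neg. fold (hh m).
    assert (tanh alpha <= tanh (hh m)) by (apply tanh_mono; left; apply field_large; lra).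
    assert (1 - 1 / alpha <= tanh alpha); [|lra].
    rewrite tanh_exp. pose proof (exp_ineq1_le (2 * alpha)).
    assert (2 / (exp (2 * alpha) + 1) <= 2 / (2 * alpha)).
    { apply Rmult_le_compat_l; [lra|]. apply Rinv_le_contravar; lra. }
    replace (2 / (2 * alpha)) with (1 / alpha) in H1 by (field; lra). lra. }
  (* As m0 > 0, the factor exp (-2t) and the negative drift keep these positions below m0, which
     will serve as the level b2 of the fold. *)
  assert (Hbelow : forall t m, 0 < t -> -1 <= m <= m0 -> Xt alpha theta t m < m0).
  { intros t m Ht Hm. rewrite Xt_Drift. specialize (Hgap m Hm). pose proof (sinh_pos (2 * t) ltac:(lra)).
    pose proof (exp_pos (- (2 * t))). assert (exp (- (2 * t)) <= 1) by (apply exp_le_1; lra). nra. }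
  (* The fold is born inside (-1,1) because 1 - 2 / alpha > -1. *)
  set (xi := Xt alpha theta t0 m0).
  assert (Hxi : -1 < xi).
  { pose proof (sinh_pos (2 * t0) ltac:(lra)) as Hs0. set (s0 := sinh (2 * t0)) in *.
    assert (E : xi = s0 * (K0 * m0 + (c * m0 - c * tau))).
    { unfold xi, Xt, Gam, Psi. fold (hh m0). rewrite Szero. fold s0. rewrite Hsh. fold c. ring. }
    pose proof (cosh2_sinh2 (2 * t0)) as Q1. rewrite Szero in Q1. fold s0 in Q1.
    pose proof (cosh2_sinh2 (2 * hh m0)) as Q2. rewrite Hsh in Q2. fold c in Q2.
    (* s0^2 = 1 / (K0^2 - 1), while (c tau)^2 = c^2 - 1 <= K0^2 - 1. *)
    assert (Q3 : s0 * (c * tau) <= 1).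
    { apply Rsqr_incr_0_var; [|lra]. unfold Rsqr.
      replace (s0 * (c * tau) * (s0 * (c * tau))) with (s0 * s0 * (c * tau * (c * tau))) by ring.
      replace (c * tau * (c * tau)) with (c * c - 1) by lra.
      replace (1 * 1) with (s0 * s0 * (K0 * K0 - 1)) by lra.
      apply Rmult_le_compat_l; nra. }
    assert (Em : m0 = tau * (1 - 1 / alpha)) by (apply Rmult_eq_reg_l with alpha; [rewrite Ez; field; lra | lra]).
    assert (L : s0 * (c * tau) * (1 - 2 * (1 / alpha)) <= xi).
    { rewrite E. assert (c * m0 <= K0 * m0) by (apply Rmult_le_compat_r; lra).
      replace (s0 * (c * tau) * (1 - 2 * (1 / alpha))) with (s0 * (c * m0 + (c * m0 - c * tau))) by (rewrite Em; ring).
      apply Rmult_le_compat_l; lra. }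
    assert (0 < 1 / alpha < 1).
    { split; [apply Rdiv_lt_0_compat; lra|]. apply Rmult_lt_reg_r with alpha; [lra|]. rewrite Rdiv_mult by lra. lra. }
    assert (Hsct : 0 < s0 * (c * tau)).
    { apply Rmult_lt_0_compat; [exact Hs0 | apply Rmult_lt_0_compat; lra]. }
    nra. }
  (* Midway between -1 and xi, the lowest position at time t0 of the characteristics issued from
     [m0,1]. *)
  set (b1 := (xi - 1) / 2).
  assert (Hxi2 : forall m, m0 <= m <= 1 -> xi <= Xt alpha theta t0 m).
  { intros m [[Hm| <-] Hm']; [|unfold xi; lra].
    left. apply (Xt_strict_incr alpha theta t0 m0 1); try lra.
    intros q Hq. fold (hh q) (slope q). specialize (Hinc m0 q ltac:(lra) ltac:(lra) ltac:(lra)).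
    pose proof (sinh_pos (2 * t0) ltac:(lra)). rewrite Szero. unfold K0. nra. }
  assert (HPsi : exists KP, 0 <= KP /\ forall m, -1 <= m <= 1 -> Rabs (Psi (hh m) m) <= KP).
  { assert (HPc : forall m, continuity_pt (fun m => Rabs (Psi (hh m) m)) m).
    { intros m. apply (continuity_pt_Rabs (fun m => Psi (hh m) m)).
      apply continuity_pt_of_ex_derive. unfold Psi, hh, cosh, sinh. auto_derive. exact I. }
    destruct (continuity_ab_maj (fun m => Rabs (Psi (hh m) m)) (-1) 1) as (q & Hq & _); [lra | intros; apply HPc|].
    exists (Rabs (Psi (hh q) q)). split; [apply Rabs_pos | exact Hq]. }
  destruct HPsi as (KP & HKP & HPsi).
  (* Uniform in m: X_t depends on t only through cosh 2t and sinh 2t, with coefficients bounded by 1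
     and [KP]. *)
  assert (Hnear : exists d, 0 < d /\ forall t, t0 < t < t0 + d -> forall m, m0 <= m <= 1 -> b1 < Xt alpha theta t m).
  { set (w := fun t => - (Rabs (cosh (2 * t) - cosh (2 * t0)) + Rabs (sinh (2 * t) - sinh (2 * t0)) * KP)).
    assert (Hw : continuity_pt w t0).
    { apply continuity_pt_opp, continuity_pt_plus; [|apply continuity_pt_mult;
        [|apply continuity_cst]];
        apply (continuity_pt_Rabs (fun t => _ (2 * t) - _)); apply continuity_pt_of_ex_derive;
        unfold cosh, sinh; auto_derive; exact I. }
    destruct (continuity_pt_locally_gt w t0 (b1 - xi)) as (d & Hd & H); [exact Hw | |].
    { unfold w. rewrite !Rminus_diag, Rabs_R0. unfold b1. lra. }
    exists d. split; [exact Hd|]. intros t Ht m Hm. specialize (H t ltac:(apply Rabs_def1; lra)).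
    specialize (Hxi2 m Hm). unfold w in H. unfold Xt, Gam in Hxi2 |- *. fold (hh m) in Hxi2 |- *. specialize (HPsi m ltac:(lra)).
    set (dc := cosh (2 * t) - cosh (2 * t0)) in *. set (ds := sinh (2 * t) - sinh (2 * t0)) in *.
    assert (E : m * cosh (2 * t) + sinh (2 * t) * Psi (hh m) m = m * cosh (2 * t0) + sinh (2 * t0) * Psi (hh m) m + (dc * m + ds * Psi (hh m) m)) by (unfold dc, ds; ring).
    rewrite E.
    assert (B1 : Rabs (dc * m) <= Rabs dc * 1).
    { rewrite Rabs_mult. apply Rmult_le_compat_l; [apply Rabs_pos|]. apply Rabs_le; lra. }
    assert (B2 : Rabs (ds * Psi (hh m) m) <= Rabs ds * KP) by (rewrite Rabs_mult; apply Rmult_le_compat_l; [apply Rabs_pos | exact HPsi]).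
    apply Rabs_le_between in B1. apply Rabs_le_between in B2. lra. }
  destruct Hnear as (d & Hd & Hnear).
  (* Times at which some characteristic from the left of m0 is still above -1. A characteristic
     inside at one time was inside before, and the uniformly negative drift on [-1,m0] bounds these
     times by [/ cD]; their supremum is t2. *)
  set (alive := fun t => t0 <= t /\ exists m, -1 <= m <= m0 /\ -1 < Xt alpha theta t m).
  assert (Halive : alive (t0 + d / 2)).
  { split; [lra|]. exists m0. split; [lra|]. specialize (Hnear (t0 + d / 2) ltac:(lra) m0 ltac:(lra)). unfold b1 in Hnear. lra. }
  destruct (continuous_pos_bound (fun m => - Drift alpha theta m) (-1) m0) as (cD & HcD & HD); [lra | | |].
  { intros m. apply continuity_pt_opp, continuity_Drift. }
  { intros m Hm. specialize (Hgap m Hm). lra. }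
  destruct (completeness alive) as [t2 [Hub Hlub]].
  { exists (/ cD). intros t [Ht (m & Hm & HX)]. apply Rnot_lt_le. intros Hlt.
    rewrite Xt_Drift in HX. specialize (HD m Hm). pose proof (exp_decay_bounds t m ltac:(lra) ltac:(lra)).
    pose proof (sinh_ge (2 * t) ltac:(lra)).
    assert (1 < t * cD) by (apply Rle_lt_trans with (/ cD * cD); [rewrite Rinv_l; lra | apply Rmult_lt_compat_r; lra]).
    assert (2 * t * cD <= sinh (2 * t) * - Drift alpha theta m) by (apply Rmult_le_compat; lra). lra. }
  { exists (t0 + d / 2). exact Halive. }
  pose proof (Hub _ Halive) as Ht2.
  exists t0, (Rmin (t0 + d) t2), t2.
  pose proof (Rmin_l (t0 + d) t2). pose proof (Rmin_r (t0 + d) t2).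
  split; [exact Ht0|]. split; [unfold Rmin; destruct Rle_dec; lra|]. split; [assumption|].
  repeat split.
  - intros t Ht. exists (-1), 1. repeat split; try lra.
    + apply Xt_strict_incr. intros q Hq. fold (hh q) (slope q). specialize (Hmin q ltac:(lra)).
      pose proof (Spos t ltac:(lra)) as HS. pose proof (sinh_pos (2 * t) ltac:(lra)). unfold K0 in HS. nra.
    + intros m Hm. replace m with (-1) by lra. left. apply Xt_left_end. lra.
    + intros m Hm. replace m with 1 by lra. left. apply Xt_right_end. lra.
  - intros t Ht.
    assert (Hex : exists t', alive t' /\ t < t').
    { apply NNPP. intros Hno. assert (t2 <= t); [|lra]. apply Hlub. intros t' Ht'. apply Rnot_lt_le. intros Hlt. apply Hno. exists t'. auto. }
    destruct Hex as (t' & (Ht' & mh & Hmh & HXh) & Htt').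
    assert (mh <> -1) by (intros ->; pose proof (Xt_left_end alpha theta t' ltac:(lra)); lra).
    assert (HXt : -1 < Xt alpha theta t mh).
    { unfold Xt in *. apply Gam_gt_earlier with t'; lra. }
    (* On [-1,m0] X_t starts below -1 and is descending at m0, so its maximum is interior; a level
       just above both -1 and X_t m0 but below the maximum is attained on either side of it. *)
    destruct (continuity_ab_maj (Xt alpha theta t) (-1) m0) as (a & Hmax & Hma); [lra | intros; apply continuity_Xt |].
    pose proof (Hmax mh Hmh) as Hamh. pose proof (Xt_left_end alpha theta t ltac:(lra)) as HXl.
    assert (a <> -1) by (intros ->; lra).
    assert (Hleft : exists z, -1 <= z <= m0 /\ Xt alpha theta t m0 < Xt alpha theta t z).
    { destruct (derivable_pt_lim_lt_left (fun m => - Xt alpha theta t m) m0 (- (cosh (2 * t) + sinh (2 * t) * slope m0)) (m0 + 1)) as (k & Hk & H').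
      - apply derivable_pt_lim_opp, derive_Xt.
      - pose proof (Dneg t ltac:(lra)). lra.
      - lra.
      - exists (m0 - k). specialize (H' k ltac:(lra)). lra. }
    destruct Hleft as (z & Hz & HXz). pose proof (Hmax z Hz) as Haz.
    assert (a <> m0) by (intros ->; lra).
    pose proof (Hbelow t a ltac:(lra) Hma).
    set (lev := (Xt alpha theta t a + Rmax (-1) (Xt alpha theta t m0)) / 2).
    assert (Hlev : Rmax (-1) (Xt alpha theta t m0) < lev < Xt alpha theta t a).
    { assert (Rmax (-1) (Xt alpha theta t m0) < Xt alpha theta t a) by (apply Rmax_lub_lt; lra). unfold lev. lra. }
    pose proof (Rmax_l (-1) (Xt alpha theta t m0)). pose proof (Rmax_r (-1) (Xt alpha theta t m0)).
    destruct (IVT_value (Xt alpha theta t) (-1) a lev) as (m1 & Hm1 & E1); try lra; [apply continuity_Xt|].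
    destruct (IVT_value (fun m => - Xt alpha theta t m) a m0 (- lev)) as (m2 & Hm2 & E2); try lra.
    { intros m. apply continuity_pt_opp, continuity_Xt. }
    exists m1, m2. repeat split; lra.
  - intros t Ht. exists m0, b1, m0. pose proof (Hbelow t m0 ltac:(lra) ltac:(lra)).
    pose proof (Hnear t ltac:(lra)) as Hn. pose proof (Hn m0 ltac:(lra)).
    assert (-1 < b1) by (unfold b1; lra).
    split; [lra|]. split; [apply Dneg; lra|]. repeat split; try lra; [exact Hn|].
    intros m Hm. apply Hbelow; lra.
  - intros t Ht.
    assert (Hdead : forall m, -1 <= m <= m0 -> Xt alpha theta t m <= -1).
    { intros m Hm. apply Rnot_lt_le. intros Hlt. assert (t <= t2); [|lra]. apply Hub. split; [lra|]. exists m. auto. }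
    pose proof (sinh_pos (2 * t) ltac:(lra)) as Hst.
    assert (Hs1 : 0 < slope 1).
    { pose proof (field_large 1 ltac:(lra)) as Hf. unfold slope, dPsi.
      set (h := hh 1) in *. pose proof (exp_ineq1_le (2 * h)). pose proof (exp_pos (2 * h)) as He.
      assert (E : (1 - 2 * alpha) * cosh (2 * h) + 2 * alpha * 1 * sinh (2 * h) = cosh (2 * h) - 2 * alpha / exp (2 * h)).
      { rewrite cosh_exp, sinh_exp. field. lra. }
      rewrite E. pose proof (cosh_ge1 (2 * h)).
      assert (2 * alpha / exp (2 * h) < 1); [|lra].
      apply Rmult_lt_reg_r with (exp (2 * h)); [exact He|]. rewrite Rdiv_mult by lra. lra. }
    (* l is the critical point of X_t to the right of m0: X_t descends from X_t m0 <= -1 until l and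
       increases afterwards. *)
    destruct (IVT_value (fun m => cosh (2 * t) + sinh (2 * t) * slope m) m0 1 0) as (l & Hl & El); try lra.
    { intros m. apply continuity_pt_plus; [apply continuity_cst|].
      apply continuity_pt_mult; [apply continuity_cst | apply continuity_slope]. }
    { apply Dneg. lra. }
    { pose proof (cosh_pos (2 * t)). assert (0 < sinh (2 * t) * slope 1) by (apply Rmult_lt_0_compat; lra). lra. }
    exists l, 1. repeat split; try lra.
    + apply Xt_strict_incr. intros q Hq. fold (hh q) (slope q).
      specialize (Hinc l q ltac:(lra) ltac:(lra) ltac:(lra)). nra.
    + intros m Hm. destruct (Rle_or_lt m m0) as [Hle|Hlt]; [apply Hdead; lra|].
      destruct (MVT_cor2 _ _ m0 m Hlt (fun c _ => derive_Xt alpha theta t c)) as (q & Hq & Hqm).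
      fold (hh q) in Hq. fold (slope q) in Hq. specialize (Hinc q l ltac:(lra) ltac:(lra) ltac:(lra)).
      assert (sinh (2 * t) * slope q < sinh (2 * t) * slope l) by (apply Rmult_lt_compat_l; lra).
      specialize (Hdead m0 ltac:(lra)).
      assert (0 <= - (cosh (2 * t) + sinh (2 * t) * slope q) * (m - m0)) by (apply Rmult_le_pos; lra). lra.
    + intros m Hm. replace m with 1 by lra. left. apply Xt_right_end. lra.
Qed.
End Large_field.

Theorem mainTheorem8 :
  (* (a) *)
  (forall alpha theta : R, 0 <= alpha ->
     (exists x, -1 < x < 1 /\ derivable_pt_lim (I0 alpha theta) x 0 /\
        forall y, -1 < y < 1 -> derivable_pt_lim (I0 alpha theta) y 0 -> y = x) ->
     exists tstar, 0 <= tstar /\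
       forall t, tstar <= t -> C1partial (It alpha theta t)) /\
  (* (b) *)
  (forall alpha : R, 1 < alpha ->
     exists kappa, 0 < kappa /\
       forall theta, kappa < Rabs theta ->
         exists t0 t1 t2, 0 <= t0 /\ t0 < t1 /\ t1 <= t2 /\
           (forall t, 0 <= t < t0 -> C1partial (It alpha theta t)) /\
           (forall t, t0 < t < t2 -> overhang alpha theta t) /\
           (forall t, t0 < t < t1 ->
              exists x, -1 < x < 1 /\ ~ exists l, derivable_pt_lim (It alpha theta t) x l) /\
           (forall t, t2 < t -> C1partial (It alpha theta t))).
Proof.
  split; [exact C1partial_eventually|].
  intros alpha Ha. exists (2 * alpha). split; [lra|]. intros theta Hth.
  assert (Htimes : exists t0 t1 t2, 0 < t0 /\ t0 < t1 /\ t1 <= t2 /\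
    (forall t, 0 < t < t0 -> monotone_char alpha theta t) /\
    (forall t, t0 < t < t2 -> colliding_char alpha theta t) /\
    (forall t, t0 < t < t1 -> folded_char alpha theta t) /\
    (forall t, t2 < t -> monotone_char alpha theta t)).
  { destruct (Rle_or_lt 0 theta).
    - apply fold_times; [exact Ha|]. rewrite Rabs_right in Hth; lra.
    - rewrite Rabs_left in Hth by assumption.
      destruct (fold_times alpha (- theta) Ha Hth) as (t0 & t1 & t2 & H0 & H1 & H2 & H3 & H4 & H5 & H6).
      exists t0, t1, t2. rewrite <- (Ropp_involutive theta). repeat split; auto; intros t Ht.
      + apply monotone_char_opp; auto.
      + apply colliding_char_opp; auto.
      + apply folded_char_opp; auto.
      + apply monotone_char_opp; auto. }
  destruct Htimes as (t0 & t1 & t2 & H0 & H1 & H2 & H3 & H4 & H5 & H6).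
  exists t0, t1, t2. split; [lra|]. split; [exact H1|]. split; [exact H2|]. split; [|split; [|split]].
  - intros t [[Ht| <-] Ht']; [|apply C1partial_It_0].
    apply C1partial_of_monotone_char; auto; lra.
  - intros t Ht. destruct (H4 t Ht) as (m1 & m2 & A1 & A2 & A3 & A4 & A5).
    apply (overhang_of_collision alpha theta t m1 m2); auto; lra.
  - intros t Ht. destruct (H5 t Ht) as (mc & b1 & b2 & A1 & A2 & A3 & A4 & A5 & A6 & A7).
    apply (nondifferentiable_of_fold alpha theta t mc _ b1 b2) with (4 := derive_Xt alpha theta t mc); auto; lra.
  - intros t Ht. apply C1partial_of_monotone_char; auto; lra.
Qed.
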